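(* Let $\mathfrak u=\bigoplus_{p\ge-1}\mathfrak u^p$ be the $\mathbb Z$-graded subspace of $\widehat{\mathfrak c}$ with component $$\mathfrak u^p=\bigoplus_{1\le\ell\le p+2}S^{\ell,p+2-\ell}\ \oplus\bigoplus_{0\le j\le[p/2]}S^{p-2j}(\widehat{\mathfrak c}^{-1})$$ given by the direct sum of all $\operatorname{ad}(\mathfrak J)$-eigenspaces in $\widehat{\mathfrak c}^p$ of non-minimal eigenvalue, i.e. of eigenvalue different from $-i(p+2)$. Then $\mathfrak u$ is a Lie subalgebra of $\widehat{\mathfrak c}$ and $(\mathfrak c,\mathfrak u)$ is a holomorphically nondegenerate CR algebra. Moreover: (i) the real isotropy algebra is nonnegatively $\mathbb Z$-graded, $\mathfrak c_o=\bigoplus_{p\ge0}\mathfrak c_o^p$, with component $\mathfrak c_o^p=\operatorname{Re}(\mathfrak u^p\cap\overline{\mathfrak u}^p)$, where $$\mathfrak u^p\cap\overline{\mathfrak u}^p=\bigoplus_{1\le\ell\le p+1}S^{\ell,p+2-\ell}\ \oplus\bigoplus_{0\le j\le[p/2]}S^{p-2j}(\widehat{\mathfrak c}^{-1})$$ is the direct sum of all $\operatorname{ad}(\mathfrak J)$-eigenspaces in $\widehat{\mathfrak c}^p$ of eigenvalue different from $\pm i(p+2)$; (ii) the components of the core $\mathfrak M=\bigoplus_{p\ge-2}\mathfrak M^p$ of $(\mathfrak c,\mathfrak u)$ are given by $\mathfrak M^p=\mathfrak c^p$ for $p=-2,-1$ and $\mathfrak M^p=\operatorname{Re}(\mathfrak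 M^{p(10)}\oplus\mathfrak M^{p(01)})$ for all $p\ge0$, where $\mathfrak M^{p(10)}=S^{p+2,0}$ and $\mathfrak M^{p(01)}=\overline{\mathfrak M^{p(10)}}=S^{0,p+2}$ are the $\operatorname{ad}(\mathfrak J)$-eigenspaces in $\widehat{\mathfrak c}^p$ of extremal eigenvalues $\pm i(p+2)$; (iii) any abstract core $\mathfrak m$ of hypersurface type (with $\mathfrak m_-$ together with $J|_{\mathfrak m^{-1}}$ isomorphic to $\mathfrak c_-$ together with $\mathfrak J|_{\mathfrak c^{-1}}$) admits a natural immersion $\varphi:\mathfrak m\to\mathfrak M$.
   Context: **Contact algebra.** Hats denote complexification. $\mathfrak c=\bigoplus_{p\ge-2}\mathfrak c^p$ is the real contact algebra of degree $n$: the maximal transitive prolongation of the Heisenberg algebra $\mathfrak c_-=\mathfrak c^{-2}\oplus\mathfrak c^{-1}$, $\mathfrak c^{-2}=\langle e^{-2}\rangle$, $\dim\mathfrak c^{-1}=2n$, $[v,w]=B(v,w)e^{-2}$ with $B$ a symplectic form (i.e. the maximal graded Lie algebra with this negative part in which $X\in\mathfrak c^p$, $p\ge0$, $[X,\mathfrak c^{-1}]=0$ imply $X=0$). $\mathfrak k^p=\{X\in\mathfrak c^p:[X,\mathfrak c^{-2}]=0\}$, and $\mathfrak k^p\simeq S^{p+2}(\mathfrak c^{-1})$ for $p\ge-1$, with $[v_1\odot\cdots\odot v_{p+2},w_1\odot\cdots\odot w_{q+2}]=\sum_{i,j}B(v_i,w_j)\,v_1\odot\cdots\widehat{v_i}\cdots\odot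 v_{p+2}\odot w_1\odot\cdots\widehat{w_j}\cdots\odot w_{q+2}$ (the hat meaning omission); in particular $\mathfrak k^0=\mathfrak{sp}(\mathfrak c^{-1},B)$. As a $\mathfrak k^0$-module, $\mathfrak c^p\simeq\bigoplus_{-1\le j\le[p/2]}S^{p-2j}(\mathfrak c^{-1})$ for $p\ge -1$, a sum of pairwise inequivalent irreducible modules ($j=-1$ corresponding to $\mathfrak k^p$); $S^{p-2j}(\widehat{\mathfrak c}^{-1})$ denotes the corresponding component of $\widehat{\mathfrak c}^p$. Fix $\mathfrak J\in\mathfrak{sp}(\mathfrak c^{-1},B)$ which is a complex structure on $\mathfrak c^{-1}$ (of some signature $(r,s)$, $r+s=n$); $\widehat{\mathfrak c}^{-1}=\mathfrak c^{-1(10)}\oplus\mathfrak c^{-1(01)}$ are its $\pm i$-eigenspaces. $S^{\ell,p-2j-\ell}=S^\ell(\mathfrak c^{-1(10)})\otimes S^{p-2j-\ell}(\mathfrak c^{-1(01)})$ is the $\operatorname{ad}(\mathfrak J)$-eigenspace of eigenvalue $i(2\ell-p+2j)$ in the component $S^{p-2j}(\widehat{\mathfrak c}^{-1})$ of $\widehat{\mathfrak c}^p$. **CR algebras.** Here a CR algebra is a pair $(\mathfrak g,\mathfrak q)$ with $\mathfrak g$ a real Lie algebra and $\mathfrak q$ a complex subalgebra of $\widehat{\mathfrak g}$ (finite-dimensionality of $\mathfrak g/\mathfrak g_o$ is not required); $\mathfrak g_o=\mathfrak g\cap\mathfrak q$ is the real isotropy algebra. Put $\mathfrak q_{-1}=\mathfrak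 q$, $\mathfrak q_p=\{Z\in\mathfrak q_{p-1}:[Z,\overline{\mathfrak q}]\subset\mathfrak q_{p-1}+\overline{\mathfrak q}\}$ for $p\ge0$, and $\mathfrak g_{-1}=\operatorname{Re}(\mathfrak q+\overline{\mathfrak q})$, $\mathfrak g_p=\mathfrak g_{p+1}+[\mathfrak g_{-1},\mathfrak g_{p+1}]$ for $p\le-2$. $(\mathfrak g,\mathfrak q)$ is holomorphically nondegenerate if $\bigcap_{p\ge-1}\mathfrak q_p=\mathfrak q\cap\overline{\mathfrak q}$. Its core has components $\mathfrak g_p/\mathfrak g_{p+1}$ for $p\le-2$ and $\operatorname{Re}\big((\mathfrak q_p+\overline{\mathfrak q}_p)/(\mathfrak q_{p+1}+\overline{\mathfrak q}_{p+1})\big)$ for $p\ge-1$, with $(10)$-part $\mathfrak q_p/\mathfrak q_{p+1}$ and structure maps induced by the Lie bracket. **Abstract cores.** An abstract core is a finite-dimensional $\mathbb Z$-graded real vector space $\mathfrak m=\bigoplus\mathfrak m^p$ with (i) a grading-preserving complex structure $J$ on $\bigoplus_{p\ge-1}\mathfrak m^p$ (write $\widehat{\mathfrak m}^p=\mathfrak m^{p(10)}\oplus\mathfrak m^{p(01)}$ for the $\pm i$-eigenspaces); (ii) a graded Lie bracket on $\mathfrak m_-=\bigoplus_{p<0}\mathfrak m^p$ with $[Jv,Jw]=[v,w]$ for $v,w\in\mathfrak m^{-1}$, fundamental (generated by $\mathfrak m^{-1}$) and nondegenerate ($v\in\mathfrak m^{-1}$, $[v,\mathfrak m^{-1}]=0$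 imply $v=0$); (iii) for each $p\ge0$ an injective $\mathbb C$-linear map $L^{p+2}:\mathfrak m^{p(10)}\to\big(\mathfrak m^{p-1(10)}\otimes(\mathfrak m^{-1(01)})^*\big)\cap\big(\widehat{\mathfrak m}^{-2}\otimes S^{p+2}(\mathfrak m^{-1(01)})^*\big)$, where $\mathfrak m^{-1(10)}$ is regarded as a space of maps $\mathfrak m^{-1(01)}\to\widehat{\mathfrak m}^{-2}$ via the bracket (ii). It is of hypersurface type if $\mathfrak m^p=0$ for $p<-2$ and $\dim\mathfrak m^{-2}=1$. A morphism $\varphi:\mathfrak m\to\mathfrak m'$ is a real linear map preserving degrees, commuting with the complex structures, restricting to a Lie algebra morphism $\mathfrak m_-\to\mathfrak m'_-$ and satisfying $L'^{p+2}(\varphi(v))(\varphi(w))=\varphi(L^{p+2}(v)(w))$ for $v\in\mathfrak m^{p(10)}$, $w\in\mathfrak m^{-1(01)}$, $p\ge0$; it is an immersion if injective. The same notions are used for the infinite-dimensional $\mathfrak M$: $J=\mathfrak J$ on $\mathfrak M^{-1}$, $J$ is multiplication by $i$ on $\mathfrak M^{p(10)}$, and its maps $v\mapsto(w\mapsto[v,w])$, $v\in\mathfrak M^{p(10)}$, $w\in\mathfrak M^{-1(01)}=\mathfrak c^{-1(01)}$, are given by the bracket of $\widehat{\mathfrak c}$. *)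

(* Defs.v *)
From HB Require Import structures.
From mathcomp Require Import all_boot all_order all_fingroup all_algebra.
From mathcomp Require Import complex.
From mathcomp Require Import boolp classical_sets functions reals.

Set Implicit Arguments.
Unset Strict Implicit.
Unset Printing Implicit Defensive.

Import Order.TTheory GRing.Theory Num.Theory.
Local Open Scope classical_set_scope.
Local Open Scope complex_scope.
Local Open Scope ring_scope.

(* Linear algebra with subspaces given as sets. *)

Definition subspace (K : pzRingType) (V : lmodType K) (S : set V) : Prop :=
  S 0 /\ forall (a : K) (x y : V), S x -> S y -> S (a *: x + y).

Definition setadd (V : zmodType) (A B : set V) : set V :=
  [set z | exists x y, A x /\ B y /\ z = x + y].

Definition lspan (K : pzRingType) (V : lmodType K) (A : set V) : set V :=
  [set z | exists (d : nat) (a : 'I_d -> K) (v : 'I_d -> V),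
     (forall i, A (v i)) /\ z = \sum_(i < d) a i *: v i].

(* The sum of the subspaces F i over the (possibly infinite) set of indices
   satisfying P, i.e. all finite sums of elements of these subspaces. *)
Definition bigsum (I : eqType) (V : zmodType) (P : pred I) (F : I -> set V) :
  set V :=
  [set z | exists (s : seq I) (f : I -> V),
     (forall i, i \in s -> P i /\ F i (f i)) /\ z = \sum_(i <- s) f i].

Definition independent (I : eqType) (V : zmodType) (P : pred I)
    (F : I -> set V) : Prop :=
  forall (s : seq I) (f : I -> V), uniq s ->
    (forall i, i \in s -> P i /\ F i (f i)) ->
    \sum_(i <- s) f i = 0 -> forall i, i \in s -> f i = 0.

Definition is_direct_sum (I : eqType) (V : zmodType) (P : pred I)
    (F : I -> set V) (W : set V) : Prop :=
  independent P F /\ W = bigsum P F.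

Definition has_dim (K : pzRingType) (V : lmodType K) (S : set V) (d : nat) :
  Prop :=
  exists b : 'I_d -> V, (forall i, S (b i)) /\
    forall x, S x -> exists! a : 'rV[K]_d, x = \sum_(i < d) a ord0 i *: b i.

Definition linear_on (K : pzRingType) (V W : lmodType K) (S : set V)
    (f : V -> W) : Prop :=
  forall (a : K) (x y : V), S x -> S y -> f (a *: x + y) = a *: f x + f y.

(* The quotient F / G, as a set of cosets. *)
Definition coset (V : zmodType) (G : set V) (x : V) : set V :=
  [set y | G (y - x)].

Definition quo (V : zmodType) (F G : set V) : set (set V) := coset G @` F.

(* Lie algebras and gradings. *)

Definition lie_bracket_on (K : pzRingType) (V : lmodType K) (S : set V)
    (br : V -> V -> V) : Prop :=
  [/\ forall x y, S x -> S y -> S (br x y),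
      forall x, S x -> linear_on S (br x) /\ linear_on S (br ^~ x),
      forall x, S x -> br x x = 0 &
      forall x y z, S x -> S y -> S z ->
        br x (br y z) + br y (br z x) + br z (br x y) = 0].

Definition lie_bracket (K : pzRingType) (V : lmodType K) (br : V -> V -> V) :
  Prop := lie_bracket_on [set: V] br.

Definition lie_subalgebra (K : pzRingType) (V : lmodType K)
    (br : V -> V -> V) (S : set V) : Prop :=
  subspace S /\ forall x y, S x -> S y -> S (br x y).

Definition graded_lie (K : pzRingType) (V : lmodType K) (br : V -> V -> V)
    (gr : int -> set V) : Prop :=
  [/\ lie_bracket br,
      forall p, subspace (gr p),
      is_direct_sum predT gr [set: V] &
      forall (p q : int) x y, gr p x -> gr q y -> gr (p + q) (br x y)].

Definition neg_part (K : pzRingType) (V : lmodType K) (gr : int -> set V) :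
  set V := bigsum (fun p : int => p < 0) gr.

Definition neg_iso (K : pzRingType) (V W : lmodType K)
    (brV : V -> V -> V) (grV : int -> set V)
    (brW : W -> W -> W) (grW : int -> set W) (psi : V -> W) : Prop :=
  [/\ linear_on (neg_part grV) psi,
      forall p : int, p < 0 -> set_bij (grV p) (grW p) psi &
      forall x y, neg_part grV x -> neg_part grV y ->
        psi (brV x y) = brW (psi x) (psi y)].

(* The contact algebra. *)

Definition heisenberg_neg (R : realType) (n : nat) (V : lmodType R)
    (br : V -> V -> V) (gr : int -> set V) : Prop :=
  [/\ forall p : int, p < -2 -> gr p = [set 0],
      has_dim (gr (-1)) (2 * n)%N &
      exists (e : V) (B : V -> V -> R),
        [/\ e != 0,
            gr (-2) = [set x | exists a : R, x = a *: e],
            forall v w, gr (-1) v -> gr (-1) w -> br v w = B v w *: e,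
            (forall v, gr (-1) v ->
               linear_on (W := R^o) (gr (-1)) (B v) /\
               linear_on (W := R^o) (gr (-1)) (B ^~ v) /\ B v v = 0) &
            (forall v, gr (-1) v ->
               (forall w, gr (-1) w -> B v w = 0) -> v = 0)]].

Definition transitive_grading (K : pzRingType) (V : lmodType K)
    (br : V -> V -> V) (gr : int -> set V) : Prop :=
  forall (p : int) (X : V), 0 <= p -> gr p X ->
    (forall v, gr (-1) v -> br X v = 0) -> X = 0.

(* Maximality: every transitive graded Lie algebra with the same negative part
   embeds, compatibly with the identification of the negative parts. *)
Definition contact_algebra (R : realType) (n : nat) (c : lmodType R)
    (br : c -> c -> c) (gr : int -> set c) : Prop :=
  [/\ graded_lie br gr, heisenberg_neg n br gr, transitive_grading br gr &
      forall (g : lmodType R) (br' : g -> g -> g) (gr' : int -> set g)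
        (psi : g -> c),
        graded_lie br' gr' -> transitive_grading br' gr' ->
        neg_iso br' gr' br gr psi ->
        exists phi : {linear g -> c},
          [/\ injective phi,
              forall p x, gr' p x -> gr p (phi x),
              forall x y, phi (br' x y) = br (phi x) (phi y) &
              forall x, neg_part gr' x -> phi x = psi x]].

Definition kpart (R : realType) (c : lmodType R) (br : c -> c -> c)
    (gr : int -> set c) (p : int) : set c :=
  [set X | gr p X /\ forall z, gr (-2) z -> br X z = 0].

(* Complexification: (x, y) stands for x + iy. *)

Definition cplx (R : realType) (V : lmodType R) : Type := (V * V)%type.

HB.instance Definition _ (R : realType) (V : lmodType R) :=
  GRing.Zmodule.copy (cplx V) (V * V)%type.

Definition cplx_scale (R : realType) (V : lmodType R) (a : R[i])
    (z : cplx V) : cplx V :=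
  (complex.Re a *: z.1 - complex.Im a *: z.2,
   complex.Re a *: z.2 + complex.Im a *: z.1).

Lemma cplx_scaleA (R : realType) (V : lmodType R) (a b : R[i]) (z : cplx V) :
  cplx_scale a (cplx_scale b z) = cplx_scale (a * b) z.
Proof.
case: a b z => [a1 a2] [b1 b2] [x y]; rewrite /cplx_scale /=.
by congr (_, _); rewrite !scalerDr ?scalerN !scalerDl ?scaleNr !scalerA
  ?opprD !addrA addrAC; congr (_ + _); rewrite addrAC.
Qed.

Lemma cplx_scale1 (R : realType) (V : lmodType R) :
  left_id 1 (@cplx_scale R V).
Proof.
by case=> x y; rewrite /cplx_scale /= !scale1r !scale0r subr0 addr0.
Qed.

Lemma cplx_scaleDr (R : realType) (V : lmodType R) :
  right_distributive (@cplx_scale R V) +%R.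
Proof.
move=> a [x y] [x' y']; rewrite /cplx_scale /=.
by congr (_, _); rewrite /= !scalerDr ?opprD addrACA.
Qed.

Lemma cplx_scaleDl (R : realType) (V : lmodType R) (z : cplx V) :
  {morph (@cplx_scale R V)^~ z : a b / a + b}.
Proof.
case: z => x y [a1 a2] [b1 b2]; rewrite /cplx_scale /=.
by congr (_, _); rewrite /= !scalerDl ?opprD addrACA.
Qed.

HB.instance Definition _ (R : realType) (V : lmodType R) :=
  GRing.Zmodule_isLmodule.Build R[i] (cplx V)
    (@cplx_scaleA R V) (@cplx_scale1 R V) (@cplx_scaleDr R V)
    (@cplx_scaleDl R V).

Definition rl (R : realType) (V : lmodType R) (x : V) : cplx V := (x, 0).

Definition cconj (R : realType) (V : lmodType R) (z : cplx V) : cplx V :=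
  (z.1, - z.2).

Definition conjset (R : realType) (V : lmodType R) (S : set (cplx V)) :
  set (cplx V) := @cconj R V @` S.

Definition cplxset (R : realType) (V : lmodType R) (S : set V) :
  set (cplx V) := [set z | S z.1 /\ S z.2].

Definition cplxmap (R : realType) (V W : lmodType R) (f : V -> W)
    (z : cplx V) : cplx W := (f z.1, f z.2).

Definition cbr (R : realType) (V : lmodType R) (br : V -> V -> V)
    (z w : cplx V) : cplx V :=
  (br z.1 w.1 - br z.2 w.2, br z.1 w.2 + br z.2 w.1).

(* Re S = the real vectors of S, for S invariant under conjugation. *)
Definition repart (R : realType) (V : lmodType R) (S : set (cplx V)) :
  set V := [set x | S (rl x)].

(* CR algebras.  Filtrations are indexed by nat: qfil k is q_{k-1} and gfil k
   is g_{-1-k}; qq p and gg p are the same with the original indices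
   (p >= -1 and p <= -1 respectively). *)

Definition CR_algebra (R : realType) (g : lmodType R) (br : g -> g -> g)
    (q : set (cplx g)) : Prop :=
  lie_bracket br /\ lie_subalgebra (cbr br) q.

Definition isotropy (R : realType) (g : lmodType R) (q : set (cplx g)) :
  set g := [set x | q (rl x)].

Fixpoint qfil (R : realType) (g : lmodType R) (br : g -> g -> g)
    (q : set (cplx g)) (k : nat) : set (cplx g) :=
  if k is k'.+1 then
    [set Z | qfil br q k' Z /\ forall W, conjset q W ->
       setadd (qfil br q k') (conjset q) (cbr br Z W)]
  else q.

Definition qq (R : realType) (g : lmodType R) (br : g -> g -> g)
    (q : set (cplx g)) (p : int) : set (cplx g) := qfil br q (absz (p + 1)%R).

Fixpoint gfil (R : realType) (g : lmodType R) (br : g -> g -> g)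
    (q : set (cplx g)) (k : nat) : set g :=
  if k is k'.+1 then
    setadd (gfil br q k')
      (lspan [set z | exists x y, repart (setadd q (conjset q)) x /\
                        gfil br q k' y /\ z = br x y])
  else repart (setadd q (conjset q)).

Definition gg (R : realType) (g : lmodType R) (br : g -> g -> g)
    (q : set (cplx g)) (p : int) : set g := gfil br q (absz (p + 1)%R).

Definition hol_nondegenerate (R : realType) (g : lmodType R)
    (br : g -> g -> g) (q : set (cplx g)) : Prop :=
  \bigcap_k qfil br q k = q `&` conjset q.

(* The core of a CR algebra.  The real component of degree p is coreneg p for
   p <= -2 and corere p for p >= -1; core10 p is the (10)-part. *)

Definition qqbar (R : realType) (g : lmodType R) (br : g -> g -> g)
    (q : set (cplx g)) (p : int) : set (cplx g) :=
  setadd (qq br q p) (conjset (qq br q p)).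

Definition coreneg (R : realType) (g : lmodType R) (br : g -> g -> g)
    (q : set (cplx g)) (p : int) : set (set g) :=
  quo (gg br q p) (gg br q (p + 1)).

Definition corere (R : realType) (g : lmodType R) (br : g -> g -> g)
    (q : set (cplx g)) (p : int) : set (set (cplx g)) :=
  [set A | quo (qqbar br q p) (qqbar br q (p + 1)) A /\ conjset A = A].

Definition core10 (R : realType) (g : lmodType R) (br : g -> g -> g)
    (q : set (cplx g)) (p : int) : set (set (cplx g)) :=
  quo (qq br q p) (qq br q (p + 1)).

Definition core01 (R : realType) (g : lmodType R) (br : g -> g -> g)
    (q : set (cplx g)) (p : int) : set (set (cplx g)) :=
  quo (conjset (qq br q p)) (conjset (qq br q (p + 1))).

(* The induced bracket of two classes of corere (-1), in g_{-2}/g_{-1}. *)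
Definition core_bracket (R : realType) (g : lmodType R) (br : g -> g -> g)
    (q : set (cplx g)) (A B : set (cplx g)) : set g :=
  [set z | exists x y, A (rl x) /\ B (rl y) /\ gg br q (-1) (z - br x y)].

(* The induced map core10 p x core01 (-1) -> core10 (p - 1): the bracket lies
   in q_{p-1} + conj q, and (q_{p-1} + conj q)/(q_p + conj q) is q_{p-1}/q_p. *)
Definition core_L (R : realType) (g : lmodType R) (br : g -> g -> g)
    (q : set (cplx g)) (p : int) (A B : set (cplx g)) : set (cplx g) :=
  [set Z | qq br q (p - 1) Z /\ exists X Y, A X /\ B Y /\
     setadd (qq br q p) (conjset q) (Z - cbr br X Y)].

(* Abstract cores.  The space is the span of the components cd_gr p inside
   cd_car; cd_J p, cd_br and cd_L p are used only on the component of degree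
   p >= -1, on the negative part, and on degree p (10)-vectors times degree -1
   (01)-vectors (p >= 0; this is L^{p+2}), respectively. *)

Record core_data (R : realType) := CoreData {
  cd_car :> lmodType R;
  cd_gr : int -> set cd_car;
  cd_J : int -> cd_car -> cd_car;
  cd_br : cd_car -> cd_car -> cd_car;
  cd_L : nat -> cplx cd_car -> cplx cd_car -> cplx cd_car }.

Definition cd10 (R : realType) (m : core_data R) (p : int) : set (cplx m) :=
  [set z | cplxset (cd_gr p) z /\ cplxmap (@cd_J R m p) z = 'i%C *: z].

Definition cd01 (R : realType) (m : core_data R) (p : int) : set (cplx m) :=
  [set z | cplxset (cd_gr p) z /\
           cplxmap (@cd_J R m p) z = (- 'i%C) *: z].

(* For v of degree k - 1 and ws = w_1, ..., w_(k+1), this is the value in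
   degree -2 of v seen as a multilinear form:
   [L^2(..L^k(L^(k+1)(v)(w_1))(w_2)..)(w_k), w_(k+1)]. *)
Fixpoint core_form (R : realType) (m : core_data R) (k : nat) (v : cplx m)
    (ws : seq (cplx m)) : cplx m :=
  match k, ws with
  | 0%N, w :: _ => cbr (@cd_br R m) v w
  | k'.+1, w :: ws' => core_form k' (cd_L k' v w) ws'
  | _, [::] => 0
  end.

Definition core_axioms (R : realType) (m : core_data R) : Prop :=
  let gr := @cd_gr R m in
  let br := @cd_br R m in
  let m_ := neg_part gr in
  [/\ (forall p, subspace (gr p)) /\ independent predT gr,
      forall p : int, -1 <= p ->
        [/\ forall x, gr p x -> gr p (cd_J p x),
            linear_on (gr p) (@cd_J R m p) &
            forall x, gr p x -> cd_J p (cd_J p x) = - x],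
      [/\ lie_bracket_on m_ br,
          forall (p q : int) x y, p < 0 -> q < 0 -> gr p x -> gr q y ->
            gr (p + q) (br x y),
          forall v w, gr (-1) v -> gr (-1) w ->
            br (cd_J (-1) v) (cd_J (-1) w) = br v w,
          (forall S : set m, subspace S -> S `<=` m_ -> gr (-1) `<=` S ->
             (forall x y, S x -> S y -> S (br x y)) -> S = m_) &
          (forall v, gr (-1) v -> (forall w, gr (-1) w -> br v w = 0) ->
             v = 0)] &
      forall p : nat,
        [/\ forall v w : cplx m, cd10 p v -> cd01 (-1) w ->
              cd10 (p%:Z - 1) (cd_L p v w),
            forall v : cplx m, cd10 p v -> linear_on (@cd01 R m (-1)) (cd_L p v),
            forall w : cplx m, cd01 (-1) w -> linear_on (@cd10 R m p) (cd_L p ^~ w),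
            forall v : cplx m, cd10 p v -> (forall w : cplx m, cd01 (-1) w -> cd_L p v w = 0) ->
              v = 0 &
            forall (v : cplx m) (ws ws' : seq (cplx m)), cd10 p v ->
              size ws = p.+2 -> (forall w : cplx m, w \in ws -> cd01 (-1) w) ->
              perm_eq ws ws' -> core_form p.+1 v ws = core_form p.+1 v ws']].

Definition abstract_core (R : realType) (m : core_data R) : Prop :=
  [/\ core_axioms m, is_direct_sum predT (@cd_gr R m) [set: m] &
      exists d, has_dim [set: m] d].

Definition hypersurface_type (R : realType) (m : core_data R) : Prop :=
  (forall p : int, p < -2 -> @cd_gr R m p = [set 0]) /\
  has_dim (@cd_gr R m (-2)) 1.

Definition core_morphism (R : realType) (m m' : core_data R)
    (phi : {linear m -> m'}) : Prop :=
  [/\ forall (p : int) (x : m), cd_gr p x -> cd_gr p (phi x),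
      forall (p : int) (x : m), -1 <= p -> cd_gr p x ->
        phi (cd_J p x) = cd_J p (phi x),
      forall x y : m, neg_part (@cd_gr R m) x -> neg_part (@cd_gr R m) y ->
        phi (cd_br x y) = cd_br (phi x) (phi y) &
      forall (p : nat) (v w : cplx m), cd10 p v -> cd01 (-1) w ->
        cd_L p (cplxmap phi v) (cplxmap phi w) = cplxmap phi (cd_L p v w)].

Definition core_immersion (R : realType) (m m' : core_data R)
    (phi : {linear m -> m'}) : Prop :=
  core_morphism phi /\ injective phi.

(* The CR algebra (c, u).  Below J is an element of k^0 = sp(c^{-1}) acting on
   c^{-1} as a complex structure. *)

Definition eigensp (R : realType) (c : lmodType R) (br : c -> c -> c)
    (gr : int -> set c) (J : c) (p : int) (lambda : R[i]) : set (cplx c) :=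
  [set z | cplxset (gr p) z /\ cbr br (rl J) z = lambda *: z].

Definition extr_eigenvalue (R : realType) (p : int) : R[i] :=
  (p + 2)%:~R * 'i%C.

Definition upd (I : eqType) (T : Type) (v : I -> T) (i : I) (x : T) : I -> T :=
  fun j => if j == i then x else v j.

(* sigma encodes a k^0-equivariant C-linear map S^m(c^{-1}) -> c^p of the
   complexifications, as a symmetric m-linear map. *)
Definition sym_equivariant (R : realType) (c : lmodType R) (br : c -> c -> c)
    (gr : int -> set c) (p : int) (m : nat)
    (sigma : ('I_m -> cplx c) -> cplx c) : Prop :=
  forall v : 'I_m -> cplx c, (forall i, cplxset (gr (-1)) (v i)) ->
    [/\ cplxset (gr p) (sigma v),
        forall s : {perm 'I_m}, sigma (fun i => v (s i)) = sigma v,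
        forall i, linear_on (cplxset (gr (-1))) (fun x => sigma (upd v i x)) &
        forall X, kpart br gr 0 X ->
          cbr br (rl X) (sigma v) =
          \sum_(i < m) sigma (upd v i (cbr br (rl X) (v i)))].

(* The component S^m(c^{-1}) of c^p (complexified): the isotypic component,
   which is irreducible because c^p is multiplicity free. *)
Definition Scomp (R : realType) (c : lmodType R) (br : c -> c -> c)
    (gr : int -> set c) (p : int) (m : nat) : set (cplx c) :=
  lspan [set z | exists (sigma : ('I_m -> cplx c) -> cplx c)
                   (v : 'I_m -> cplx c),
    sym_equivariant br gr p sigma /\
    (forall i, cplxset (gr (-1)) (v i)) /\ z = sigma v].

(* S^{l,k} = S^l(c^{-1(10)}) (x) S^k(c^{-1(01)}) in the component S^{l+k} of
   c^p. *)
Definition Sbi (R : realType) (c : lmodType R) (br : c -> c -> c)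
    (gr : int -> set c) (J : c) (p : int) (l k : nat) : set (cplx c) :=
  lspan [set z | exists (sigma : ('I_(l + k) -> cplx c) -> cplx c)
                   (v : 'I_(l + k) -> cplx c),
    sym_equivariant br gr p sigma /\
    (forall i : 'I_(l + k),
       if (i < l)%N then eigensp br gr J (-1) 'i%C (v i)
       else eigensp br gr J (-1) (- 'i%C) (v i)) /\
    z = sigma v].

(* The summands S^{l,p+2-l} (index inl l) and S^{p-2j} (index inr j) of c^p,
   and the index sets 1 <= l <= lmax, 0 <= j <= [p/2]. *)
Definition usummand (R : realType) (c : lmodType R) (br : c -> c -> c)
    (gr : int -> set c) (J : c) (p : int) (i : nat + nat) : set (cplx c) :=
  match i with
  | inl l => Sbi br gr J p l (absz (p + 2 - l%:Z)%R)
  | inr j => Scomp br gr p (absz (p - 2 * j%:Z)%R)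
  end.

Definition uindex (p lmax : int) (i : nat + nat) : bool :=
  match i with
  | inl l => (1%:Z <= l%:Z) && (l%:Z <= lmax)
  | inr j => j%:Z <= (p %/ 2)%Z
  end.

Definition ucomp (R : realType) (c : lmodType R) (br : c -> c -> c)
    (gr : int -> set c) (J : c) (p : int) : set (cplx c) :=
  bigsum (uindex p (p + 2)) (usummand br gr J p).

Definition ualg (R : realType) (c : lmodType R) (br : c -> c -> c)
    (gr : int -> set c) (J : c) : set (cplx c) :=
  bigsum (fun p : int => -1 <= p) (ucomp br gr J).

(* The core M, realized inside c.  ad(J) = +-i(p+2) on the (10)- and
   (01)-parts of M^p, so ad(J)/(p+2) is multiplication by +-i there, and
   ad(J) itself for p = -1. *)
Definition coreM (R : realType) (c : lmodType R) (br : c -> c -> c)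
    (gr : int -> set c) (J : c) : core_data R :=
  @CoreData R c
    (fun p : int => if p < 0 then gr p else
       repart (setadd (Sbi br gr J p (absz (p + 2)%R) 0)
                      (Sbi br gr J p 0 (absz (p + 2)%R))))
    (fun p x => ((p + 2)%:~R)^-1 *: br J x)
    br
    (fun _ => cbr br).

(* Main.v *)
From HB Require Import structures.
Require Import Defs.
From mathcomp Require Import all_boot all_order all_algebra.
From mathcomp Require Import perm complex.
From mathcomp Require Import boolp classical_sets functions reals.
From mathcomp Require mpoly.
Import -(notations) mpoly.
From mathcomp Require Import ring zify.

(** The contact algebra is an algebra of polynomials, and in the polynomial model
    everything is read off from two integers attached to a monomial.

    Give t weight 2 and y_1, ..., y_2n weight 1. With Z = 2 - sum y_i d/dy_i and the
    Poisson bracket {f, g} that B defines in the y_i, the contact bracket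
    {f, g} + Z f dg/dt - df/dt Z g makes polynomials into a transitive graded Lie
    algebra (weight p + 2 is degree p) with the Heisenberg algebra as negative part, so
    maximality embeds them into c. The embedding is onto because of a Poincare lemma
    (contact_prolongation): brackets with c^{-1} and c^{-2} can be prescribed freely,
    subject to the obvious compatibilities, and by transitivity they determine an
    element of c. This gives contact_real_model and, after extension of scalars,
    contact_complex_model.

    Let v_1, ..., v_l be (10)- and w_1, ..., w_k be (01)-vectors of degree -1. The
    polynomial t^h v_1...v_l w_1...w_k gets the bidegree (r, s) = (l + h, k + h). The
    degree is r + s - 2 and the eigenvalue of ad J is i(r - s), so the bidegree
    decomposition of the complexified contact algebra is intrinsic. Conjugation
    exchanges r and s, and brackets of bidegrees (r, s) and (r', s') have bidegree
    (r + r' - 1, s + s' - 1). The algebra u is the sum of all pieces with r > 0. A band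
    is a sum of bidegree pieces over a set of bidegrees. The spaces q_p, the isotropy
    algebra and the components of the core all turn out to be bands, and inclusions,
    quotients and intersections of bands are settled by arithmetic in r and s. The one
    further ingredient is transitivity along antiholomorphic directions: an element of
    bidegree (r, 0), r > 0, which commutes with all (01)-vectors of degree -1 vanishes.
    By qfil_band, q_{k-1} is the band r > 0 with s > 0 or r > k; the new piece of
    bidegree (k + 1, 0) in each step is the (10)-part of the core in degree k - 1, that
    is S^{k+1,0}.

    The components S^{l,k} and S^{p-2j} are spans of values of equivariant maps and have
    to be located among these pieces. Multiplication of a product of vectors by t^h is
    an equivariant map, so it is enough to know that values of equivariant maps on m
    vectors are homogeneous of degree m in the y_i (equivariant_euler). If all arguments
    equal v, the value is annihilated by the stabiliser of v in sp, hence depends on t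
    and v only, and an element of sp scaling v gives its degree. The Lie algebra sp
    moves the remaining arguments one at a time.

    For the universality of the core, an abstract core m with given m_- is sent to M
    degree by degree: the image of v in m^{p(10)} has to be the element of S^{p+2,0}
    whose bracket with each (01)-vector w is the image of L(v)(w). It is unique by
    transitivity, and it exists by the Poincare lemma, whose compatibility condition is
    the symmetry of the iterated maps L. Injectivity of L makes the resulting map
    injective. *)

Set Implicit Arguments.
Unset Strict Implicit.
Unset Printing Implicit Defensive.

Import Order.TTheory GRing.Theory Num.Theory.
Local Open Scope classical_set_scope.
Local Open Scope ring_scope.

(** * Subspaces, direct sums and eigenvectors *)

Section Subspaces.
Variables (K : pzRingType) (V : lmodType K) (S : set V).
Hypothesis sS : subspace S.

Lemma subspace0 : S 0. Proof. by case: sS. Qed.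
Lemma subspaceZD a x y : S x -> S y -> S (a *: x + y).
Proof. by case: sS => _; apply. Qed.
Lemma subspaceD x y : S x -> S y -> S (x + y).
Proof. by move=> Sx Sy; have := subspaceZD 1 Sx Sy; rewrite scale1r. Qed.
Lemma subspaceZ a x : S x -> S (a *: x).
Proof. by move=> Sx; have := subspaceZD a Sx subspace0; rewrite addr0. Qed.
Lemma subspaceN x : S x -> S (- x).
Proof. by move=> Sx; rewrite -scaleN1r; exact: subspaceZ. Qed.
Lemma subspaceB x y : S x -> S y -> S (x - y).
Proof. by move=> Sx /subspaceN; exact: subspaceD. Qed.
Lemma subspace_sum (I : Type) (r : seq I) (Q : pred I) (f : I -> V) :
  (forall i, Q i -> S (f i)) -> S (\sum_(i <- r | Q i) f i).
Proof. by move=> Sf; apply: big_ind => //; [exact: subspace0 | exact: subspaceD]. Qed.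
Lemma subspace_sum_seq (I : eqType) (r : seq I) (f : I -> V) :
  (forall i, i \in r -> S (f i)) -> S (\sum_(i <- r) f i).
Proof. by move=> Sf; rewrite big_seq; exact: subspace_sum. Qed.
End Subspaces.

Section LinearOn.
Variables (K : pzRingType) (V W : lmodType K) (S : set V) (f : V -> W).
Hypothesis sS : subspace S.
Hypothesis lf : linear_on S f.

Lemma linear_on0 : f 0 = 0.
Proof.
have := lf 1 (subspace0 sS) (subspace0 sS).
by rewrite !scale1r addr0 -[X in X = _]addr0 => /addrI.
Qed.
Lemma linear_onZ a x : S x -> f (a *: x) = a *: f x.
Proof. by move=> Sx; have := lf a Sx (subspace0 sS); rewrite linear_on0 !addr0. Qed.
Lemma linear_onD x y : S x -> S y -> f (x + y) = f x + f y.
Proof. by move=> Sx Sy; have := lf 1 Sx Sy; rewrite !scale1r. Qed.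
Lemma linear_onN x : S x -> f (- x) = - f x.
Proof. by move=> Sx; rewrite -scaleN1r linear_onZ // scaleN1r. Qed.
Lemma linear_onB x y : S x -> S y -> f (x - y) = f x - f y.
Proof. by move=> Sx Sy; rewrite linear_onD ?linear_onN //; exact: subspaceN. Qed.
End LinearOn.

Lemma subspace_set0 (K : pzRingType) (V : lmodType K) : subspace [set (0 : V)].
Proof. by split=> // a x y -> ->; rewrite scaler0 addr0. Qed.

Lemma subspaceI (K : pzRingType) (V : lmodType K) (A B : set V) :
  subspace A -> subspace B -> subspace (A `&` B).
Proof.
move=> sA sB; split; first by split; exact: subspace0.
by move=> a x y [Ax Bx] [Ay By]; split; exact: subspaceZD.
Qed.

Lemma lspan_min (K : pzRingType) (V : lmodType K) (A S : set V) :
  subspace S -> A `<=` S -> lspan A `<=` S.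
Proof.
move=> sS AS _ [d [a [v [Av ->]]]].
by apply: subspace_sum => // i _; apply: subspaceZ => //; exact: AS.
Qed.

Lemma sub_lspan (K : pzRingType) (V : lmodType K) (A : set V) : A `<=` lspan A.
Proof.
move=> x Ax; exists 1%N, (fun _ => 1), (fun _ => x); split=> //.
by rewrite big_ord1 scale1r.
Qed.

Lemma subspace_lspan (K : pzRingType) (V : lmodType K) (A : set V) : subspace (lspan A).
Proof.
split; first by exists 0%N, (fun _ => 0), (fun _ => 0); split=> [[]|]//; rewrite big_ord0.
move=> a _ _ [d [b [v [Av ->]]]] [d' [b' [v' [Av' ->]]]].
exists (d + d')%N,
  (fun i : 'I_(d + d') => match fintype.split i with inl j => a * b j | inr j => b' j end),
  (fun i : 'I_(d + d') => match fintype.split i with inl j => v j | inr j => v' j end); split.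
  by move=> i; case: fintype.splitP.
rewrite big_split_ord /= scaler_sumr; congr (_ + _); apply: eq_bigr => i _.
  by rewrite (unsplitK (inl i)) scalerA.
by rewrite (unsplitK (inr i)).
Qed.

Lemma bigsum_mem (I : eqType) (V : zmodType) (P : pred I) (F : I -> set V) i x :
  P i -> F i x -> bigsum P F x.
Proof.
move=> Pi Fx; exists [:: i], (fun _ => x); split; last by rewrite big_seq1.
by move=> j; rewrite inE => /eqP ->.
Qed.

Section BigSum.
Variables (I : eqType) (K : pzRingType) (V : lmodType K).
Implicit Types (P : pred I) (F : I -> set V).

Lemma sum_uniq_sub (s r : seq I) (f : I -> V) :
  uniq s -> uniq r -> {subset s <= r} -> (forall i, i \notin s -> f i = 0) ->
  \sum_(i <- r) f i = \sum_(i <- s) f i.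
Proof.
move=> us ur sr f0; rewrite (bigID (mem s)) /= [X in _ + X]big1 ?addr0; last by move=> i /f0.
rewrite -big_filter; apply: perm_big; apply: uniq_perm => //; first exact: filter_uniq.
by move=> i; rewrite mem_filter /=; case: (boolP (i \in s)) => // /sr ->.
Qed.

Lemma bigsum_uniq P F x : (forall i, P i -> subspace (F i)) -> bigsum P F x ->
  exists (s : seq I) (f : I -> V), [/\ uniq s, forall i, i \in s -> P i /\ F i (f i),
    forall i, i \notin s -> f i = 0 & x = \sum_(i <- s) f i].
Proof.
move=> sF [s [f [sP ->]]].
exists (undup s), (fun i => f i *+ count_mem i s); split.
- exact: undup_uniq.
- move=> i; rewrite mem_undup => /sP [Pi Fi]; split=> //.
  by rewrite -scaler_nat; apply: subspaceZ => //; exact: sF.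
- by move=> i; rewrite mem_undup => /count_memPn ->.
have gen r : uniq r -> {subset s <= r} ->
    \sum_(i <- s) f i = \sum_(i <- r) f i *+ count_mem i s.
  move=> ur; elim: s {sP} => [|a s IH] sr; first by rewrite big_nil big1.
  rewrite big_cons IH; last by move=> i si; apply: sr; rewrite inE si orbT.
  under [RHS]eq_bigr => i _ do rewrite /= mulrnDr.
  rewrite big_split /=; congr (_ + _).
  rewrite (bigD1_seq a) ?sr ?mem_head //= eqxx mulr1n big1 ?addr0 // => i.
  by rewrite eq_sym => /negbTE ->.
by apply: gen; [exact: undup_uniq | move=> i; rewrite mem_undup].
Qed.

Lemma subspace_bigsum P F : (forall i, P i -> subspace (F i)) -> subspace (bigsum P F).
Proof.
move=> sF; split; first by exists [::], (fun _ => 0); split=> //; rewrite big_nil.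
move=> a x y /(bigsum_uniq sF)[s [f [us sP f0 ->]]] /(bigsum_uniq sF)[s' [f' [us' sP' f0' ->]]].
pose r := undup (s ++ s').
have ur : uniq r by exact: undup_uniq.
have sr : {subset s <= r} by move=> i si; rewrite mem_undup mem_cat si.
have sr' : {subset s' <= r} by move=> i si; rewrite mem_undup mem_cat si orbT.
exists r, (fun i => a *: f i + f' i); split; last first.
  by rewrite big_split -scaler_sumr /= (sum_uniq_sub us ur sr f0) (sum_uniq_sub us' ur sr' f0').
move=> i; rewrite mem_undup mem_cat => ir.
have Pi : P i by case/orP: ir => [/sP|/sP'] [].
split=> //; apply: (subspaceZD (sF _ Pi)).
  by have [/sP[]//|/f0 ->] := boolP (i \in s); exact: subspace0 (sF _ Pi).
by have [/sP'[]//|/f0' ->] := boolP (i \in s'); exact: subspace0 (sF _ Pi).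
Qed.

Lemma bigsum_min P F S : subspace S -> (forall i, P i -> F i `<=` S) -> bigsum P F `<=` S.
Proof.
move=> sS FS _ [s [f [sP ->]]]; apply: (subspace_sum_seq sS) => i /sP [Pi Fi].
exact: FS Fi.
Qed.

Lemma direct_sum_eq P F F' W : (forall i, P i -> F i = F' i) ->
  is_direct_sum P F W -> is_direct_sum P F' W.
Proof.
move=> FF' [ind ->]; split.
  move=> s f us sP; apply: ind => // i /sP [Pi]; by rewrite FF'.
apply/seteqP; split=> x [s [f [sP ->]]]; exists s, f; split=> // i /sP [Pi]; by rewrite FF'.
Qed.

Lemma independent_sub P P' F F' : (forall i, P' i -> P i /\ F' i `<=` F i) ->
  independent P F -> independent P' F'.
Proof.
move=> PP ind s f us sP; apply: ind => // i /sP [P'i Fi].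
by have [Pi sub] := PP _ P'i; split=> //; exact: sub.
Qed.

End BigSum.

Section Projections.
Variables (I : eqType) (K : pzRingType) (V : lmodType K) (F : I -> set V).
Hypothesis sF : forall i, subspace (F i).
Hypothesis dF : is_direct_sum predT F [set: V].

Definition decomposes (x : V) (s : seq I) (f : I -> V) : Prop :=
  [/\ uniq s, forall i, F i (f i), forall i, i \notin s -> f i = 0 & x = \sum_(i <- s) f i].

Lemma decomposition_exists x : exists s f, decomposes x s f.
Proof.
have [_ /seteqP[/(_ x Logic.I) + _]] := dF.
move=> /(bigsum_uniq (fun i _ => sF i)) [s [f [us sP f0 ->]]]; exists s, f; split=> // i.
by have [/sP[]//|/f0 ->] := boolP (i \in s); exact: subspace0.
Qed.

Lemma decomposition_unique x s f s' f' : decomposes x s f -> decomposes x s' f' -> f =1 f'.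
Proof.
move=> [us Ff f0 xE] [us' Ff' f0' xE'] i.
pose r := undup (s ++ s').
have ur : uniq r by exact: undup_uniq.
have sr : {subset s <= r} by move=> j sj; rewrite mem_undup mem_cat sj.
have sr' : {subset s' <= r} by move=> j sj; rewrite mem_undup mem_cat sj orbT.
have [ir|] := boolP (i \in r); last first.
  by rewrite mem_undup mem_cat negb_or => /andP[/f0 -> /f0' ->].
have [ind _] := dF; apply/eqP; rewrite -subr_eq0; apply/eqP.
apply: (ind r (fun i => f i - f' i)) => //.
  by move=> j _; split=> //; apply: subspaceB.
by rewrite sumrB (sum_uniq_sub us ur sr f0) (sum_uniq_sub us' ur sr' f0') -xE -xE' subrr.
Qed.

(** Used for the (infinite) bidegree decomposition: the support s depends on x, but each
    projection is linear on the whole space. *)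
Lemma projections_exist : exists pr : I -> V -> V,
  [/\ forall i x, F i (pr i x),
      forall i, linear (pr i),
      forall i x, F i x -> pr i x = x,
      forall i j x, i != j -> F j x -> pr i x = 0 &
      forall x, exists s, [/\ uniq s, forall i, i \notin s -> pr i x = 0 &
                              x = \sum_(i <- s) pr i x]].
Proof.
have /choice[rep repP] x : exists sf : seq I * (I -> V), decomposes x sf.1 sf.2.
  by have [s [f ?]] := decomposition_exists x; exists (s, f).
exists (fun i x => (rep x).2 i); split.
- by move=> i x; have [] := repP x.
- move=> i a x y.
  have [us Ff f0 xE] := repP x; have [us' Ff' f0' yE] := repP y.
  pose r := undup ((rep x).1 ++ (rep y).1).
  have ur : uniq r by exact: undup_uniq.
  have sr : {subset (rep x).1 <= r} by move=> j sj; rewrite mem_undup mem_cat sj.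
  have sr' : {subset (rep y).1 <= r} by move=> j sj; rewrite mem_undup mem_cat sj orbT.
  apply: (decomposition_unique (repP _) (s' := r) (f' := fun i => a *: (rep x).2 i + (rep y).2 i)).
  split=> //; first by move=> j; exact: subspaceZD.
    move=> j; rewrite mem_undup mem_cat negb_or => /andP[/f0 -> /f0' ->].
    by rewrite scaler0 addr0.
  by rewrite big_split -scaler_sumr /= (sum_uniq_sub us ur sr f0) (sum_uniq_sub us' ur sr' f0') -xE -yE.
- move=> i x Fx.
  rewrite (decomposition_unique (repP _) (s' := [:: i]) (f' := fun j => if j == i then x else 0)).
    by rewrite eqxx.
  split=> // [j|j|]; last by rewrite big_seq1 eqxx.
    by case: eqP => [->//|_]; exact: subspace0.
  by rewrite inE => /negbTE ->.
- move=> i j x ij Fx.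
  rewrite (decomposition_unique (repP _) (s' := [:: j]) (f' := fun k => if k == j then x else 0)).
    by rewrite (negbTE ij).
  split=> // [k|k|]; last by rewrite big_seq1 eqxx.
    by case: eqP => [->//|_]; exact: subspace0.
  by rewrite inE => /negbTE ->.
- by move=> x; have [us Ff f0 xE] := repP x; exists (rep x).1.
Qed.

Lemma direct_sum_linear_extension (W : lmodType K) (phi : I -> V -> W) :
  (forall i, linear_on (F i) (phi i)) ->
  exists Phi : {linear V -> W}, forall i x, F i x -> Phi x = phi i x.
Proof.
move=> lphi; have [pr [prF prl pr1 pr0 prs]] := projections_exist.
have phi0 i : phi i 0 = 0.
  have := lphi i 1 0 0 (subspace0 (sF i)) (subspace0 (sF i)).
  by rewrite !scale1r addr0 -[X in X = _]addr0 => /addrI.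
have /choice[supp suppP] := prs.
pose Phi x := \sum_(i <- supp x) phi i (pr i x).
have PhiE x r : uniq r -> {subset supp x <= r} -> Phi x = \sum_(i <- r) phi i (pr i x).
  move=> ur sr; have [us f0 _] := suppP x; rewrite [RHS](sum_uniq_sub us) // => i /f0 ->.
  exact: phi0.
have lPhi : linear Phi.
  move=> a x y; pose r := undup (supp x ++ supp y ++ supp (a *: x + y)).
  have ur : uniq r by exact: undup_uniq.
  rewrite !(PhiE _ r) //; try by move=> i si; rewrite mem_undup !mem_cat si ?orbT.
  rewrite scaler_sumr -big_split; apply: eq_bigr => i _ /=.
  by rewrite prl lphi.
pose PhiL : {linear V -> W} := HB.pack Phi (GRing.isLinear.Build K V W _ Phi lPhi).
exists PhiL => i x Fx /=.
have [us f0 _] := suppP x.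
have z j : j != i -> phi j (pr j x) = 0 by move=> ji; rewrite (pr0 _ i).
rewrite /Phi; have [si|si] := boolP (i \in supp x).
  by rewrite (bigD1_seq i) //= big1 ?addr0 ?pr1.
rewrite big_seq big1.
  by rewrite -(pr1 _ _ Fx) f0.
by move=> j sj; apply: z; apply: contraNneq si => <-.
Qed.
End Projections.

Section Eigenvectors.
Variables (K : fieldType) (V : lmodType K) (D : {linear V -> V}).

(** Applying the product of the operators D - a_i kills every summand, but multiplies
    the sum, an eigenvector for b, by the nonzero product of the b - a_i. *)
Lemma eigen_sum_eq0 (I : eqType) (s : seq I) (v : I -> V) (a : I -> K) (b : K) :
    (forall i, i \in s -> D (v i) = a i *: v i /\ a i != b) ->
    D (\sum_(i <- s) v i) = b *: \sum_(i <- s) v i ->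
  \sum_(i <- s) v i = 0.
Proof.
move=> vP; set g := \sum_(i <- s) v i => Dg.
pose q (r : seq I) x := foldr (fun i z => D z - a i *: z) x r.
have q0 r : q r 0 = 0 by elim: r => //= i r ->; rewrite linear0 scaler0 subr0.
have qD r : {morph q r : x y / x + y}.
  elim: r => [|i r IH] x y //=.
  by have := IH x y; rewrite /= => ->; rewrite linearD scalerDr opprD addrACA.
have qg r x : D x = b *: x -> q r x = (\prod_(i <- r) (b - a i)) *: x.
  move=> Dx; elim: r => [|i r]; first by rewrite big_nil scale1r.
  rewrite /= => ->.
  by rewrite big_cons linearZ /= Dx -[X in _ = X]scalerA scalerBl !scalerA
     [_ * b]mulrC.
have qv r i x : D x = a i *: x -> i \in r -> q r x = 0.
  move=> Dx; have qe r' : D (q r' x) = a i *: q r' x.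
    elim: r' => //= j r' IH; rewrite linearB linearZ /= IH linearZ /= IH scalerBr !scalerA.
    by rewrite [a j * _]mulrC.
  elim: r => //= j r IH; rewrite inE => /predU1P[<-|/IH ->]; last by rewrite linear0 scaler0 subr0.
  by rewrite qe subrr.
have : q s g = 0.
  rewrite /g (big_morph (q s) (qD s) (q0 s)) big_seq big1 // => i si.
  by apply: (qv _ i) => //; have [] := vP _ si.
rewrite qg // => /eqP; rewrite scaler_eq0 => /orP[|/eqP//].
rewrite prodf_seq_eq0 => /hasP[i si /=]; rewrite subr_eq0 => /eqP ba.
by have [_] := vP _ si; rewrite ba eqxx.
Qed.

(** An eigenvector written as a sum of eigenvectors may drop the summands for other
    eigenvalues; this recovers homogeneous representatives from arbitrary ones. *)
Lemma eigen_sum_filter (I : eqType) (s : seq I) (v : I -> V) (a : I -> K) (b : K) x :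
    (forall i, i \in s -> D (v i) = a i *: v i) -> D x = b *: x ->
    x = \sum_(i <- s) v i ->
  x = \sum_(i <- s | a i == b) v i.
Proof.
move=> vP Dx; rewrite (bigID (fun i => a i == b)) /= => xE.
suff y0 : \sum_(i <- s | a i != b) v i = 0 by rewrite {1}xE y0 addr0.
rewrite -big_filter; apply: (@eigen_sum_eq0 _ _ _ a b).
  by move=> i; rewrite mem_filter => /andP[? /vP].
rewrite big_filter.
have -> : \sum_(i <- s | a i != b) v i = x - \sum_(i <- s | a i == b) v i.
  by rewrite {1}xE [X in X - _]addrC addrK.
rewrite linearB scalerBr Dx; congr (_ - _).
rewrite linear_sum scaler_sumr big_seq_cond [RHS]big_seq_cond.
by apply: eq_bigr => i /andP[/vP -> /eqP ->].
Qed.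

Lemma eigen_independent (I : eqType) (P : pred I) (F : I -> set V) (a : I -> K) :
    {in P &, injective a} -> (forall i x, P i -> F i x -> D x = a i *: x) ->
  independent P F.
Proof.
move=> aI FD s f us sP s0 i si.
have [Pi Fi] := sP _ si.
have fE : f i = \sum_(j <- s | j != i) - f j.
  by rewrite sumrN; apply/eqP; rewrite -subr_eq0 opprK -(bigD1_seq i) //= s0.
suff : \sum_(j <- s | j != i) - f j = 0 by rewrite -fE.
rewrite -big_filter; apply: (@eigen_sum_eq0 _ _ _ a (a i)).
  move=> j; rewrite mem_filter => /andP[ji /sP[Pj Fj]]; split.
    by rewrite linearN (FD _ _ Pj Fj) scalerN.
  by apply: contraNneq ji => /(aI _ _ Pj Pi) ->.
by rewrite big_filter -fE (FD i).
Qed.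
End Eigenvectors.

Lemma eigen_independent2 (K : fieldType) (V : lmodType K) (D D' : {linear V -> V})
    (I : eqType) (P : pred I) (F : I -> set V) (a a' : I -> K) :
    (forall i j, P i -> P j -> a i = a j -> a' i = a' j -> i = j) ->
    (forall i x, P i -> F i x -> D x = a i *: x /\ D' x = a' i *: x) ->
  independent P F.
Proof.
move=> aI FD s f us sP s0 i si.
have Dv j : j \in s -> D (f j) = a j *: f j by move=> /sP[Pj Fj]; case: (FD _ _ Pj Fj).
have D0 : D 0 = a i *: 0 by rewrite linear0 scaler0.
have := eigen_sum_filter Dv D0 (esym s0); rewrite -big_filter => /esym s0'.
have Pi : P i by case: (sP _ si).
pose P' j := P j && (a j == a i).
have := @eigen_independent _ _ D' _ P' F a' _ _ [seq j <- s | a j == a i] f _ _ s0' i.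
apply; rewrite ?mem_filter ?eqxx ?filter_uniq //.
- by move=> j k /andP[Pj /eqP aj] /andP[Pk /eqP ak] /aI; apply => //; rewrite aj ak.
- by move=> j x /andP[Pj _] Fx; case: (FD _ _ Pj Fx).
- by move=> j; rewrite mem_filter => /andP[aj /sP[Pj Fj]]; split=> //; rewrite /P' Pj.
Qed.

(** * Lie brackets, complexification and quotients *)

Section LieAlgebra.
Variables (K : pzRingType) (V : lmodType K) (br : V -> V -> V).
Hypothesis hl : lie_bracket br.

Lemma lie_linearr x : linear (br x).
Proof. by move=> a y z; have [_ /(_ x Logic.I)[h _] _ _] := hl; exact: h. Qed.
Lemma lie_linearl x : linear (br ^~ x).
Proof. by move=> a y z; have [_ /(_ x Logic.I)[_ h] _ _] := hl; exact: h. Qed.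

Definition lie_ad x : {linear V -> V} :=
  HB.pack (br x) (GRing.isLinear.Build K V V _ (br x) (lie_linearr x)).
Definition lie_adr x : {linear V -> V} :=
  HB.pack (br ^~ x) (GRing.isLinear.Build K V V _ (br ^~ x) (lie_linearl x)).

Lemma lieDr x y z : br x (y + z) = br x y + br x z.
Proof. exact: (linearD (lie_ad x)). Qed.
Lemma lieDl x y z : br (y + z) x = br y x + br z x.
Proof. exact: (linearD (lie_adr x)). Qed.
Lemma lieNr x y : br x (- y) = - br x y.
Proof. exact: (linearN (lie_ad x)). Qed.
Lemma lieNl x y : br (- y) x = - br y x.
Proof. exact: (linearN (lie_adr x)). Qed.
Lemma lieBr x y z : br x (y - z) = br x y - br x z.
Proof. exact: (linearB (lie_ad x)). Qed.
Lemma lieBl x y z : br (y - z) x = br y x - br z x.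
Proof. exact: (linearB (lie_adr x)). Qed.
Lemma lie0r x : br x 0 = 0.
Proof. exact: (linear0 (lie_ad x)). Qed.
Lemma lie0l x : br 0 x = 0.
Proof. exact: (linear0 (lie_adr x)). Qed.
Lemma lieZr x a y : br x (a *: y) = a *: br x y.
Proof. by have := lie_linearr x a y 0; rewrite lie0r !addr0. Qed.
Lemma lieZl x a y : br (a *: y) x = a *: br y x.
Proof. by have := lie_linearl x a y 0; rewrite lie0l !addr0. Qed.
Lemma lie_sumr (I : Type) (r : seq I) (P : pred I) f x :
  br x (\sum_(i <- r | P i) f i) = \sum_(i <- r | P i) br x (f i).
Proof. exact: (linear_sum (lie_ad x)). Qed.
Lemma lie_suml (I : Type) (r : seq I) (P : pred I) f x :
  br (\sum_(i <- r | P i) f i) x = \sum_(i <- r | P i) br (f i) x.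
Proof. exact: (linear_sum (lie_adr x)). Qed.
Lemma liexx x : br x x = 0.
Proof. by have [_ _ h _] := hl; exact: h. Qed.
Lemma lieC x y : br x y = - br y x.
Proof.
apply/eqP; rewrite -addr_eq0.
by have := liexx (x + y); rewrite lieDl !lieDr !liexx add0r addr0 => ->.
Qed.
Lemma lie_jacobi x y z : br x (br y z) = br (br x y) z + br y (br x z).
Proof.
have [_ _ _ /(_ x y z Logic.I Logic.I Logic.I)/eqP] := hl.
rewrite (lieC z x) lieNr (lieC z) addrAC subr_eq0.
by rewrite subr_eq addrC => /eqP.
Qed.
Lemma lie_jacobil x y z : br (br x y) z = br x (br y z) - br y (br x z).
Proof. by rewrite (lie_jacobi x) addrK. Qed.
Lemma lie_jacobir x y z : br (br x y) z = br (br x z) y + br x (br y z).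
Proof. by rewrite lie_jacobil (lieC y (br x z)) opprK addrC. Qed.

Lemma foldl_bracket_comm z w s : (forall w', w' \in s -> br w w' = 0) ->
  foldl br (br z w) s = br (foldl br z s) w.
Proof.
elim: s z => [|w' s IH] z h //=.
have w0 : br w w' = 0 by apply: h; exact: mem_head.
rewrite lie_jacobir w0 lie0r addr0 IH // => x xs.
by apply: h; rewrite inE xs orbT.
Qed.

(** Brackets with commuting elements can be taken in any order. For (01)-vectors of
    degree -1 this is the symmetry of the structure maps of the core. *)
Lemma foldl_bracket_perm s s' z : (forall w w', w \in s -> w' \in s -> br w w' = 0) ->
  perm_eq s s' -> foldl br z s = foldl br z s'.
Proof.
elim: s s' z => [|w s IH] s' z h; first by rewrite perm_sym => /perm_nilP ->.
move=> ps; have ws' : w \in s' by rewrite -(perm_mem ps) mem_head.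
case/splitPr: ws' ps => s1 s2 ps.
have ps' : perm_eq s (s1 ++ s2) 
  by rewrite -(perm_cons w) (perm_trans ps) // -(cat1s w s2) perm_catCA.
rewrite /= (IH (s1 ++ s2)) //; last by move=> x y xs ys; apply: h; rewrite inE ?xs ?ys orbT.
rewrite !foldl_cat /= foldl_bracket_comm // => x xs; apply: h; first exact: mem_head.
by rewrite inE (perm_mem ps') mem_cat xs orbT.
Qed.
End LieAlgebra.

Section Complexification.
Variables (R : realType) (V : lmodType R).
Local Notation C := R[i].
Implicit Types (x y z : cplx V) (u v : V) (a : C).

Lemma cplxDE x y : x + y = (x.1 + y.1, x.2 + y.2).
Proof. by []. Qed.
Lemma cplxNE x : - x = (- x.1, - x.2).
Proof. by []. Qed.
Lemma cplxZE a x : a *: x =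
  (complex.Re a *: x.1 - complex.Im a *: x.2, complex.Re a *: x.2 + complex.Im a *: x.1).
Proof. by []. Qed.
Lemma cplx_iZ x : 'i%C *: x = (- x.2, x.1).
Proof. by rewrite cplxZE /= !scale0r !scale1r !add0r. Qed.
Lemma cplx_niZ x : - 'i%C *: x = (x.2, - x.1).
Proof. by rewrite scaleNr cplx_iZ cplxNE /= opprK. Qed.
Lemma cplxE x : x = rl x.1 + 'i%C *: rl x.2.
Proof. by case: x => u v; rewrite cplx_iZ cplxDE /= oppr0 addr0 add0r. Qed.

Lemma rlD u v : rl (u + v) = rl u + rl v.
Proof. by rewrite cplxDE /= addr0. Qed.
Lemma rlN u : rl (- u) = - rl u.
Proof. by rewrite cplxNE /= oppr0. Qed.
Lemma rlB u v : rl (u - v) = rl u - rl v.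
Proof. by rewrite rlD rlN. Qed.
Lemma rlZ (b : R) u : rl (b *: u) = (b%:C)%C *: rl u.
Proof. by rewrite cplxZE /= scaler0 subr0 scale0r addr0 scaler0. Qed.
Lemma rl0 : rl (0 : V) = 0. Proof. by []. Qed.
Lemma rl_sum (I : Type) (r : seq I) (P : pred I) (f : I -> V) :
  rl (\sum_(i <- r | P i) f i) = \sum_(i <- r | P i) rl (f i).
Proof. exact: (big_morph _ rlD rl0). Qed.
Lemma rl_inj : injective (@rl R V).
Proof. by move=> u v []. Qed.

Lemma cconjK : involutive (@cconj R V).
Proof. by case=> u v; rewrite /cconj /= opprK. Qed.
Lemma cconjD x y : cconj (x + y) = cconj x + cconj y.
Proof. by rewrite /cconj !cplxDE /= opprD. Qed.
Lemma cconj0 : cconj (0 : cplx V) = 0.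
Proof. by rewrite /cconj /= oppr0. Qed.
Lemma cconjN x : cconj (- x) = - cconj x.
Proof. by rewrite /cconj !cplxNE. Qed.
Lemma cconjB x y : cconj (x - y) = cconj x - cconj y.
Proof. by rewrite cconjD cconjN. Qed.
Lemma cconjZ a x : cconj (a *: x) = conjc a *: cconj x.
Proof.
by case: a => a1 a2; rewrite /cconj !cplxZE /= scalerN !scaleNr opprK opprD scalerN.
Qed.
Lemma cconj_rl u : cconj (rl u) = rl u.
Proof. by rewrite /cconj /= oppr0. Qed.
Lemma cconj_sum (I : Type) (r : seq I) (P : pred I) (f : I -> cplx V) :
  cconj (\sum_(i <- r | P i) f i) = \sum_(i <- r | P i) cconj (f i).
Proof. exact: (big_morph _ cconjD cconj0). Qed.
Lemma cconj_fix x : cconj x = x -> x = rl x.1.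
Proof.
case: x => u v [] /eqP; rewrite eq_sym -addr_eq0 -mulr2n -scaler_nat scaler_eq0 pnatr_eq0 /=.
by move=> /eqP ->.
Qed.
Lemma conjsetE (S : set (cplx V)) x : conjset S x <-> S (cconj x).
Proof. by split=> [[y Sy <-]|Sx]; [rewrite cconjK | exists (cconj x); rewrite ?cconjK]. Qed.

Lemma subspace_cplxset (S : set V) : subspace S -> subspace (cplxset S).
Proof.
move=> sS; split; first by split; exact: subspace0.
move=> a x y [x1 x2] [y1 y2]; split; rewrite cplxDE cplxZE /=.
  by apply: (subspaceD sS _ y1); apply: (subspaceB sS); exact: subspaceZ.
by apply: (subspaceD sS _ y2); apply: (subspaceD sS); exact: subspaceZ.
Qed.
Lemma cplxset_rl (S : set V) u : S 0 -> cplxset S (rl u) <-> S u.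
Proof. by move=> S0; split=> [[]|]. Qed.
Lemma cplxset_conj (S : set V) x : subspace S -> cplxset S x -> cplxset S (cconj x).
Proof. by move=> sS [? ?]; split=> //=; exact: subspaceN. Qed.
Lemma subspace_repart (S : set (cplx V)) : subspace S -> subspace (repart S).
Proof.
move=> sS; split; first by rewrite /repart /= rl0; exact: subspace0.
by move=> a x y Sx Sy; rewrite /repart /= rlD rlZ; exact: subspaceZD.
Qed.
Lemma subspace_setadd (K : pzRingType) (W : lmodType K) (A B : set W) :
  subspace A -> subspace B -> subspace (setadd A B).
Proof.
move=> sA sB; split; first by exists 0, 0; rewrite addr0; do !split; exact: subspace0.
move=> a _ _ [x [y [Ax [By ->]]]] [x' [y' [Ax' [By' ->]]]].
exists (a *: x + x'), (a *: y + y'); split; first exact: subspaceZD.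
by split; [exact: subspaceZD | rewrite scalerDr addrACA].
Qed.

Variable br : V -> V -> V.
Hypothesis hl : lie_bracket br.

Lemma cbr_rl u v : cbr br (rl u) (rl v) = rl (br u v).
Proof. by rewrite /cbr /= !(lie0r hl) (lie0l hl) subr0 addr0. Qed.
Lemma cbr_conj x y : cconj (cbr br x y) = cbr br (cconj x) (cconj y).
Proof.
rewrite /cbr /cconj /= (lieNr hl) !(lieNl hl) (lieNr hl) opprK.
by rewrite opprD.
Qed.
Lemma cbrDr x y z : cbr br x (y + z) = cbr br x y + cbr br x z.
Proof.
rewrite /cbr !cplxDE /= !(lieDr hl); congr (_, _); last by rewrite addrACA.
by rewrite opprD addrACA.
Qed.
Lemma cbrC x y : cbr br x y = - cbr br y x.
Proof.
rewrite /cbr cplxNE /= (lieC hl x.1) (lieC hl x.2) (lieC hl x.1 y.2) (lieC hl x.2 y.1).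
by rewrite opprB !opprD opprK [in X in (X, _)]addrC [in X in (_, X)]addrC.
Qed.
Lemma cbrZr a x y : cbr br x (a *: y) = a *: cbr br x y.
Proof.
case: a => a1 a2; rewrite /cbr !cplxZE /= !(lieBr hl) !(lieDr hl) !(lieZr hl).
congr (_, _); rewrite ?scalerBr ?scalerDr.
  by rewrite !opprD -!addrA; congr (_ + _); rewrite addrCA.
by rewrite -!addrA; congr (_ + _); rewrite [in LHS]addrC -addrA [in RHS]addrCA [in RHS]addrC -!addrA.
Qed.

(** The Jacobi expression is cyclic and complex linear in each argument, so it vanishes
    identically once it vanishes on real vectors. *)
Lemma lie_cbr : lie_bracket (cbr br).
Proof.
have linr x : linear (cbr br x) by move=> a y z; rewrite cbrDr cbrZr.
have linl x : linear (cbr br ^~ x).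
  by move=> a y z; rewrite /= (cbrC (a *: y + z)) linr opprD -scalerN -(cbrC y x) -(cbrC z x).
split=> //.
- by move=> x _; split=> a y z _ _; [exact: linr | exact: linl].
- by move=> x _; rewrite /cbr !(liexx hl) subrr (lieC hl x.1) addNr.
pose Jc x y z := cbr br x (cbr br y z) + cbr br y (cbr br z x) + cbr br z (cbr br x y).
have Jcyc x y z : Jc x y z = Jc y z x by rewrite /Jc [RHS]addrC addrA.
have Jlin x y z z' a : Jc x y (a *: z + z') = a *: Jc x y z + Jc x y z'.
  rewrite /Jc !linr !linl !scalerDr linr -!addrA; congr (_ + _).
  rewrite addrCA; congr (_ + _); rewrite !addrA; congr (_ + _).
  by rewrite addrC addrA.
have Jrl u v u' : Jc (rl u) (rl v) (rl u') = 0.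
  have [_ _ _ h] := hl; by rewrite /Jc !cbr_rl -!rlD h.
have J0 x y : (forall u, Jc x y (rl u) = 0) -> forall z, Jc x y z = 0.
  by move=> h z; rewrite (cplxE z) addrC Jlin !h scaler0 addr0.
move=> x y z _ _ _; rewrite -/(Jc x y z).
apply: (J0) => u; rewrite -Jcyc; apply: (J0) => v; rewrite -Jcyc.
by apply: (J0) => u'; rewrite -Jcyc Jrl.
Qed.
End Complexification.

Lemma cplxmap_linear_on (R : realType) (V W : lmodType R) (S : set V) (f : V -> W) :
  subspace S -> linear_on S f -> linear_on (cplxset S) (cplxmap f).
Proof.
move=> sS lf a [x1 x2] [y1 y2] [/= Sx1 Sx2] [/= Sy1 Sy2].
have SZ b x : S x -> S (b *: x) by move=> Sx; exact: subspaceZ.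
rewrite /cplxmap !cplxDE !cplxZE /=; congr (_, _).
  rewrite (linear_onD lf) ?(linear_onB sS lf) ?(linear_onZ sS lf) //; try exact: SZ.
  by apply: (subspaceB sS); exact: SZ.
rewrite !(linear_onD lf) ?(linear_onZ sS lf) //; try exact: SZ.
by apply: (subspaceD sS); exact: SZ.
Qed.

Lemma cplxset_repart (R : realType) (V : lmodType R) (S : set (cplx V)) :
  subspace S -> conjset S = S -> cplxset (repart S) = S.
Proof.
move=> sS cS; have cSz z : S z -> S (cconj z) by move=> Sz; apply/conjsetE; rewrite cS.
apply/seteqP; split=> z; rewrite /cplxset /repart /=.
  by move=> [z1 z2]; rewrite (cplxE z); apply: (subspaceD sS) => //; exact: (subspaceZ sS).
have re w : S w -> S (rl w.1).
  move=> Sw; have -> : rl w.1 = 2%:R^-1 *: (w + cconj w).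
    apply: (scalerI (a := 2%:R : R[i])); first by rewrite pnatr_eq0.
    rewrite scalerA mulfV ?pnatr_eq0 // scale1r scaler_nat mulr2n.
    by case: (w) => a b; rewrite !cplxDE /= addr0 subrr.
  by apply: (subspaceZ sS); apply: (subspaceD sS) => //; exact: cSz.
move=> Sz; split; first exact: re.
have := re (- 'i%C *: z); rewrite cplx_niZ /=; apply.
by rewrite -cplx_niZ; exact: (subspaceZ sS).
Qed.

Lemma coset_eq (V : zmodType) (G : set V) : G 0 -> (forall x y, G x -> G y -> G (x - y)) ->
  forall x y, coset G x = coset G y <-> G (y - x).
Proof.
move=> G0 GB x y; split=> [/seteqP[_ /(_ y)]|Gyx]; first by rewrite /coset /= subrr; apply.
apply/seteqP; split=> z; rewrite /coset /= => Gz.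
  by have := GB _ _ Gz Gyx; rewrite opprB addrA subrK.
have -> : z - x = (z - y) - (0 - (y - x)) by rewrite sub0r opprK addrA subrK.
by apply: (GB) => //; exact: GB.
Qed.

Lemma quo_bij (K : pzRingType) (V : lmodType K) (A F G : set V) : subspace A -> subspace G ->
  A `<=` F -> F `<=` setadd A G -> A `&` G `<=` [set 0] -> set_bij A (quo F G) (coset G).
Proof.
move=> sA sG AF FAG AG; have cE := coset_eq (subspace0 sG) (subspaceB sG); split.
- by move=> x Ax; exists x => //; exact: AF.
- move=> x y; rewrite !inE => Ax Ay /cE Gyx; apply/esym/subr0_eq/AG; split=> //.
  exact: (subspaceB sA).
- move=> _ [x /FAG [a [g [Aa [Gg ->]]]] <-]; exists a => //.
  by apply/cE; rewrite addrC addKr.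
Qed.

(** If all spaces are stable under conjugation, the real classes of F / G are
    represented by the real vectors of a complement: for a representative a of a real
    class, a minus its conjugate lies in the complement and in G. *)
Lemma quo_real_bij (R : realType) (V : lmodType R) (A F G : set (cplx V)) : subspace A -> subspace G ->
  conjset A = A -> conjset G = G ->
  A `<=` F -> F `<=` setadd A G -> A `&` G `<=` [set 0] ->
  set_bij (repart A) [set X | quo F G X /\ conjset X = X] (fun x => coset G (rl x)).
Proof.
move=> sA sG cA cG AF FAG AG; have cE := coset_eq (subspace0 sG) (subspaceB sG).
have GA z : A z -> G z -> z = 0 by move=> Az Gz; apply: AG.
have conj_coset z : conjset (coset G z) = coset G (cconj z).
  have cGi w : G w -> G (cconj w) by move=> Gw; apply/conjsetE; rewrite cG.
  apply/seteqP; split=> y; rewrite /coset /=.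
    by move=> /conjsetE /cGi; rewrite cconjB cconjK.
  by move=> /cGi; rewrite cconjB cconjK => Gy; apply/conjsetE.
split.
- move=> x Ax; split; first by exists (rl x) => //; exact: AF.
  by rewrite conj_coset cconj_rl.
- move=> x y; rewrite !inE => Ax Ay /cE Gyx; apply: rl_inj; apply/esym/subr0_eq/GA => //.
  exact: (subspaceB sA).
- move=> _ [[x /FAG [a [g [Aa [Gg ->]]]] <-]].
  have -> : coset G (a + g) = coset G a by apply/cE; rewrite opprD addNKr; exact: (subspaceN sG).
  rewrite conj_coset => /cE Ga.
  have /subr0_eq/esym/cconj_fix aE : a - cconj a = 0.
    by apply: GA => //; apply: (subspaceB sA) => //; apply/conjsetE; rewrite cA.
  by exists a.1; rewrite /repart /= -?aE.
Qed.

(** * The contact bracket on polynomials *)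

(** A Poisson bracket becomes a Jacobi bracket with the help of commuting operators z
    and d: d is a derivation of the product and of the bracket, whereas z is a
    derivation of the bracket that fails to be a derivation of the product by the term
    -2fg. *)
Lemma jacobi_bracket (P : comPzRingType) (pb : P -> P -> P) (z d : {additive P -> P}) :
    (forall f, {morph pb f : g h / g + h}) ->
    (forall f g, pb f g = - pb g f) ->
    (forall f g h, pb f (g * h) = pb f g * h + g * pb f h) ->
    (forall f g h, pb f (pb g h) + pb g (pb h f) + pb h (pb f g) = 0) ->
    (forall f g, d (pb f g) = pb (d f) g + pb f (d g)) ->
    (forall f g, z (pb f g) = pb (z f) g + pb f (z g)) ->
    (forall f g, d (f * g) = d f * g + f * d g) ->
    (forall f g, z (f * g) = z f * g + f * z g - f * g *+ 2) ->
    (forall f, d (z f) = z (d f)) ->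
  let c f g := pb f g + z f * d g - d f * z g in
  forall f g h, c f (c g h) + c g (c h f) + c h (c f g) = 0.
Proof.
move=> pbD pbC pbM pbJ dpb zpb dM zM dz c f g h; rewrite /c {c}.
have pbN f' g' : pb f' (- g') = - pb f' g'.
  apply/eqP; rewrite -addr_eq0 -pbD addNr; apply/eqP.
  by have /eqP := pbD f' 0 0; rewrite addr0 -subr_eq0 opprD addNKr oppr_eq0 => /eqP.
rewrite !(raddfD, raddfB, raddfN, pbD, pbN, pbM, dpb, zpb, dM, zM, dz) /=.
have := pbJ f g h; move/(canRL (addrK _))/(canRL (addrK _)) => ->.
rewrite ?(pbC h f, pbC g f, pbC h g, pbC (d g) f, pbC (d h) f, pbC (d h) g).
rewrite ?(pbC (z g) f, pbC (z h) f, pbC (z h) g).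
rewrite ?(pbC h (d f), pbC h (d g), pbC g (d f), pbC g (z f), pbC h (z f), pbC h (z g)).
ring.
Qed.

(** What the contact bracket needs of the polynomial ring in t, y_1, ..., y_N: its
    partial derivatives. Working over an abstract commutative algebra lets the same
    statements serve real and complex polynomials. *)
Record contact_coordinates (F : numFieldType) (P : comAlgType F) (N : nat)
    (dt : {linear P -> P}) (dx : 'I_N -> {linear P -> P})
    (t : P) (y : 'I_N -> P) : Prop := ContactCoordinates {
  dtM : forall f g, dt (f * g) = dt f * g + f * dt g;
  dxM : forall i f g, dx i (f * g) = dx i f * g + f * dx i g;
  dxdt : forall i f, dx i (dt f) = dt (dx i f);
  dxdx : forall i j f, dx i (dx j f) = dx j (dx i f);
  dt_t : dt t = 1;
  dt_y : forall i, dt (y i) = 0;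
  dx_t : forall i, dx i t = 0;
  dx_y : forall i j, dx i (y j) = (i == j)%:R }.

Section ContactBracket.
Variables (F : numFieldType) (P : comAlgType F) (N : nat).
Variables (dt : {linear P -> P}) (dx : 'I_N -> {linear P -> P}).
Variables (t : P) (y : 'I_N -> P) (w : 'M[F]_N).
Hypothesis cc : contact_coordinates dt dx t y.
Let dtM := dtM cc. Let dxM := dxM cc. Let dxdt := dxdt cc. Let dxdx := dxdx cc.
Let dt_t := dt_t cc. Let dt_y := dt_y cc. Let dx_t := dx_t cc. Let dx_y := dx_y cc.

(** The Poisson bracket with constant coefficients w. *)
Definition pbr (f g : P) : P := \sum_i \sum_j w i j *: (dx i f * dx j g).
Definition euler (f : P) : P := \sum_i y i * dx i f.
Definition zop (f : P) : P := f *+ 2 - euler f.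
Definition contact (f g : P) : P := pbr f g + zop f * dt g - dt f * zop g.

Lemma dt1 : dt 1 = 0.
Proof.
by have /eqP := dtM 1 1; rewrite !mulr1 mul1r -subr_eq0 opprD addNKr oppr_eq0 => /eqP.
Qed.
Lemma dx1 i : dx i 1 = 0.
Proof.
by have /eqP := dxM i 1 1; rewrite !mulr1 mul1r -subr_eq0 opprD addNKr oppr_eq0 => /eqP.
Qed.

Lemma pbr_linear f : linear (pbr f).
Proof.
move=> a g h; rewrite /pbr scaler_sumr -big_split; apply: eq_bigr => i _ /=.
rewrite scaler_sumr -big_split; apply: eq_bigr => j _ /=.
by rewrite linearP mulrDr scalerDr -!scalerAr !scalerA mulrC.
Qed.
HB.instance Definition _ f := GRing.isLinear.Build F P P _ (pbr f) (pbr_linear f).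

Lemma pbrDl f f' g : pbr (f + f') g = pbr f g + pbr f' g.
Proof.
rewrite /pbr -big_split; apply: eq_bigr => i _; rewrite -big_split; apply: eq_bigr => j _ /=.
by rewrite linearD mulrDl scalerDr.
Qed.
Lemma pbrZl a f g : pbr (a *: f) g = a *: pbr f g.
Proof.
rewrite /pbr scaler_sumr; apply: eq_bigr => i _; rewrite scaler_sumr.
by apply: eq_bigr => j _; rewrite linearZ -scalerAl !scalerA mulrC.
Qed.
Lemma pbrBl f f' g : pbr (f - f') g = pbr f g - pbr f' g.
Proof. by rewrite pbrDl -scaleN1r pbrZl scaleN1r. Qed.

Lemma pbrM f g h : pbr f (g * h) = pbr f g * h + g * pbr f h.
Proof.
rewrite /pbr mulr_suml mulr_sumr -big_split; apply: eq_bigr => i _ /=.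
rewrite mulr_suml mulr_sumr -big_split; apply: eq_bigr => j _ /=.
rewrite dxM -!scalerAl -!scalerAr -scalerDr; congr (_ *: _); ring.
Qed.

Lemma euler_linear : linear euler.
Proof.
move=> a g h; rewrite /euler scaler_sumr -big_split; apply: eq_bigr => i _ /=.
by rewrite linearP mulrDr -scalerAr.
Qed.
HB.instance Definition _ := GRing.isLinear.Build F P P _ euler euler_linear.

Lemma eulerM f g : euler (f * g) = euler f * g + f * euler g.
Proof.
rewrite /euler mulr_suml mulr_sumr -big_split; apply: eq_bigr => i _ /=.
by rewrite dxM; ring.
Qed.

Lemma zop_linear : linear zop.
Proof.
by move=> a g h; rewrite /zop linearP mulrnDl scalerMnr scalerBr opprD addrACA.
Qed.
HB.instance Definition _ := GRing.isLinear.Build F P P _ zop zop_linear.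

Lemma derivation_pbr (D : {linear P -> P}) :
    (forall f g, D (f * g) = D f * g + f * D g) -> (forall i f, dx i (D f) = D (dx i f)) ->
  forall f g, D (pbr f g) = pbr (D f) g + pbr f (D g).
Proof.
move=> DM Ddx f g; rewrite /pbr linear_sum -big_split; apply: eq_bigr => i _ /=.
rewrite linear_sum -big_split; apply: eq_bigr => j _ /=.
by rewrite linearZ /= DM scalerDr !Ddx.
Qed.

Lemma dt_euler f : dt (euler f) = euler (dt f).
Proof.
rewrite /euler linear_sum; apply: eq_bigr => i _ /=.
by rewrite dtM dt_y mul0r add0r dxdt.
Qed.

Lemma dx_euler i f : dx i (euler f) = dx i f + euler (dx i f).
Proof.
rewrite /euler linear_sum.
under eq_bigr => j _ do rewrite /= dxM dx_y dxdx.
rewrite big_split /= (bigD1 i) //= eqxx mul1r big1 ?addr0 //.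
by move=> j /negbTE nji; rewrite eq_sym nji mul0r.
Qed.

Lemma dt_zop f : dt (zop f) = zop (dt f).
Proof. by rewrite /zop linearB linearMn dt_euler. Qed.

Lemma euler_pbr f g : euler (pbr f g) = pbr (euler f) g + pbr f (euler g) - pbr f g *+ 2.
Proof.
rewrite /pbr linear_sum -sumrMnl -big_split -sumrB; apply: eq_bigr => i _ /=.
rewrite linear_sum -sumrMnl -big_split -sumrB; apply: eq_bigr => j _ /=.
rewrite linearZ /= eulerM !dx_euler scalerMnr -scalerDr -scalerBr; congr (_ *: _).
by ring.
Qed.

Lemma zop_pbr f g : zop (pbr f g) = pbr (zop f) g + pbr f (zop g).
Proof.
rewrite /zop euler_pbr pbrBl linearB /= [pbr (f *+ 2) g]pbrDl linearMn /=.
by ring.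
Qed.
Lemma zopM f g : zop (f * g) = zop f * g + f * zop g - f * g *+ 2.
Proof. by rewrite /zop eulerM; ring. Qed.

Lemma contact_linear f : linear (contact f).
Proof.
move=> a g h; rewrite /contact [pbr _ _]linearP [zop (_ + _)]linearP [dt (_ + _)]linearP /=.
move: (zop _) (zop _) (zop _) (pbr _ _) (pbr _ _) => zf zg zh p q.
rewrite !mulrDr -!scalerAr !scalerDr scalerN opprD !addrA.
move: (_ *: _) (_ *: _) (_ *: _) => r1 r2 r3; ring.
Qed.
HB.instance Definition _ f := GRing.isLinear.Build F P P _ (contact f) (contact_linear f).

Hypothesis wskew : w^T = - w.

Lemma skewC i j : w i j = - w j i.
Proof. by have /matrixP/(_ j i) := wskew; rewrite !mxE. Qed.

Lemma pbrC f g : pbr f g = - pbr g f.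
Proof.
rewrite /pbr -sumrN exchange_big; apply: eq_bigr => i _ /=.
rewrite -sumrN; apply: eq_bigr => j _ /=.
by rewrite skewC scaleNr mulrC.
Qed.

(** The second-order part of the double bracket {f, {g, h}} in which the second
    derivatives fall on g. It is symmetric in the outer arguments, which makes the
    Jacobi sum cancel. *)
Definition pbrS f g h : P :=
  \sum_i \sum_j \sum_k \sum_l (w i j * w k l) *: (dx i f * dx j (dx k g) * dx l h).

Lemma pbrS_sym f g h : pbrS f g h = pbrS h g f.
Proof.
rewrite /pbrS.
rewrite exchange_big [in RHS]exchange_big /=.
transitivity (\sum_j \sum_k \sum_i \sum_l
   (w i j * w k l) *: (dx i f * dx j (dx k g) * dx l h)).
  by apply: eq_bigr => j _; rewrite exchange_big.
rewrite exchange_big; apply: eq_bigr => k _ /=.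
rewrite [RHS]exchange_big; apply: eq_bigr => j _ /=.
rewrite exchange_big; apply: eq_bigr => l _ /=.
apply: eq_bigr => i _ /=.
rewrite (skewC i j) (skewC k l) (dxdx j) mulrNN [w j i * _]mulrC; congr (_ *: _).
ring.
Qed.

Lemma pbr_pbr f g h : pbr f (pbr g h) = pbrS f g h - pbrS f h g.
Proof.
rewrite {1}/pbr.
under eq_bigr => i _ do under eq_bigr => j _ do
  rewrite (derivation_pbr (dxM j) (fun i => dxdx i j)) mulrDr scalerDr.
under eq_bigr => i _ do rewrite big_split /=.
rewrite big_split /=; congr (_ + _).
  rewrite /pbrS; apply: eq_bigr => i _; apply: eq_bigr => j _.
  rewrite mulr_sumr scaler_sumr; apply: eq_bigr => k _.
  rewrite mulr_sumr scaler_sumr; apply: eq_bigr => l _.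
  by rewrite -scalerAr scalerA mulrA (dxdx j).
rewrite /pbrS -sumrN; apply: eq_bigr => i _; rewrite -sumrN; apply: eq_bigr => j _.
rewrite /pbr exchange_big mulr_sumr scaler_sumr -sumrN; apply: eq_bigr => k _ /=.
rewrite mulr_sumr scaler_sumr -sumrN; apply: eq_bigr => l _.
rewrite (skewC k l) mulrN scaleNr opprK -scalerAr scalerA; congr (_ *: _).
by rewrite (dxdx j); ring.
Qed.

Lemma pbr_jacobi f g h : pbr f (pbr g h) + pbr g (pbr h f) + pbr h (pbr f g) = 0.
Proof.
rewrite !pbr_pbr (pbrS_sym h g f) (pbrS_sym h f g) (pbrS_sym g h f).
move: (pbrS _ _ _) (pbrS _ _ _) (pbrS _ _ _) => a b c; ring.
Qed.

Lemma contactC f g : contact f g = - contact g f.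
Proof. by rewrite /contact pbrC; move: (zop f) (zop g) => ? ?; ring. Qed.

Lemma contactxx f : contact f f = 0.
Proof.
apply/eqP; have /eqP := contactC f f; rewrite -addr_eq0 -mulr2n.
by rewrite -scaler_nat scaler_eq0 pnatr_eq0.
Qed.

Lemma contact_linearl g : linear (contact ^~ g).
Proof.
move=> a f h /=; rewrite contactC linearP /= opprD -scalerN -(contactC f) -(contactC h).
by [].
Qed.

Lemma contact_jacobi f g h :
  contact f (contact g h) + contact g (contact h f) + contact h (contact f g) = 0.
Proof.
apply: (jacobi_bracket (pb := pbr) (z := zop) (d := dt)).
- by move=> ? ? ?; rewrite linearD.
- exact: pbrC.
- exact: pbrM.
- exact: pbr_jacobi.
- by apply: derivation_pbr dtM dxdt.
- exact: zop_pbr.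
- exact: dtM.
- exact: zopM.
- exact: dt_zop.
Qed.

Lemma contact_lie : lie_bracket contact.
Proof.
split=> //.
- by move=> f _; split=> a g h _ _; [exact: linearP | exact: contact_linearl].
- by move=> f _; exact: contactxx.
- by move=> *; exact: contact_jacobi.
Qed.

(** Twice the degree in t plus the degree in the y_i, as a differential operator. *)
Definition weight (f : P) : P := (t * dt f) *+ 2 + euler f.

Lemma weight_linear : linear weight.
Proof.
move=> a f g; rewrite /weight linearP [euler _]linearP /= mulrDr mulrnDl -scalerAr.
by rewrite [in RHS]scalerDr -[a *: (_ *+ 2)]scalerMnr addrACA.
Qed.
HB.instance Definition _ := GRing.isLinear.Build F P P _ weight weight_linear.

Lemma weightM f g : weight (f * g) = weight f * g + f * weight g.
Proof. by rewrite /weight dtM eulerM; move: (euler f) (euler g) => ? ?; ring. Qed.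

(** The polynomials of weight p + 2: the shift makes the bracket, which lowers the
    weight by 2, graded. *)
Definition Gr (p : int) : set P := [set f | weight f = (p + 2)%:~R *: f].

Lemma subspace_Gr p : subspace (Gr p).
Proof.
split=> [|a f g]; rewrite /Gr /= ?linear0 ?scaler0 // => fE gE.
by rewrite [weight _]linearP /= fE gE scalerDr !scalerA mulrC.
Qed.

Lemma euler_t : euler t = 0.
Proof. by rewrite /euler big1 // => i _; rewrite dx_t mulr0. Qed.
Lemma euler_y i : euler (y i) = y i.
Proof.
rewrite /euler (bigD1 i) //= dx_y eqxx mulr1 big1 ?addr0 // => j /negbTE ji.
by rewrite dx_y ji mulr0.
Qed.
Lemma euler1 : euler 1 = 0.
Proof. by rewrite /euler big1 // => i _; rewrite dx1 mulr0. Qed.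

Lemma contact_t f : contact t f = weight f - f *+ 2.
Proof.
rewrite /contact /pbr big1; last by move=> i _; rewrite big1 // => j _; rewrite dx_t mul0r scaler0.
by rewrite /zop /weight euler_t dt_t; move: (euler f) => ?; ring.
Qed.

(** The variable t is the grading element. *)
Lemma GrP p f : Gr p f <-> contact t f = p%:~R *: f.
Proof.
have E : (p + 2)%:~R *: f = p%:~R *: f + f *+ 2.
  by rewrite intrD scalerDl -scaler_nat.
rewrite /Gr /= E contact_t; split=> [->|<-]; first by rewrite addrK.
by rewrite subrK.
Qed.

Lemma Gr_contact p q f g : Gr p f -> Gr q g -> Gr (p + q) (contact f g).
Proof.
move=> /GrP fE /GrP gE; apply/GrP.
have := contact_jacobi t f g; rewrite (contactC g t) gE fE linearN !linearZ /= (contactC g) !scalerN.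
move=> /eqP; rewrite -addrA -opprD -scalerDl subr_eq0 => /eqP ->.
by rewrite intrD addrC.
Qed.

Lemma GrM p q f g : Gr p f -> Gr q g -> Gr (p + q + 2) (f * g).
Proof.
rewrite /Gr /= => fE gE; rewrite weightM fE gE -scalerAl -scalerAr -scalerDl.
by congr (_ *: _); rewrite !intrD; ring.
Qed.
Lemma Gr_t : Gr 0 t.
Proof. by rewrite /Gr /= /weight euler_t dt_t mulr1 addr0 add0r scaler_nat. Qed.
Lemma Gr_1 : Gr (-2) 1.
Proof. by rewrite /Gr /= /weight euler1 dt1 mulr0 mul0rn addr0 scale0r. Qed.
Lemma Gr_y i : Gr (-1) (y i).
Proof. by rewrite /Gr /= /weight euler_y dt_y mulr0 mul0rn add0r scale1r. Qed.

Variable W : 'M[F]_N.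
Hypothesis wW : w *m W^T = 1%:M.

(** The basis of linear forms with {f, x_i} = df/dy_i. *)
Definition dual_y (i : 'I_N) : P := \sum_k W i k *: y k.
Local Notation x := dual_y.

Lemma Gr_dual i : Gr (-1) (x i).
Proof.
apply: (subspace_sum (subspace_Gr _)) => k _; apply: (subspaceZ (subspace_Gr _)).
exact: Gr_y.
Qed.
Lemma dt_dual i : dt (x i) = 0.
Proof. by rewrite linear_sum big1 // => k _; rewrite linearZ /= dt_y scaler0. Qed.
Lemma dx_dual k i : dx k (x i) = W i k *: 1.
Proof.
rewrite linear_sum (bigD1 k) //= linearZ /= dx_y eqxx big1 ?addr0 // => j /negbTE jk.
by rewrite linearZ /= dx_y eq_sym jk scaler0.
Qed.
Lemma euler_dual i : euler (x i) = x i.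
Proof. by rewrite linear_sum; apply: eq_bigr => k _; rewrite linearZ /= euler_y. Qed.

Lemma pbr_dual f i : pbr f (x i) = dx i f.
Proof.
have E j : \sum_k w j k * W i k = (j == i)%:R.
  by have /matrixP/(_ j i) := wW; rewrite !mxE => <-; apply: eq_bigr => k _; rewrite mxE.
have E' j : \sum_k w j k *: (dx j f * dx k (x i)) = (j == i)%:R *: dx j f.
  by rewrite -E scaler_suml; apply: eq_bigr => k _; rewrite dx_dual -scalerAr mulr1 scalerA.
rewrite /pbr (bigD1 i) //= E' eqxx scale1r big1 ?addr0 // => j /negbTE ji.
by rewrite E' ji scale0r.
Qed.

Lemma contact_dual f i : contact f (x i) = dx i f - dt f * x i.
Proof.
rewrite /contact pbr_dual dt_dual mulr0 addr0 /zop euler_dual; congr (_ - _ * _).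
by rewrite mulr2n addrK.
Qed.
Lemma contact_1 f : contact f 1 = - (dt f *+ 2).
Proof.
rewrite /contact /pbr big1; last by move=> i _; rewrite big1 // => j _; rewrite dx1 mulr0 scaler0.
by rewrite [zop 1]/zop euler1 dt1 mulr0 subr0 addr0 add0r mulrnAr mulr1.
Qed.
Lemma contact_dual_dual i j : contact (x i) (x j) = W i j *: 1.
Proof. by rewrite contact_dual dx_dual dt_dual mul0r subr0. Qed.

Lemma dual_skew i j : W i j = - W j i.
Proof.
have Wu : W^T \in unitmx by have [] := mulmx1_unit wW.
have : w^T *m W = 1%:M by rewrite -[LHS]trmxK trmx_mul trmxK (mulmx1C wW) trmx1.
rewrite wskew mulNmx => E.
have WE : W = - W^T.
  rewrite -[LHS]mul1mx -(mulmx1C wW) -mulmxA -[w *m W]opprK E mulmxN mulmx1 //.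
by rewrite {1}WE !mxE.
Qed.

Lemma y_dual i : y i = \sum_j w j i *: x j.
Proof.
have E k : \sum_j w j i * W j k = (k == i)%:R.
  by have /matrixP/(_ k i) := mulmx1C wW; rewrite !mxE => <-; apply: eq_bigr => j _; rewrite mxE mulrC.
rewrite /dual_y; under eq_bigr => j _ do rewrite scaler_sumr.
rewrite exchange_big /= (bigD1 i) //= [X in _ + X]big1.
  under eq_bigr => j _ do rewrite scalerA.
  by rewrite -scaler_suml E eqxx scale1r addr0.
move=> k /negbTE ki; under eq_bigr => j _ do rewrite scalerA.
by rewrite -scaler_suml E ki scale0r.
Qed.

(** Commuting with the x_i kills df/dt, since 1 is a multiple of a bracket of two of
    them and [f, 1] = -2 df/dt. Then all df/dy_i vanish as well, and the weight operator
    gives (p + 2) f = 0. *)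
Lemma contact_transitive (i0 : 'I_N) (p : int) f :
  0 <= p -> Gr p f -> (forall v, Gr (-1) v -> contact f v = 0) -> f = 0.
Proof.
move=> p0 Gf fv.
have [j Wj] : exists j, W j i0 != 0.
  apply: contrapT => /forallNP W0.
  have /matrixP/(_ i0 i0)/eqP := wW; rewrite !mxE eqxx big1 ?(eq_sym 0) ?oner_eq0 // => k _.
  rewrite mxE; have /negP := W0 k; rewrite negbK dual_skew oppr_eq0 => /eqP ->.
  by rewrite mulr0.
have dtf : dt f = 0.
  have := contact_jacobi f (x j) (x i0).
  rewrite contact_dual_dual (contactC (x i0)) (fv _ (Gr_dual j)) (fv _ (Gr_dual i0)).
  rewrite linearZ /= contact_1 oppr0 !linear0 !addr0 => /eqP.
  rewrite scaler_eq0 (negbTE Wj) /= oppr_eq0 -scaler_nat scaler_eq0 pnatr_eq0 /=.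
  by move/eqP.
have dxf i : dx i f = 0.
  by have := fv _ (Gr_dual i); rewrite contact_dual dtf mul0r subr0.
move: Gf; rewrite /Gr /= /weight dtf mulr0 mul0rn add0r /euler big1 => [/esym/eqP|i _].
  rewrite scaler_eq0 intr_eq0 => /orP[|/eqP//]; lia.
by rewrite dxf mulr0.
Qed.

Lemma double_inj (a b : P) : a *+ 2 = b *+ 2 -> a = b.
Proof.
move=> /eqP; rewrite -subr_eq0 -mulrnBl -scaler_nat scaler_eq0 pnatr_eq0 subr_eq0 /=.
by move/eqP.
Qed.

(** The Poincare lemma for the contact bracket. The prescribed brackets determine the
    partial derivatives that f must have: df/dt = g, where F1 = -2g, and df/dy_i =
    Fx_i + g x_i = H_i. The hypotheses say that this gradient is closed, and Euler's
    formula for the weight integrates it: the weight p + 2 of f times f is 2tg + sum y_k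
    H_k. *)
Lemma contact_prolongation (p : int) (Fx : 'I_N -> P) (F1 : P) :
    0 <= p -> (forall i, Gr (p - 1) (Fx i)) -> Gr (p - 2) F1 ->
    (forall i j, contact (Fx i) (x j) - contact (Fx j) (x i) = W i j *: F1) ->
    (forall i, contact (Fx i) 1 = contact F1 (x i)) ->
  exists f, [/\ Gr p f, forall i, contact f (x i) = Fx i & contact f 1 = F1].
Proof.
move=> p0 GF GF1 c1 c2.
have two : 2%:R != 0 :> F by rewrite pnatr_eq0.
have [g F1E Gg] : exists2 g, F1 = - (g *+ 2) & Gr (p - 2) g.
  exists (- (2%:R^-1 *: F1)).
    by rewrite mulNrn opprK -scaler_nat scalerA mulfV ?scale1r.
  by apply: (subspaceN (subspace_Gr _)); apply: (subspaceZ (subspace_Gr _)).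
pose H i := Fx i + g * x i.
have GH i : Gr (p - 1) (H i).
  apply: (subspaceD (subspace_Gr _)) => //.
  have := GrM Gg (Gr_dual i); congr (Gr _ _); lia.
have dtF i : dt (Fx i) = dx i g - dt g * x i.
  apply: double_inj; apply: oppr_inj; rewrite -contact_1 c2 contact_dual F1E.
  rewrite !linearN !linearMn /=; move: (dx i g) (dt g) (x i) => a b c; ring.
have dtH i : dt (H i) = dx i g.
  by rewrite linearD /= dtM dt_dual mulr0 addr0 dtF subrK.
have dxH i j : dx j (H i) = dx i (H j).
  have := c1 i j; rewrite !contact_dual !dtF F1E => E.
  rewrite !linearD /= !dxM !dx_dual (dual_skew j i) scaleNr mulrN -scalerAr mulr1.
  apply/eqP; rewrite -subr_eq0; apply/eqP.
  move: E; rewrite scalerN -scalerMnr => /eqP; rewrite -subr_eq0 => /eqP E.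
  rewrite -[RHS]E; move: (W i j *: g) => a; ring.
have p2 : (p + 2)%:~R != 0 :> F by rewrite intr_eq0; lia.
pose f := (p + 2)%:~R^-1 *: ((t * g) *+ 2 + \sum_k y k * H k).
have fE : (p + 2)%:~R *: f = (t * g) *+ 2 + \sum_k y k * H k.
  by rewrite scalerA mulfV ?scale1r.
have dtf : dt f = g.
  rewrite linearZ /= linearD linearMn linear_sum /= dtM dt_t mul1r.
  under eq_bigr => k _ do rewrite dtM dt_y mul0r add0r dtH.
  have -> : (g + t * dt g) *+ 2 + \sum_k y k * dx k g = g *+ 2 + weight g.
    by rewrite mulrnDl -addrA.
  have E : 2%:R + (p - 2 + 2)%:~R = (p + 2)%:~R :> F by rewrite subrK intrD addrC.
  by rewrite Gg -scaler_nat -scalerDl scalerA E mulVf ?scale1r.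
have dxf i : dx i f = H i.
  rewrite linearZ /= linearD linearMn linear_sum /= dxM dx_t mul0r add0r.
  under eq_bigr => k _ do rewrite dxM dx_y dxH.
  rewrite big_split /= (bigD1 i) //= eqxx mul1r big1 ?addr0; last first.
    by move=> k /negbTE ki; rewrite eq_sym ki mul0r.
  have -> : (t * dx i g) *+ 2 + (H i + \sum_k y k * dx k (H i)) = H i + weight (H i).
    by rewrite -dtH addrCA.
  rewrite GH -{1}[H i]scale1r -scalerDl scalerA.
  rewrite -(intrD _ 1) (_ : 1 + (p - 1 + 2) = p + 2) ?mulVf ?scale1r //; lia.
exists f; split.
- rewrite /Gr /= fE /weight dtf /euler; congr (_ + _).
  by apply: eq_bigr => k _; rewrite dxf.
- by move=> i; rewrite contact_dual dxf dtf addrK.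
- by rewrite contact_1 dtf.
Qed.

Definition mono (h : nat) (s : seq 'I_N) : P := t ^+ h * \prod_(i <- s) y i.

Definition mono_comb (r : seq (F * (nat * seq 'I_N))) : P :=
  \sum_(m <- r) m.1 *: mono m.2.1 m.2.2.

Lemma euler_mono h s : euler (mono h s) = (size s)%:R *: mono h s.
Proof.
have Et : euler (t ^+ h) = 0.
  by elim: h => [|h IH]; rewrite ?expr0 ?euler1 // exprS eulerM euler_t IH mul0r mulr0 addr0.
have Ep : euler (\prod_(i <- s) y i) = (size s)%:R *: \prod_(i <- s) y i.
  elim: s => [|i s IH]; first by rewrite big_nil euler1 scale0r.
  by rewrite big_cons eulerM euler_y IH -scalerAr -[X in X + _]scale1r -scalerDl mulrS.
by rewrite /mono eulerM Et mul0r add0r Ep -scalerAr.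
Qed.

Lemma dt_prod_y (s : seq 'I_N) : dt (\prod_(i <- s) y i) = 0.
Proof.
elim: s => [|i s IH]; first by rewrite big_nil dt1.
by rewrite big_cons dtM dt_y IH mul0r mulr0 addr0.
Qed.

Lemma tdt_mono h s : t * dt (mono h s) = h%:R *: mono h s.
Proof.
rewrite /mono dtM dt_prod_y mulr0 addr0 mulrA scalerAl; congr (_ * _).
elim: h => [|h IH]; first by rewrite expr0 dt1 mulr0 scale0r.
rewrite exprS dtM dt_t mul1r mulrDr mulrCA IH -scalerAr -exprS.
by rewrite -[X in X + _]scale1r -scalerDl mulrS.
Qed.

Lemma Gr_mono h s : Gr ((h.*2 + size s)%:Z - 2) (mono h s).
Proof.
rewrite /Gr /= /weight tdt_mono euler_mono -scaler_nat scalerA -scalerDl subrK.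
by rewrite -mul2n -natrM -natrD.
Qed.

Hypothesis span : forall f, exists r, f = mono_comb r.

Lemma eigen_mono_comb (D : {linear P -> P}) (a : nat -> seq 'I_N -> F) (b : F) r f :
    (forall h s, D (mono h s) = a h s *: mono h s) -> D f = b *: f -> f = mono_comb r ->
  exists2 r', f = mono_comb r' & {subset r' <= [seq m <- r | a m.2.1 m.2.2 == b]}.
Proof.
move=> Dm Df fr; exists [seq m <- r | a m.2.1 m.2.2 == b] => //.
rewrite /mono_comb big_filter.
apply: (@eigen_sum_filter _ _ D _ _ (fun m => m.1 *: mono m.2.1 m.2.2)
   (fun m => a m.2.1 m.2.2)) => // m _.
by rewrite linearZ /= Dm !scalerA mulrC.
Qed.

Lemma Gr_mono_comb p f r : Gr p f -> f = mono_comb r ->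
  exists2 r', f = mono_comb r' &
    {subset r' <= [seq m <- r | (m.2.1.*2 + size m.2.2)%:Z == p + 2]}.
Proof.
move=> Gf fr.
have [h s|r' fE sub] := eigen_mono_comb
    (D := weight) (a := fun h s => (h.*2 + size s)%:R) _ Gf fr.
  by have := Gr_mono h s; rewrite /Gr /= subrK.
exists r' => // m /sub; rewrite !mem_filter => /andP[/eqP E ->].
by move/eqP: E; rewrite pmulrn eqr_int => ->.
Qed.

Lemma Gr_span p f : Gr p f -> exists2 r, f = mono_comb r &
  forall m, m \in r -> (m.2.1.*2 + size m.2.2)%:Z = p + 2.
Proof.
move=> Gf; have [r fr] := span f; have [r' fr' sub] := Gr_mono_comb Gf fr.
by exists r' => // m /sub; rewrite mem_filter => /andP[/eqP].
Qed.

Lemma Gr_small p f : p < -2 -> Gr p f -> f = 0.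
Proof.
move=> p2 /Gr_span[r -> rP]; rewrite /mono_comb big_seq big1 // => m /rP; lia.
Qed.

Lemma Gr_m2 f : Gr (-2) f -> exists a, f = a *: 1.
Proof.
move=> /Gr_span[r -> rP]; exists (\sum_(m <- r) m.1).
rewrite /mono_comb scaler_suml big_seq [RHS]big_seq; apply: eq_bigr => [[a [h s]]] /rP /=.
case: h s => [|h] [|i s] //= _; by rewrite /mono expr0 big_nil mulr1.
Qed.

Lemma Gr_m1 f : Gr (-1) f -> exists a : 'I_N -> F, f = \sum_i a i *: y i.
Proof.
move=> /Gr_span[r -> rP]; exists (fun i => \sum_(m <- r | m.2.2 == [:: i]) m.1).
rewrite /mono_comb; under [RHS]eq_bigr => i _ do rewrite scaler_suml big_mkcond.
rewrite exchange_big /= big_seq [RHS]big_seq; apply: eq_bigr => [[a [h s]]] /rP /=.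
case: h s => [|h] [|i [|j s]] //= _.
rewrite (bigD1 i) //= eqxx big1 ?addr0; first by rewrite /mono expr0 mul1r big_seq1.
by move=> j /negbTE ji; rewrite eqseq_cons eq_sym ji.
Qed.

Lemma contact_graded : graded_lie contact Gr.
Proof.
split.
- exact: contact_lie.
- exact: subspace_Gr.
- split.
    apply: (@eigen_independent _ _ weight _ _ _ (fun p => (p + 2)%:~R)) => //.
    by move=> p q _ _ /eqP; rewrite eqr_int => /eqP/addIr.
  apply/seteqP; split=> // f _; have [r ->] := span f.
  apply: (subspace_sum (subspace_bigsum (fun i _ => subspace_Gr i))) => m _.
  apply: (bigsum_mem (i := (m.2.1.*2 + size m.2.2)%:Z - 2)) => //.
  by apply: (subspaceZ (subspace_Gr _)); exact: Gr_mono.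
- by move=> p q f g; exact: Gr_contact.
Qed.
End ContactBracket.

(** * Extension of scalars and the polynomial ring *)

Section BaseChange.
Variables (F F' : numFieldType) (sigma : {rmorphism F -> F'}).
Variables (P : comAlgType F) (P' : comAlgType F') (iota : {rmorphism P -> P'}) (N : nat).
Variables (dt : {linear P -> P}) (dx : 'I_N -> {linear P -> P}) (t : P) (y : 'I_N -> P).
Variables (dt' : {linear P' -> P'}) (dx' : 'I_N -> {linear P' -> P'}) (t' : P') (y' : 'I_N -> P').
Hypothesis iotaZ : forall a f, iota (a *: f) = sigma a *: iota f.
Hypothesis iota_dt : forall f, iota (dt f) = dt' (iota f).
Hypothesis iota_dx : forall i f, iota (dx i f) = dx' i (iota f).
Hypothesis iota_t : iota t = t'.
Hypothesis iota_y : forall i, iota (y i) = y' i.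

Lemma base_change_euler f : iota (euler dx y f) = euler dx' y' (iota f).
Proof. by rewrite rmorph_sum; apply: eq_bigr => i _; rewrite rmorphM iota_y iota_dx. Qed.

Lemma base_change_zop f : iota (zop dx y f) = zop dx' y' (iota f).
Proof. by rewrite rmorphB rmorphMn base_change_euler. Qed.

Lemma base_change_weight f : iota (weight dt dx t y f) = weight dt' dx' t' y' (iota f).
Proof. by rewrite rmorphD rmorphMn rmorphM iota_t iota_dt /= base_change_euler. Qed.

Lemma base_change_contact w f g :
  iota (contact dt dx y w f g) = contact dt' dx' y' (map_mx sigma w) (iota f) (iota g).
Proof.
rewrite rmorphB rmorphD !rmorphM !base_change_zop !iota_dt; congr (_ + _ - _).
rewrite rmorph_sum; apply: eq_bigr => i _; rewrite rmorph_sum; apply: eq_bigr => j _.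
by rewrite iotaZ rmorphM !iota_dx mxE.
Qed.
End BaseChange.

Section PolynomialModel.
Variables (F : numFieldType) (N : nat).
Local Notation P := (mpoly N.+1 F).

Lemma mderiv_var (k l : 'I_N.+1) : mderiv k (mpolyX F (mnm1 l)) = (k == l)%:R :> P.
Proof.
rewrite mderivX mnm1E eq_sym; case: eqVneq => [->|_]; last by rewrite scale0r.
rewrite scale1r; have -> : mnm_sub (mnm1 l) (mnm1 l) = mnm0.
  by apply/mnmP => i; rewrite mnmBE subnn mnm0E.
by rewrite mpolyX0.
Qed.

Definition tvar : P := mpolyX F (mnm1 ord0).
Definition yvar (i : 'I_N) : P := mpolyX F (mnm1 (lift ord0 i)).
Definition pdt : {linear P -> P} := mderiv ord0.
Definition pdx (i : 'I_N) : {linear P -> P} := mderiv (lift ord0 i).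

Lemma mpoly_contact_coordinates : contact_coordinates pdt pdx tvar yvar.
Proof.
split.
- by move=> f g; rewrite /pdt /= mderivM.
- by move=> i f g; rewrite /pdx /= mderivM.
- by move=> i f; exact: mderiv_comm.
- by move=> i j f; exact: mderiv_comm.
- by rewrite /pdt /= mderiv_var eqxx.
- by move=> i; rewrite /pdt /= mderiv_var.
- by move=> i; rewrite /pdx /= mderiv_var.
- by move=> i j; rewrite /pdx /= mderiv_var (inj_eq lift_inj).
Qed.

Lemma mpoly_span (f : P) : exists r, f = mono_comb tvar yvar r.
Proof.
elim/mpolyind: f => [|a m f _ _ [r ->]]; first by exists [::]; rewrite /mono_comb big_nil.
have [s sE] : exists s, mpolyX F m = tvar ^+ m ord0 * \prod_(i <- s) yvar i.
  rewrite mpolyXE_id big_ord_recl.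
  suff [s ->] : exists s, \prod_i (mpolyX F (mnm1 (lift ord0 i))) ^+ m (lift ord0 i) =
       \prod_(i <- s) yvar i by exists s.
  apply: (big_ind (fun g => exists s, g = \prod_(i <- s) yvar i)).
  - by exists [::]; rewrite big_nil.
  - by move=> _ _ [s ->] [s' ->]; exists (s ++ s'); rewrite big_cat.
  - by move=> i _; exists (nseq (m (lift ord0 i)) i); rewrite big_nseq iter_mulr_1.
by exists ((a, (m ord0, s)) :: r); rewrite /mono_comb big_cons /= sE.
Qed.
End PolynomialModel.

(** * The contact algebra is the polynomial algebra *)

Section ContactIsomorphism.
Variables (R : realType) (n : nat) (c : lmodType R) (br : c -> c -> c) (gr : int -> set c).
Hypothesis hn : (0 < n)%N.
Hypothesis hc : contact_algebra n br gr.

Local Notation N := (2 * n)%N.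
Local Notation P := (mpoly N.+1 R).
Local Notation cb w := (contact (@pdt R N) (@pdx R N) (@yvar R N) w).
Local Notation G := (Gr (@pdt R N) (@pdx R N) (tvar R N) (@yvar R N)).

Let hgl : graded_lie br gr. Proof. by case: hc. Qed.
Let hl : lie_bracket br. Proof. by case: hgl. Qed.
Let hsub p : subspace (gr p). Proof. by case: hgl. Qed.
Let cc := @mpoly_contact_coordinates R N.
Let sp := @mpoly_span R N.

Lemma heisenberg_basis : exists (e : c) (b : 'I_N -> c) (w W : 'M[R]_N),
  [/\ e != 0, gr (-2) = [set x | exists a, x = a *: e],
      forall x, gr (-1) x <-> exists a : 'I_N -> R, x = \sum_i a i *: b i,
      forall a : 'I_N -> R, \sum_i a i *: b i = 0 -> forall i, a i = 0 &
      [/\ forall i j, br (b i) (b j) = w i j *: e, w^T = - w & w *m W^T = 1%:M]].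
Proof.
have [_ [_ [b [gb bP]] [e [B [e0 g2 brB _ Bn]]]] _ _] := hc.
pose w := \matrix_(i, j) B (b i) (b j).
have wE i j : br (b i) (b j) = w i j *: e by rewrite brB // mxE.
have gP x : gr (-1) x <-> exists a : 'I_N -> R, x = \sum_i a i *: b i.
  split=> [/bP[a [-> _]]|[a ->]]; first by exists (fun i => a ord0 i).
  by apply: subspace_sum => // i _; exact: subspaceZ.
have ind (a : 'I_N -> R) : \sum_i a i *: b i = 0 -> forall i, a i = 0.
  move=> a0 i; have [a' [_ ua]] := bP _ (subspace0 (hsub (-1))).
  have E1 : 0 = \sum_i (\row_i a i) ord0 i *: b i.
    by rewrite -[LHS]a0; apply: eq_bigr => j _; rewrite mxE.
  have E2 : 0 = \sum_i (0 : 'rV_N) ord0 i *: b i.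
    by rewrite big1 // => j _; rewrite mxE scale0r.
  have := etrans (esym (ua _ E1)) (ua _ E2).
  by move/matrixP/(_ ord0 i); rewrite !mxE.
have ws : w^T = - w.
  apply/matrixP => i j; rewrite mxE [RHS]mxE; apply/eqP; rewrite -addr_eq0; apply/eqP.
  have /eqP := lieC hl (b j) (b i); rewrite -addr_eq0 !wE -scalerDl scaler_eq0 (negbTE e0) orbF.
  by move/eqP.
(* The matrix w is invertible because B is nondegenerate. *)
exists e, b, w, ((invmx w)^T); split=> //; split=> //.
rewrite trmxK mulmxV // -row_free_unit; apply: inj_row_free => u uw.
apply/rowP => i; rewrite mxE; apply: (ind (fun i => u ord0 i)) => //.
apply: Bn; first by apply/gP; exists (fun i => u ord0 i).
have gu : gr (-1) (\sum_i u ord0 i *: b i) by apply/gP; exists (fun i => u ord0 i).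
move=> x gx; have [a xE] := (gP x).1 gx.
have /eqP : B (\sum_i u ord0 i *: b i) x *: e = 0; last by rewrite scaler_eq0 (negbTE e0) orbF => /eqP.
rewrite -brB // xE lie_sumr // big1 // => j _; rewrite lieZr // lie_suml //.
under eq_bigr => k _ do rewrite lieZl // wE scalerA.
rewrite -scaler_suml; have /rowP/(_ j) := uw; rewrite !mxE.
by move=> ->; rewrite scale0r scaler0.
Qed.

Lemma neg_part_model f : neg_part G f ->
  exists (a : R) (a' : 'I_N -> R), f = a *: 1 + \sum_i a' i *: yvar R i.
Proof.
move: f; apply: bigsum_min.
  split; first by exists 0, (fun=> 0); rewrite scale0r add0r big1 // => i _; rewrite scale0r.
  move=> k _ _ [a [a' ->]] [b [b' ->]]; exists (k * a + b), (fun i => k * a' i + b' i).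
  rewrite scalerDr scalerA addrACA -scalerDl; congr (_ + _).
  rewrite scaler_sumr -big_split; apply: eq_bigr => i _ /=.
  by rewrite scalerA -scalerDl.
move=> p p0 f Gf; have : p < -2 \/ p = -2 \/ p = -1 by lia.
case=> [p2|[]pE]; subst.
- rewrite (Gr_small cc sp p2 Gf); exists 0, (fun=> 0).
  by rewrite scale0r add0r big1 // => i _; rewrite scale0r.
- have [a ->] := Gr_m2 cc sp Gf; exists a, (fun=> 0).
  by rewrite big1 ?addr0 // => i _; rewrite scale0r.
- by have [a ->] := Gr_m1 cc sp Gf; exists 0, a; rewrite scale0r add0r.
Qed.

(** Maximality of the contact algebra yields an injective homomorphism phi from
    polynomials. It is surjective in each degree, by induction: the brackets of x with
    c^{-1} and c^{-2} come from polynomials, which prolong to a polynomial f, and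
    phi f = x by transitivity. *)
Lemma contact_real_model : exists (w W : 'M[R]_N) (phi : {linear P -> c}),
  [/\ w^T = - w, w *m W^T = 1%:M, bijective phi,
      forall f g, phi (cb w f g) = br (phi f) (phi g) &
      forall p f, G p f <-> gr p (phi f)].
Proof.
have [e [b [w [W [e0 g2 g1 ind [bw ws wW]]]]]] := heisenberg_basis.
have [_ [small _ _] trans maxc] := hc.
(* Transitivity of the polynomials needs at least one variable y_i. *)
have i0 : 'I_N by exists 0%N; lia.
pose psi (f : P) := mcoeff mnm0 f *: e + \sum_i mcoeff (mnm1 (lift ord0 i)) f *: b i.
have lpsi : linear psi.
  move=> k f g; rewrite /psi mcoeffD mcoeffZ scalerDl -scalerA scalerDr -!addrA.
  congr (_ + _); rewrite addrCA; congr (_ + _).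
  rewrite scaler_sumr -big_split; apply: eq_bigr => i _ /=.
  by rewrite mcoeffD mcoeffZ scalerDl scalerA.
pose psiL : {linear P -> c} := HB.pack psi (GRing.isLinear.Build R P c _ psi lpsi).
have psiZ k f : psi (k *: f) = k *: psi f by exact: (linearZ_LR psiL).
have psi1 : psi 1 = e.
  rewrite /psi mcoeff1 eqxx scale1r big1 ?addr0 // => i _.
  by rewrite mcoeff1 mnm1_eq0 scale0r.
have psiy i : psi (yvar R i) = b i.
  rewrite /psi mcoeffX mnm1_eq0 scale0r add0r (bigD1 i) //= mcoeffX eqxx scale1r big1 ?addr0 //.
  move=> j ji; rewrite mcoeffX; case: eqP => [/mnmP/(_ (lift ord0 j))|]; last by rewrite scale0r.
  by rewrite !mnm1E eqxx (inj_eq lift_inj) eq_sym (negbTE ji).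
have psiE a (a' : 'I_N -> R) :
    psi (a *: 1 + \sum_i a' i *: yvar R i) = a *: e + \sum_i a' i *: b i.
  rewrite -[LHS]/(psiL _) linearD linearZ linear_sum /= psi1; congr (_ + _).
  by apply: eq_bigr => i _; rewrite -[LHS]/(psiL _) linearZ /= psiy.
have br1 x : gr (-1) x -> br e x = 0.
  have ge : gr (-2) e by rewrite g2; exists 1; rewrite scale1r.
  by move=> gx; have [_ _ _ /(_ (-2) (-1) _ _ ge gx)] := hgl; rewrite small.
have gb i : gr (-1) (b i).
  apply/g1; exists (fun j => (i == j)%:R); rewrite (bigD1 i) //= eqxx scale1r big1 ?addr0 //.
  by move=> j /negbTE; rewrite eq_sym => ->; rewrite scale0r.
have cyy i j : cb w (yvar R i) (yvar R j) = w i j *: 1.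
  rewrite /contact (dt_y cc) mulr0 addr0 (dt_y cc) mul0r subr0 /pbr.
  rewrite (bigD1 i) //= (bigD1 j) //= !(dx_y cc) !eqxx mul1r.
  rewrite big1 ?addr0; last by move=> k /negbTE kj; rewrite (dx_y cc) kj mulr0 scaler0.
  rewrite big1 ?addr0 // => k /negbTE ki; rewrite big1 // => l _.
  by rewrite (dx_y cc) ki mul0r scaler0.
have Gy i : G (-1) (yvar R i) by exact: Gr_y cc i.
have G1 : G (-2) 1 by exact: Gr_1 cc.
have lc := contact_lie cc ws.
have c1y i : cb w 1 (yvar R i) = 0.
  by apply: (Gr_small cc sp _ (Gr_contact cc ws G1 (Gy i))).
(* The negative parts agree: 1 corresponds to e and y_i to b_i. *)
have psi_br f g : neg_part G f -> neg_part G g -> psi (cb w f g) = br (psi f) (psi g).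
  move=> /neg_part_model[a [a' ->]] /neg_part_model[k [k' ->]].
  have lin : forall i, G (-1) (a' i *: yvar R i) by move=> i; apply: (subspaceZ (subspace_Gr _ _ _ _ _)).
  have gl (l : 'I_N -> R) : gr (-1) (\sum_i l i *: b i) by apply/g1; exists l.
  rewrite !psiE !(lieDl lc) !(lieDr lc) !(lieDl hl) !(lieDr hl) !(lieZl lc) !(lieZr lc).
  rewrite (liexx lc) !scaler0 add0r !(lieZl hl) !(lieZr hl) (liexx hl) !scaler0 add0r.
  have z1 (l : 'I_N -> R) : cb w 1 (\sum_i l i *: yvar R i) = 0.
    by rewrite (lie_sumr lc) big1 // => i _; rewrite (lieZr lc) c1y scaler0.
  rewrite z1 (lieC lc _ 1) z1 oppr0 !scaler0 !add0r br1 // (lieC hl _ e) br1 // oppr0 !scaler0 !add0r.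
  rewrite (lie_sumr lc) (lie_sumr hl) -[LHS]/(psiL _) linear_sum; apply: eq_bigr => j _.
  rewrite (lie_suml lc) (lie_suml hl) linear_sum; apply: eq_bigr => i _.
  rewrite !(lieZr lc) !(lieZl lc) cyy !(lieZr hl) !(lieZl hl) bw.
  by rewrite -[LHS]/(psi _) !psiZ psi1.
have psi_bij p : p < 0 -> set_bij (G p) (gr p) psi.
  move=> p0; have : p < -2 \/ p = -2 \/ p = -1 by lia.
  case=> [p2|[->|->]].
  - rewrite small //; have -> : G p = [set 0].
      apply/seteqP; split=> [f /(Gr_small cc sp p2)//|f ->]; exact: subspace0 (subspace_Gr _ _ _ _ _).
    split.
    + by move=> _ ->; rewrite /= -[LHS]/(psiL _) linear0.
    + by move=> f g; rewrite !inE => -> ->.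
    + by move=> _ ->; exists 0 => //; rewrite -[LHS]/(psiL _) linear0.
  - have E a : psi (a *: 1) = a *: e by rewrite -[LHS]/(psiL _) linearZ /= psi1.
    split.
    + by move=> f /(Gr_m2 cc sp)[a ->]; rewrite g2; exists a.
    + move=> f g /set_mem/(Gr_m2 cc sp)[a ->] /set_mem/(Gr_m2 cc sp)[a' ->].
      rewrite !E => /eqP; rewrite -subr_eq0 -scalerBl scaler_eq0 (negbTE e0) orbF subr_eq0.
      by move/eqP ->.
    + move=> x; rewrite g2 => [[a ->]]; exists (a *: 1); rewrite ?E //.
      by apply: (subspaceZ (subspace_Gr _ _ _ _ _)).
  - have E (a : 'I_N -> R) : psi (\sum_i a i *: yvar R i) = \sum_i a i *: b i.
      by have := psiE 0 a; rewrite !scale0r !add0r.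
    split.
    + by move=> f /(Gr_m1 cc sp)[a ->]; apply/g1; exists a.
    + move=> f g /set_mem/(Gr_m1 cc sp)[a ->] /set_mem/(Gr_m1 cc sp)[a' ->].
      rewrite !E => /eqP; rewrite -subr_eq0 -sumrB; under eq_bigr => i _ do rewrite -scalerBl.
      move/eqP/ind => aa; apply: eq_bigr => i _; congr (_ *: _).
      by apply/eqP; rewrite -subr_eq0; apply/eqP; exact: aa.
    + move=> x /g1[a ->]; exists (\sum_i a i *: yvar R i) => //.
      by apply: (subspace_sum (subspace_Gr _ _ _ _ _)) => i _; apply: (subspaceZ (subspace_Gr _ _ _ _ _)).
have Gtrans : transitive_grading (cb w) G.
  by move=> p f p0 Gf fv; exact: (contact_transitive cc ws wW i0 p0 Gf fv).
have [phi [phiI phiG phiB phiN]] := maxc P (cb w) G psi (contact_graded cc ws sp) Gtrans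
  (And3 (fun a x y _ _ => lpsi a x y) psi_bij psi_br).
have phi_neg p f : p < 0 -> G p f -> phi f = psi f.
  by move=> p0 Gf; apply: phiN; exact: (bigsum_mem (P := fun p : int => p < 0) p0).
have phiGs p x : gr p x -> exists2 f, G p f & phi f = x.
  have base q y : q < 0 -> gr q y -> exists2 f, G q f & phi f = y.
    move=> q0 gy; have [_ _ /(_ _ gy)[f Gf fE]] := psi_bij q q0.
    by exists f => //; rewrite (phi_neg q).
  (* Degrees p - 1 and p - 2 enter, so the induction is on a bound of p + 2. *)
  have [k] := ubnP (absz (p + 2)); elim: k p x => // k IH p x pk gx.
  have [p0|p0] := ltP p 0; first exact: base.
  pose xv i := dual_y (@yvar R N) W i.
  have gxv i : gr (-1) (phi (xv i)) by apply: phiG; exact: Gr_dual cc W i.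
  have ge : gr (-2) (phi 1) by apply: phiG.
  have [_ _ _ gbr] := hgl.
  have /choice[Fx FxP] i : exists f, G (p - 1) f /\ phi f = br x (phi (xv i)).
    by have [|f] := IH (p - 1) _ _ (gbr _ _ _ _ gx (gxv i)); [lia | exists f].
  have [|F1 GF1 F1E] := IH (p - 2) _ _ (gbr _ _ _ _ gx ge); first by lia.
  have [|||f [Gf fx f1]] := @contact_prolongation _ _ _ _ _ _ _ _ cc ws _ wW p Fx F1 p0 _ GF1.
  - by move=> i; have [] := FxP i.
  - move=> i j; apply: phiI; have [_ Fi] := FxP i; have [_ Fj] := FxP j.
    rewrite linearB linearZ /= !phiB Fi Fj F1E.
    rewrite (lie_jacobir hl x (phi (xv i))) addrC addKr -phiB (contact_dual_dual cc wW).
    by rewrite linearZ /= (lieZr hl).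
  - move=> i; apply: phiI; have [_ Fi] := FxP i; rewrite !phiB Fi F1E.
    rewrite (lie_jacobir hl) -phiB.
    have z : cb w (xv i) 1 = 0.
      by apply: (Gr_small cc sp _ (Gr_contact cc ws (Gr_dual cc W i) G1)).
    by rewrite z linear0 (lie0r hl) addr0.
  exists f => //; apply/eqP; rewrite -subr_eq0; apply/eqP.
  apply: (trans p) => //; first by apply: subspaceB => //; exact: phiG.
  move=> v /(base (-1) v isT)[g /(Gr_m1 cc sp)[a ->] <-].
  rewrite linear_sum (lie_sumr hl) big1 // => i _; rewrite linearZ (lieZr hl) (y_dual _ wW) linear_sum.
  rewrite (lie_sumr hl) big1 ?scaler0 // => j _.
  rewrite linearZ (lieZr hl) (lieBl hl) -phiB fx; have [_ ->] := FxP j.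
  by rewrite subrr scaler0.
have phiS x : exists f, phi f = x.
  have [_ _ [_ /seteqP[/(_ x Logic.I)[s [h [hP ->]]] _]] _] := hgl.
  have /choice[f fP] i : exists f, i \in s -> phi f = h i.
    have [/hP[_ /phiGs[f _ fE]]|_] := boolP (i \in s); first by exists f.
    by exists 0.
  exists (\sum_(i <- s) f i); rewrite linear_sum big_seq [RHS]big_seq.
  by apply: eq_bigr => i /fP.
have /choice[inv invP] := phiS.
exists w, W, phi; split=> //; first by exists inv => // f; apply: phiI; rewrite invP.
move=> p f; split; first exact: phiG.
by move=> /phiGs[g Gg /phiI <-].
Qed.
End ContactIsomorphism.

Section ComplexModel.
Variables (R : realType) (c : lmodType R) (br : c -> c -> c) (gr : int -> set c).
Hypothesis hl : lie_bracket br.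
Local Notation C := R[i].
Variables (P : comAlgType R) (P' : comAlgType C) (iota : {rmorphism P -> P'}).
Hypothesis iotaZ : forall a f, iota (a *: f) = (a%:C)%C *: iota f.
Hypothesis iota_eq0 : forall f g, iota f + 'i%C *: iota g = 0 -> f = 0 /\ g = 0.
Hypothesis iota_split : forall f, exists g h, f = iota g + 'i%C *: iota h.
Variables (cb : P -> P -> P) (cb' : P' -> P' -> P') (wt : {linear P -> P}) (wt' : {linear P' -> P'}).
Hypothesis lcb : lie_bracket cb'.
Hypothesis iota_cb : forall f g, iota (cb f g) = cb' (iota f) (iota g).
Hypothesis iota_wt : forall f, iota (wt f) = wt' (iota f).
Variable phi : {linear P -> c}.
Hypothesis phi_bij : bijective phi.
Hypothesis phiB : forall f g, phi (cb f g) = br (phi f) (phi g).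
Hypothesis phiG : forall p f, wt f = (p + 2)%:~R *: f <-> gr p (phi f).

Lemma complex_split (a : C) : a = ((complex.Re a)%:C + 'i * (complex.Im a)%:C)%C.
Proof.
by case: a => a1 a2; apply/eqP; rewrite eq_complex /= !(mul0r, mul1r, mulr0, subr0, addr0, add0r) !eqxx.
Qed.

(** An isomorphism of real Lie algebras extends to the complexification c + ic, once the
    target has a compatible complex form iota. *)
Lemma complexification_model : exists Th : {linear cplx c -> P'},
  [/\ bijective Th, forall z z', Th (cbr br z z') = cb' (Th z) (Th z') &
      forall p z, cplxset (gr p) z <-> wt' (Th z) = (p + 2)%:~R *: Th z].
Proof.
have [psi phiK psiK] := phi_bij.
have phiI : injective phi by exact: can_inj phiK.
have psiD x y : psi (x + y) = psi x + psi y by apply: phiI; rewrite linearD !psiK.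
have psiZ a x : psi (a *: x) = a *: psi x by apply: phiI; rewrite (linearZ_LR phi) !psiK.
have psiN x : psi (- x) = - psi x by apply: phiI; rewrite linearN !psiK.
have psi0 : psi 0 = 0 by apply: phiI; rewrite linear0 psiK.
have psiB x y : psi (br x y) = cb (psi x) (psi y) by apply: phiI; rewrite phiB !psiK.
pose th (z : cplx c) : P' := iota (psi z.1) + 'i%C *: iota (psi z.2).
have thD z z' : th (z + z') = th z + th z'.
  by rewrite /th cplxDE /= !psiD !rmorphD scalerDr addrACA.
have thrl x : th (rl x) = iota (psi x) by rewrite /th /= psi0 raddf0 scaler0 addr0.
have i2 : ('i * 'i)%C = -1 :> C by rewrite -expr2 sqr_i.
have thi z : th ('i%C *: z) = 'i%C *: th z.
  rewrite /th cplx_iZ /= psiN raddfN /= scalerDr scalerA i2 scaleN1r.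
  by rewrite addrC.
have thr (a : R) z : th ((a%:C)%C *: z) = (a%:C)%C *: th z.
  rewrite /th cplxZE /= !scale0r subr0 addr0 !psiZ !iotaZ scalerDr.
  by rewrite !scalerA mulrC.
have lth : linear th.
  move=> a z z'; rewrite thD; congr (_ + _).
  by rewrite (complex_split a) !scalerDl thD thr -!scalerA thi thr.
pose Th : {linear cplx c -> P'} := HB.pack th (GRing.isLinear.Build C (cplx c) P' _ th lth).
exists Th; split=> //.
- have /choice[inv invP] : forall f, exists z, th z = f.
    move=> f; have [g [h ->]] := iota_split f; exists (phi g, phi h).
    by rewrite /th /= !phiK.
  exists inv => z; last exact: invP.
  have : th (inv (th z) - z) = 0 by rewrite -[LHS]/(Th _) linearB /= invP subrr.
  rewrite /th => /iota_eq0[/(congr1 phi) + /(congr1 phi)]; rewrite !psiK linear0 /=.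
  move=> /subr0_eq E1 /subr0_eq E2.
  by rewrite [LHS]surjective_pairing [RHS]surjective_pairing; congr (_, _).
- have thB u v : th (cbr br (rl u) (rl v)) = cb' (th (rl u)) (th (rl v)).
    by rewrite cbr_rl // !thrl psiB iota_cb.
  have thB2 u z : th (cbr br (rl u) z) = cb' (th (rl u)) (th z).
    rewrite (cplxE z) (cbrDr hl) (cbrZr hl) !thD !thi !thB.
    by rewrite (lieDr lcb _ (th (rl z.1))) (lieZr lcb _ 'i%C).
  move=> z z'; rewrite -[LHS]/(th _) -[RHS]/(cb' (th z) (th z')) (cplxE z).
  have lh := lie_cbr hl.
  rewrite (lieDl lh) (lieZl lh) !thD !thi !thB2.
  by rewrite (lieDl lcb _ (th (rl z.1))) (lieZl lcb _ 'i%C).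
- move=> p z; rewrite -[Th z]/(th z).
  have E : wt' (th z) - (p + 2)%:~R *: th z = iota (wt (psi z.1) - (p + 2)%:~R *: psi z.1) +
      'i%C *: iota (wt (psi z.2) - (p + 2)%:~R *: psi z.2).
    rewrite /th linearD linearZ /= -!iota_wt !raddfB /= !iotaZ.
    rewrite [in RHS]addrACA -opprD; congr (_ - _).
    by rewrite !scalerDr !scalerA [_ * 'i%C]mulrC rmorph_int.
  split=> [[]|].
    rewrite -[z.1]psiK -[z.2]psiK => /phiG E1 /phiG E2.
    by apply/eqP; rewrite -subr_eq0 E E1 E2 !subrr raddf0 scaler0 addr0.
  move=> /eqP; rewrite -subr_eq0 E => /eqP/iota_eq0[/eqP + /eqP].
  rewrite !subr_eq0 => /eqP E1 /eqP E2.
  by split; rewrite -[X in gr p X]psiK; apply/phiG.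
Qed.
End ComplexModel.

Section ComplexPolynomials.
Variables (R : realType) (N : nat).
Local Notation C := R[i].
Local Notation P K := (mpoly N.+1 K).
Local Notation iota := (@map_mpoly N.+1 R C (real_complex R)).

Lemma iota_mderiv k (f : P R) : iota (mderiv k f) = mderiv k (iota f).
Proof.
apply/mpolyP => m; rewrite mcoeff_deriv !mcoeff_map_mpoly mcoeff_deriv.
by rewrite raddfMn.
Qed.
Lemma iotaZ a (f : P R) : iota (a *: f) = (a%:C)%C *: iota f.
Proof. by rewrite map_mpolyZ. Qed.
Lemma iota_var k : iota (mpolyX R (mnm1 k)) = mpolyX C (mnm1 k).
Proof. by rewrite map_mpolyX. Qed.

Lemma complex_split_eq0 (a b : R) : (a%:C + 'i * b%:C)%C = 0 -> a = 0 /\ b = 0.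
Proof.
move=> /eqP; rewrite eq_complex /= => /andP[/eqP + /eqP].
by rewrite !(mul0r, mul1r, mulr0, subr0, addr0, add0r).
Qed.

Lemma mcoeff_lin (K : nzRingType) m (a : K) (f g : P K) :
  mcoeff m (f + a *: g) = mcoeff m f + a * mcoeff m g.
Proof. by rewrite mcoeffD mcoeffZ. Qed.

Lemma iota_eq0 (f g : P R) : iota f + 'i%C *: iota g = 0 -> f = 0 /\ g = 0.
Proof.
move=> fg; have E m : mcoeff m f = 0 /\ mcoeff m g = 0.
  apply: complex_split_eq0.
  have h := congr1 (mcoeff m) fg.
  rewrite mcoeff_lin in h.
  rewrite mcoeff0 in h.
  have h1 : mcoeff m (iota f) = ((mcoeff m f)%:C)%C := mcoeff_map_mpoly _ m f.
  have h2 : mcoeff m (iota g) = ((mcoeff m g)%:C)%C := mcoeff_map_mpoly _ m g.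
  exact: etrans (esym (congr2 (fun a b => a + 'i%C * b) h1 h2)) h.
by split; apply/mpolyP => m; have [a b] := E m; rewrite mcoeff0.
Qed.

Lemma iota_split (f : P C) : exists g h : P R, f = iota g + 'i%C *: iota h.
Proof.
elim/mpolyind: f => [|a m f _ _ [g [h ->]]].
  by exists 0, 0; rewrite rmorph0 scaler0 addr0.
exists (complex.Re a *: mpolyX R m + g), (complex.Im a *: mpolyX R m + h).
rewrite (raddfD (iota : {additive P R -> P C})) (raddfD (iota : {additive P R -> P C})).
rewrite /= !iotaZ map_mpolyX [in RHS]scalerDr [in RHS]addrACA scalerA -scalerDl.
by rewrite -complex_split.
Qed.
End ComplexPolynomials.

Section ContactComplexModel.
Variables (R : realType) (n : nat) (c : lmodType R) (br : c -> c -> c) (gr : int -> set c).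
Hypothesis hn : (0 < n)%N.
Hypothesis hc : contact_algebra n br gr.

Local Notation N := (2 * n)%N.
Local Notation C := R[i].
Local Notation P K := (mpoly N.+1 K).
Local Notation cb K w := (contact (@pdt K N) (@pdx K N) (@yvar K N) w).
Local Notation G K := (Gr (@pdt K N) (@pdx K N) (tvar K N) (@yvar K N)).

Lemma contact_complex_model :
  exists (w W : 'M[C]_N) (Th : {linear cplx c -> P C}),
  [/\ w^T = - w, w *m W^T = 1%:M, bijective Th,
      forall z z', Th (cbr br z z') = cb C w (Th z) (Th z') &
      forall p z, cplxset (gr p) z <-> G C p (Th z)].
Proof.
have [w [W [phi [ws wW phi_bij phiB phiG]]]] := contact_real_model hn hc.
have hl : lie_bracket br by case: hc => [[]].
pose wc := map_mx (real_complex R) w.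
pose Wc := map_mx (real_complex R) W.
have wcs : wc^T = - wc.
  by apply/matrixP => i j; move/matrixP/(_ i j): ws; rewrite !mxE => ->; rewrite raddfN.
have wWc : wc *m Wc^T = 1%:M.
  apply/matrixP => i j; have /matrixP/(_ i j) := wW; rewrite !mxE => /(congr1 (real_complex R)).
  rewrite rmorph_nat rmorph_sum => <-; apply: eq_bigr => k _.
  by rewrite !mxE rmorphM.
have lc := contact_lie (@mpoly_contact_coordinates C N) wcs.
have cbi := base_change_contact (@iotaZ R N) (@iota_mderiv R N ord0)
  (fun i => @iota_mderiv R N (lift ord0 i)) (fun i => @iota_var R N (lift ord0 i)) w.
have wti := base_change_weight (@iota_mderiv R N ord0)
  (fun i => @iota_mderiv R N (lift ord0 i)) (@iota_var R N ord0) (fun i => @iota_var R N (lift ord0 i)).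
have [Th ThP] := complexification_model hl (@iotaZ R N) (@iota_eq0 R N) (@iota_split R N)
  lc cbi wti phi_bij phiB phiG.
by exists wc, Wc, Th; case: ThP.
Qed.
End ContactComplexModel.

(** * Equivariant maps and monomials *)

Section Quadratics.
Variables (F : numFieldType) (P : comAlgType F) (N : nat).
Variables (dt : {linear P -> P}) (dx : 'I_N -> {linear P -> P}).
Variables (t : P) (y : 'I_N -> P) (w W : 'M[F]_N).
Hypothesis cc : contact_coordinates dt dx t y.
Hypothesis ws : w^T = - w.
Hypothesis wW : w *m W^T = 1%:M.
Hypothesis span : forall f, exists r, f = mono_comb t y r.
Hypothesis integral : forall f g : P, f * g = 0 -> f = 0 \/ g = 0.
Local Notation cb := (contact dt dx y w).
Local Notation pb := (pbr dx w).
Local Notation eu := (euler dx y).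
Local Notation G := (Gr dt dx t y).
Local Notation x := (dual_y y W).

(** The polynomials of degree 2 in the y_i; under the contact bracket they form sp, and
    they act through the Poisson bracket alone. *)
Definition quadratic : set P := [set q | G 0 q /\ dt q = 0].

Lemma linear_dt a : G (-1) a -> dt a = 0.
Proof.
move=> /(Gr_m1 cc span)[k ->]; rewrite linear_sum big1 // => i _.
by rewrite linearZ /= (dt_y cc) scaler0.
Qed.
Lemma linear_euler a : G (-1) a -> eu a = a.
Proof.
move=> Ga; have := Ga; rewrite /Gr /= /weight (linear_dt Ga) mulr0 mul0rn add0r => ->.
by rewrite (_ : -1 + 2 = 1) // scale1r.
Qed.
Lemma pbr_dual_const a i : G (-1) a -> exists k, pb a (x i) = k *: 1.
Proof.
move=> /(Gr_m1 cc span)[k ->]; exists (k i); rewrite (pbr_dual cc wW) linear_sum.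
rewrite (bigD1 i) //= linearZ /= (dx_y cc) eqxx big1 ?addr0 // => j /negbTE ji.
by rewrite linearZ /= (dx_y cc) eq_sym ji scaler0.
Qed.
Lemma pbr_const a b : G (-1) a -> G (-1) b -> exists k, pb a b = k *: 1.
Proof.
move=> Ga /(Gr_m1 cc span)[k ->].
have /choice[l lP] : forall i, exists l, pb a (x i) = l *: 1 by move=> i; exact: pbr_dual_const.
exists (\sum_i k i * \sum_j w j i * l j).
rewrite linear_sum scaler_suml; apply: eq_bigr => i _; rewrite linearZ /= (y_dual y wW) -scalerA.
congr (_ *: _); rewrite linear_sum scaler_suml; apply: eq_bigr => j _.
by rewrite linearZ /= lP scalerA.
Qed.

Lemma quadratic_mul a b : G (-1) a -> G (-1) b -> quadratic (a * b).
Proof.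
move=> Ga Gb; split; first exact: (GrM cc Ga Gb).
by rewrite (dtM cc) !linear_dt // mul0r mulr0 addr0.
Qed.
Lemma quadratic_euler q : quadratic q -> eu q = q *+ 2.
Proof.
move=> [Gq dq]; have := Gq; rewrite /Gr /= /weight dq mulr0 mul0rn add0r => ->.
by rewrite add0r -[RHS]scaler_nat.
Qed.
Lemma contact_quadratic q f : quadratic q -> cb q f = pb q f.
Proof.
move=> Qq; have [_ dq] := Qq.
by rewrite /contact dq mul0r subr0 /zop (quadratic_euler Qq) subrr mul0r addr0.
Qed.
(** Thus sp acts by derivations of the product, and by contact_quadratic_t it fixes t;
    this is why products of vectors times powers of t are equivariant. *)
Lemma contact_quadraticM q f g : quadratic q -> cb q (f * g) = cb q f * g + f * cb q g.
Proof. by move=> Qq; rewrite !contact_quadratic // (pbrM _ cc). Qed.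
Lemma contact_quadratic_t q : quadratic q -> cb q t = 0.
Proof.
move=> Qq; rewrite contact_quadratic // /pbr big1 // => i _; rewrite big1 // => j _.
by rewrite (dx_t cc) mulr0 scaler0.
Qed.
Lemma pbr_mul a b f : pb (a * b) f = a * pb b f + b * pb a f.
Proof.
rewrite (pbrC dx ws) (pbrM _ cc) opprD (pbrC dx ws b) (pbrC dx ws a) !mulrN.
by rewrite [X in _ = X]addrC; congr (- _ + - _); rewrite mulrC.
Qed.
Lemma quadratic_euler_comm q f : quadratic q -> eu (cb q f) = cb q (eu f).
Proof.
move=> Qq; rewrite !contact_quadratic // (euler_pbr w cc) (quadratic_euler Qq).
by rewrite mulr2n (pbrDl dx w) -mulr2n [X in X - _]addrC addrK.
Qed.

Lemma double_eq0 (f : P) : f *+ 2 = 0 -> f = 0.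
Proof. by move/eqP; rewrite -scaler_nat scaler_eq0 pnatr_eq0 => /eqP. Qed.

Lemma pbrr f : pb f f = 0.
Proof. by apply: double_eq0; rewrite mulr2n {1}(pbrC dx ws) addNr. Qed.

Lemma linear_partner v : G (-1) v -> v != 0 -> exists2 u, G (-1) u & pb v u = 1.
Proof.
move=> Gv v0.
have [i vi] : exists i, pb v (x i) != 0.
  apply: contrapT => /forallNP h; case/eqP: v0; rewrite -(linear_euler Gv) /euler big1 // => i _.
  by have /negP := h i; rewrite negbK (pbr_dual cc wW) => /eqP ->; rewrite mulr0.
have [k kE] := pbr_dual_const i Gv.
exists (k^-1 *: x i); first exact: (subspaceZ (subspace_Gr _ _ _ _ _) _ (Gr_dual cc W i)).
rewrite linearZ /= kE scalerA mulVf ?scale1r //.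
by apply: contraNneq vi => k0; rewrite kE k0 scale0r.
Qed.

(** Annihilation by v v and by v b for b orthogonal to v makes f constant along the
    hyperplane orthogonal to v, so that f depends on v and t only. The prescribed action
    of v u, which scales v, is then its degree in v up to sign. *)
Lemma stabilizer_euler (v u f : P) (m : F) :
    G (-1) v -> v != 0 -> G (-1) u -> pb v u = 1 -> cb (v * v) f = 0 ->
    (forall b, G (-1) b -> pb v b = 0 -> cb (v * b) f = 0) ->
    cb (v * u) f = - (m *: f) ->
  eu f = m *: f.
Proof.
move=> Gv v0 Gu vu vv vb; rewrite contact_quadratic ?pbr_mul; last exact: quadratic_mul.
move: vv; rewrite contact_quadratic ?pbr_mul; last exact: quadratic_mul.
rewrite -mulr2n => /double_eq0/integral[/eqP|vf]; first by rewrite (negbTE v0).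
rewrite vf mulr0 addr0 => uf.
have bf b : G (-1) b -> pb v b = 0 -> pb b f = 0.
  move=> Gb /(vb b Gb); rewrite contact_quadratic ?pbr_mul; last exact: quadratic_mul.
  by rewrite vf mulr0 addr0 => /integral[/eqP|//]; rewrite (negbTE v0).
have /choice[k kE] : forall i, exists k, pb v (x i) = k *: 1 by move=> i; exact: pbr_dual_const.
have xf i : pb (x i) f = k i *: pb u f.
  apply/eqP; rewrite -subr_eq0 -(pbrZl dx w) -(pbrBl dx w); apply/eqP; apply: bf.
    apply: (subspaceB (subspace_Gr _ _ _ _ _)); first exact: Gr_dual.
    exact: (subspaceZ (subspace_Gr _ _ _ _ _)).
  by rewrite linearB linearZ /= vu kE subrr.
rewrite /euler; under eq_bigr => i _ do rewrite -(pbr_dual cc wW) (pbrC dx ws) xf mulrN -scalerAr scalerAl.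
rewrite sumrN -mulr_suml -[RHS]opprK -uf; congr (- (_ * _)).
rewrite -[RHS](linear_euler Gv); apply: eq_bigr => i _.
by rewrite -(pbr_dual cc wW) kE -scalerAr mulr1.
Qed.
End Quadratics.

Section EquivariantMaps.
Variables (R : realType) (c : lmodType R) (br : c -> c -> c) (gr : int -> set c) (J : c).
Hypothesis hgl : graded_lie br gr.
Local Notation C := R[i].
Variables (P : comAlgType C) (N : nat).
Variables (dt : {linear P -> P}) (dx : 'I_N -> {linear P -> P}).
Variables (t : P) (y : 'I_N -> P) (w W : 'M[C]_N).
Hypothesis cc : contact_coordinates dt dx t y.
Hypothesis ws : w^T = - w.
Hypothesis wW : w *m W^T = 1%:M.
Hypothesis span : forall f, exists r, f = mono_comb t y r.
Hypothesis integral : forall f g : P, f * g = 0 -> f = 0 \/ g = 0.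
Variable i0 : 'I_N.
Local Notation cb := (contact dt dx y w).
Local Notation pb := (pbr dx w).
Local Notation eu := (euler dx y).
Local Notation G := (Gr dt dx t y).
Local Notation quad := (quadratic dt dx t y).
Variables (Th : {linear cplx c -> P}) (Ti : {linear P -> cplx c}).
Hypothesis ThK : cancel Th Ti.
Hypothesis TiK : cancel Ti Th.
Hypothesis ThB : forall z z', Th (cbr br z z') = cb (Th z) (Th z').
Hypothesis ThG : forall p z, cplxset (gr p) z <-> G p (Th z).

Let hl : lie_bracket br. Proof. by case: hgl. Qed.
Let hsub p : subspace (gr p). Proof. by case: hgl. Qed.
Let lc : lie_bracket cb. Proof. exact: contact_lie cc ws. Qed.
Let sG p : subspace (G p). Proof. exact: subspace_Gr. Qed.
Local Notation V := (cplxset (gr (-1))).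
Local Notation K := (cplxset (kpart br gr 0)).

Lemma cplx_graded p q z z' :
  cplxset (gr p) z -> cplxset (gr q) z' -> cplxset (gr (p + q)) (cbr br z z').
Proof.
have [_ _ _ g] := hgl; move=> [z1 z2] [z1' z2']; split.
  by apply: (subspaceB (hsub _)); exact: g.
by apply: (subspaceD (hsub _)); exact: g.
Qed.

Lemma kpart_cplx_graded z z' p : K z -> cplxset (gr p) z' -> cplxset (gr p) (cbr br z z').
Proof.
move=> [[g1 _] [g2 _]] gz'; rewrite -[p]add0r.
by apply: cplx_graded => //; split.
Qed.

Lemma kpart_quadratic z : K z <-> quad (Th z).
Proof.
have e1 : cplxset (gr (-2)) (Ti 1) by apply/ThG; rewrite TiK; exact: Gr_1.
split=> [[[g1 k1] [g2 k2]]|[Gz dz]].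
  split; first by apply/ThG.
  have : cbr br z (Ti 1) = 0.
    by case: e1 => ? ?; rewrite /cbr !k1 // !k2 // subrr addr0.
  move/(congr1 Th); rewrite ThB TiK linear0 (contact_1 w cc) => /eqP.
  by rewrite oppr_eq0 => /eqP/double_eq0.
have [g1 g2] := (ThG 0 z).2 Gz.
have k u : gr (-2) u -> cbr br z (rl u) = 0.
  move=> gu; apply: (can_inj ThK); rewrite ThB linear0.
  have /(Gr_m2 cc span)[a ->] : G (-2) (Th (rl u)).
    by apply/ThG; split=> //; exact: subspace0.
  by rewrite (lieZr lc) (contact_1 w cc) dz mul0rn oppr0 scaler0.
split; split=> // u /k; rewrite /cbr /= !(lie0r hl) subr0 add0r => [[]]//.
Qed.

Section Equivariant.
Variables (p : int) (m : nat) (sigma : ('I_m -> cplx c) -> cplx c).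
Hypothesis hs : sym_equivariant br gr p sigma.

Lemma equivariant_slot v i : (forall i, V (v i)) ->
  linear_on V (fun x => sigma (upd v i x)).
Proof. by move=> /hs[]. Qed.

Lemma upd_V (v : 'I_m -> cplx c) i x : (forall i, V (v i)) -> V x -> forall j, V (upd v i x j).
Proof. by move=> Vv Vx j; rewrite /upd; case: eqP. Qed.

Lemma upd_id (v : 'I_m -> cplx c) i : upd v i (v i) = v.
Proof. by apply/funext => j; rewrite /upd; case: eqP => [->|]. Qed.

Lemma equivariant_slotZ v i a x : (forall i, V (v i)) -> V x ->
  sigma (upd v i (a *: x)) = a *: sigma (upd v i x).
Proof.
by move=> Vv; exact: (linear_onZ (subspace_cplxset (hsub (-1))) (equivariant_slot i Vv)).
Qed.

(** Equivariance is assumed for real elements of sp only, and extends by complex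
    linearity. *)
Lemma equivariant_cplx v z : (forall i, V (v i)) -> K z ->
  cbr br z (sigma v) = \sum_(i < m) sigma (upd v i (cbr br z (v i))).
Proof.
move=> Vv [k1 k2]; have [_ _ _ eq] := hs Vv.
have lh := lie_cbr hl.
rewrite (cplxE z) (lieDl lh) (lieZl lh) !eq // addrC scaler_sumr -big_split.
apply: eq_bigr => i _ /=; rewrite (lieDl lh) (lieZl lh) (addrC (cbr br (rl z.1) (v i))).
rewrite (equivariant_slot i Vv) //.
  by apply: kpart_cplx_graded => //; split=> //; split=> *; [exact: subspace0 | exact: lie0l].
by apply: kpart_cplx_graded => //; split=> //; split=> *; [exact: subspace0 | exact: lie0l].
Qed.

Let Wm : set (cplx c) := [set z | eu (Th z) = m%:R *: Th z].

Lemma subspace_Wm : subspace Wm.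
Proof.
split=> [|a z z']; rewrite /Wm /=; first by rewrite !linear0 ?scaler0.
move=> E E'; rewrite linearP [eu _]linearP /= E E' [in RHS]scalerDr.
by rewrite !scalerA mulrC.
Qed.

Lemma Wm_kpart z z' : K z -> Wm z' -> Wm (cbr br z z').
Proof.
move=> /kpart_quadratic Qz; rewrite /Wm /= ThB => E.
by rewrite (quadratic_euler_comm _ cc) // E (lieZr lc).
Qed.

Let a0 := y i0.
Let v0 := Ti a0.
Let Ga0 : G (-1) a0. Proof. exact: (Gr_y cc). Qed.
Let Vv0 : V v0. Proof. by apply/ThG; rewrite TiK. Qed.
Let a0_neq0 : a0 != 0.
Proof.
apply/eqP => a00; have := dx_y cc i0 i0; rewrite -/a0 a00 linear0 eqxx => /esym/eqP.
by rewrite oner_eq0.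
Qed.

(** Values of equivariant m-linear maps are homogeneous of degree m in the y_i.
    Induction on the number k of arguments which differ from a fixed vector v0: for
    k = 0 the stabiliser of v0 decides. Otherwise some q in sp maps v0 to the argument
    in position k. Acting by q on the value with v0 in this position gives terms with
    fewer arbitrary arguments, and as many copies of the wanted value as there were
    arguments v0. *)
Lemma equivariant_euler v : (forall i, V (v i)) -> eu (Th (sigma v)) = m%:R *: Th (sigma v).
Proof.
have [u Gu vu] := linear_partner cc wW span Ga0 a0_neq0.
have quadK q : quad q -> K (Ti q) by move=> Qq; apply/kpart_quadratic; rewrite TiK.
have brv q v1 : quad q -> (forall i, V (v1 i)) ->
    cb q (Th (sigma v1)) = \sum_(i < m) Th (sigma (upd v1 i (Ti (cb q (Th (v1 i)))))).
  move=> Qq Vv1; rewrite -[q in LHS]TiK -ThB equivariant_cplx ?linear_sum //; last exact: quadK.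
  by apply: eq_bigr => i _; rewrite /= -[cb _ _]/(cb q _) -{2}[q]TiK -ThB ThK.
suff claim k : (k <= m)%N -> forall v, (forall i, V (v i)) ->
    (forall i : 'I_m, (k <= i)%N -> v i = v0) -> Wm (sigma v).
  by move=> Vv; apply: (claim m) => // i; rewrite leqNgt ltn_ord.
elim: k => [|k IH] km {}v Vv vk.
  have {vk} vE : v = fun=> v0 by apply/funext => i; rewrite vk.
  rewrite /Wm /= vE; apply: (stabilizer_euler cc ws wW span integral Ga0 a0_neq0 Gu vu).
  - rewrite brv //; last by apply: quadratic_mul.
    rewrite big1 // => i _; rewrite TiK (contact_quadratic (t := t)) //; last exact: quadratic_mul.
    rewrite (pbr_mul cc ws) // (pbrr _ ws) // mulr0 addr0 linear0.
    by rewrite -(scale0r v0) equivariant_slotZ // scale0r linear0.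
  - move=> b Gb vb; rewrite brv //; last by apply: quadratic_mul.
    rewrite big1 // => i _; rewrite TiK (contact_quadratic (t := t)) //; last exact: quadratic_mul.
    rewrite (pbr_mul cc ws) // (pbrr _ ws) // (pbrC dx ws b) vb oppr0 !mulr0 addr0 linear0.
    by rewrite -(scale0r v0) equivariant_slotZ // scale0r linear0.
  - rewrite brv //; last by apply: quadratic_mul.
    rewrite (eq_bigr (fun=> - Th (sigma (fun=> v0)))).
      by rewrite sumr_const card_ord mulNrn scaler_nat.
    move=> i _; rewrite TiK (contact_quadratic (t := t)) //; last exact: quadratic_mul.
    rewrite (pbr_mul cc ws) // (pbrr _ ws) // (pbrC dx ws u) vu mulr0 addr0 mulrN1 linearN.
    by rewrite -scaleN1r equivariant_slotZ // scaleN1r linearN (upd_id (fun=> v0) i).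
pose kk := Ordinal km; pose v' := upd v kk v0.
have Vv' : forall i, V (v' i) by exact: upd_V.
have v'k (i : 'I_m) : (k <= i)%N -> v' i = v0.
  rewrite /v' /upd leq_eqVlt => /predU1P[ki|/vk ->]; last by case: eqP.
  by have -> : i = kk by [apply: val_inj]; rewrite eqxx.
pose b := Th (v kk).
have Gb : G (-1) b by apply/ThG.
have [l lE] := pbr_const cc wW span Gb Ga0.
(* By {v0, u} = 1, the term -bu maps v0 to b - {b, v0} u, and the second term removes
   the multiple of u. *)
pose q := - (b * u) - (l / 2%:R) *: (u * u).
have Qq : quad q.
  have Qs : subspace quad.
    split=> [|a f g [Gf df] [Gg dg]]; first by split; [exact: subspace0 | rewrite linear0].
    by split; [exact: subspaceZD | rewrite linearP df dg scaler0 addr0].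
  apply: (subspaceB Qs); first by apply: (subspaceN Qs); exact: quadratic_mul.
  by apply: (subspaceZ Qs); exact: quadratic_mul.
have qa : cbr br (Ti q) v0 = v kk.
  apply: (can_inj ThK); rewrite ThB !TiK -/b (contact_quadratic (t := t)) //.
  rewrite /q (pbrBl dx w) (pbrZl dx w) -scaleN1r (pbrZl dx w) !(pbr_mul cc ws) //.
  rewrite (pbrC dx ws u) vu lE !mulrN !mulr1 -scalerAr mulr1 scaleN1r opprD opprK -mulr2n.
  by rewrite mulNrn scalerN opprK -[u *+ 2]scaler_nat scalerA mulfVK ?pnatr_eq0 // subrK.
have : Wm (cbr br (Ti q) (sigma v')).
  by apply: Wm_kpart; [apply/kpart_quadratic; rewrite TiK | apply: IH; rewrite 1?ltnW].
rewrite equivariant_cplx //; last by apply/kpart_quadratic; rewrite TiK.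
rewrite (bigID (fun i : 'I_m => (i < k)%N)) /= => Wsum.
have W1 : Wm (\sum_(i < m | (i < k)%N) sigma (upd v' i (cbr br (Ti q) (v' i)))).
  apply: (subspace_sum subspace_Wm) => i ik; apply: IH; first exact: ltnW.
    by apply: upd_V => //; apply: kpart_cplx_graded => //; apply/kpart_quadratic; rewrite TiK.
  move=> j kj; rewrite /upd; case: eqP => [ji|_]; last exact: v'k.
  by move: kj; rewrite ji leqNgt ik.
have := subspaceB subspace_Wm Wsum W1; rewrite [X in Wm (X - _)]addrC addrK.
rewrite (eq_bigr (fun=> sigma v)); last first.
  move=> i; rewrite -leqNgt => ki; rewrite v'k // qa.
  have [_ perm_s _ _] := hs Vv; rewrite -(perm_s (tperm i kk)); congr sigma.
  apply/funext => j; rewrite /upd; case: eqP => [->|/eqP ji]; first by rewrite tpermL.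
  have [jk|jk] := eqVneq j kk.
    rewrite jk tpermR /v' /upd eqxx vk // ltn_neqAle ki andbT.
    by apply: contraNneq ji => ki'; rewrite jk; apply/eqP/val_inj.
  by rewrite tpermD 1?eq_sym // /v' /upd (negbTE jk).
(* By symmetry each of the d positions still holding v0 contributes the wanted value. *)
rewrite sumr_const; set d := #|_|; move=> Wd.
have d0 : d != 0%N.
  by rewrite -lt0n; apply/card_gt0P; exists kk; rewrite unfold_in /= ltnn.
have := subspaceZ subspace_Wm (d%:R^-1) Wd.
by rewrite -[sigma v *+ d]scaler_nat scalerA mulVf ?scale1r // pnatr_eq0.
Qed.
End Equivariant.

Definition tdt (f : P) : P := t * dt f.
Lemma tdt_linear : linear tdt.
Proof. by move=> a f g; rewrite /tdt linearP mulrDr -scalerAr. Qed.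
HB.instance Definition _ := GRing.isLinear.Build C P P _ tdt tdt_linear.

(** The degree of f in the y_i is m and its weight is m + 2h, so its degree in t is h. *)
Lemma Scomp_tdt p (m h : nat) z : p + 2 = (m + h.*2)%:Z -> Scomp br gr p m z ->
  cplxset (gr p) z /\ tdt (Th z) = h%:R *: Th z.
Proof.
move=> pmh; move: z.
apply: (@lspan_min _ _ _ (cplxset (gr p) `&` [set z | tdt (Th z) = h%:R *: Th z])).
  apply: subspaceI; first exact: subspace_cplxset.
  split=> [|a z z']; rewrite /= ?linear0 ?scaler0 //.
  by move=> E E'; rewrite linearP [tdt _]linearP /= E E' scalerDr !scalerA mulrC.
move=> _ [sigma [v [hs [Vv ->]]]].
have gs : cplxset (gr p) (sigma v) by have [] := hs v Vv.
split=> //=; have /ThG := gs; have := equivariant_euler hs Vv.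
move: (Th _) => f E; rewrite /Gr /= /weight E pmh PoszD intrD scalerDl addrC => /addrI E'.
by apply: double_inj; rewrite E' -[RHS]scaler_nat scalerA -natrM mul2n.
Qed.

Lemma Gr_prod (m : nat) (f : 'I_m -> P) : (forall i, G (-1) (f i)) ->
  G (m%:Z - 2) (\prod_(i < m) f i).
Proof.
elim: m f => [|m IH] f Gf; first by rewrite big_ord0; exact: (Gr_1 cc).
rewrite big_ord_recl; have := GrM cc (Gf ord0) (IH _ (fun i => Gf (lift ord0 i))).
by congr (G _ _); lia.
Qed.

Lemma Gr_tX h : G (h.*2%:Z - 2) (t ^+ h).
Proof.
elim: h => [|h IH]; first by rewrite expr0; exact: (Gr_1 cc).
by rewrite exprS; have := GrM cc (Gr_t cc) IH; congr (G _ _); lia.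
Qed.

Lemma contact_quadratic_prod q m (f : 'I_m -> P) : quad q ->
  cb q (\prod_(i < m) f i) =
  \sum_(i < m) \prod_(j < m) (if j == i then cb q (f j) else f j).
Proof.
move=> Qq; elim: m f => [|m IH] f.
  by rewrite !big_ord0 (contact_1 w cc) (proj2 Qq) mul0rn oppr0.
rewrite big_ord_recl (contact_quadraticM _ cc) // IH big_ord_recl; congr (_ + _).
  rewrite big_ord_recl eqxx; congr (_ * _); apply: eq_bigr.
rewrite mulr_sumr; apply: eq_bigr => i _.
by rewrite [RHS]big_ord_recl; congr (_ * _).
Qed.

Lemma contact_quadratic_tX q h : quad q -> cb q (t ^+ h) = 0.
Proof.
move=> Qq; elim: h => [|h IH].
  by rewrite expr0 (contact_1 w cc) (proj2 Qq) mul0rn oppr0.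
by rewrite exprS (contact_quadraticM _ cc) // IH (contact_quadratic_t _ cc) // mul0r mulr0 addr0.
Qed.

(** The embedding of S^m as the component t^h S^m. *)
Definition monomial_map h m (v : 'I_m -> cplx c) : cplx c :=
  Ti (t ^+ h * \prod_(i < m) Th (v i)).

Lemma monomial_map_equivariant p h m : p + 2 = (m + h.*2)%:Z ->
  sym_equivariant br gr p (@monomial_map h m).
Proof.
move=> pmh v Vv; have GTv i : G (-1) (Th (v i)) by apply/ThG.
split.
- apply/ThG; rewrite TiK; have := GrM cc (Gr_tX h) (Gr_prod GTv).
  by congr (G _ _); lia.
- by move=> s; rewrite /monomial_map [in RHS](reindex_inj (@perm_inj _ s)).
- move=> i a x x' Vx Vx'; rewrite /monomial_map -linearP; congr (Ti _).
  rewrite scalerAr -mulrDr; congr (_ * _).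
  have pE x1 : \prod_j Th (upd v i x1 j) = Th x1 * \prod_(j | j != i) Th (v j).
    rewrite (bigD1 i isT) /upd eqxx; congr (_ * _).
    by apply: eq_bigr => j /negbTE ->.
  by rewrite !pE linearP mulrDl scalerAl.
- move=> X kX; have QX : quad (Th (rl X)).
    by apply/kpart_quadratic; split=> //; split=> *; [exact: subspace0 | exact: lie0l].
  apply: (can_inj ThK); rewrite ThB linear_sum /monomial_map TiK.
  rewrite (contact_quadraticM _ cc) // contact_quadratic_tX // mul0r add0r.
  rewrite contact_quadratic_prod // mulr_sumr; apply: eq_bigr => i _ /=.
  rewrite TiK; congr (_ * _); apply: eq_bigr => j _.
  by rewrite /upd; case: eqP => // ->; rewrite ThB.
Qed.

Hypothesis hJ : kpart br gr 0 J.
Hypothesis hJJ : forall v, gr (-1) v -> br J (br J v) = - v.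

Let Jp := Th (rl J).
Let D := cb Jp.

Lemma Jp_quadratic : quad Jp.
Proof.
by apply/kpart_quadratic; split=> //; split=> *; [exact: subspace0 | exact: lie0l].
Qed.

Lemma Jp_sqr a : G (-1) a -> D (D a) = - a.
Proof.
rewrite -[a]TiK => /ThG[g1 g2]; rewrite /D /Jp -!ThB -linearN; congr (Th _).
by rewrite /cbr /= !(lie0l hl) !subr0 !addr0 !hJJ.
Qed.

Lemma D_graded p f : G p f -> G p (D f).
Proof. by move=> Gf; rewrite -[p]add0r; apply: (Gr_contact cc ws) => //; case: Jp_quadratic. Qed.

Let DZ a f : D (a *: f) = a *: D f. Proof. exact: lieZr lc Jp a f. Qed.
Let DD f g : D (f + g) = D f + D g. Proof. exact: lieDr lc Jp f g. Qed.
Let DN f : D (- f) = - D f. Proof. exact: lieNr lc Jp f. Qed.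

Definition lin10 a := G (-1) a /\ D a = 'i%C *: a.
Definition lin01 a := G (-1) a /\ D a = - 'i%C *: a.

Lemma ii : ('i%C : C) * 'i%C = -1.
Proof. by rewrite -expr2 sqr_i. Qed.

Lemma linear_split a : G (-1) a -> exists b b', [/\ lin10 b, lin01 b' & a = b + b'].
Proof.
move=> Ga; have GDa := D_graded Ga.
exists (2%:R^-1 *: (a - 'i%C *: D a)), (2%:R^-1 *: (a + 'i%C *: D a)); split.
- split; first by apply: (subspaceZ (sG _)); apply: (subspaceB (sG _)) => //; exact: (subspaceZ (sG _)).
  rewrite DZ DD DN DZ Jp_sqr //.
  rewrite [RHS]scalerA [_ * 2%:R^-1]mulrC -[RHS]scalerA; congr (_ *: _).
  by rewrite scalerN opprK scalerBr scalerA ii scaleN1r opprK addrC.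
- split; first by apply: (subspaceZ (sG _)); apply: (subspaceD (sG _)) => //; exact: (subspaceZ (sG _)).
  rewrite DZ DD DZ Jp_sqr //.
  rewrite [RHS]scalerA [_ * 2%:R^-1]mulrC -[RHS]scalerA; congr (_ *: _).
  by rewrite scalerN scalerDr scalerA mulNr ii opprK scale1r scaleNr addrC.
rewrite -scalerDr addrACA addNr addr0 -mulr2n -[a *+ 2]scaler_nat scalerA mulVf ?scale1r //.
by rewrite pnatr_eq0.
Qed.

Definition bimonomial (l k h : nat) (f : P) : Prop :=
  exists (a : C) (s s' : seq P), [/\ size s = l, size s' = k,
    forall b, b \in s -> lin10 b, forall b, b \in s' -> lin01 b &
    f = a *: (t ^+ h * (\prod_(b <- s) b * \prod_(b <- s') b))].

Let DM f g : D (f * g) = D f * g + f * D g.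
Proof. exact: (contact_quadraticM _ cc f g Jp_quadratic). Qed.

Let D1 : D 1 = 0.
Proof. by rewrite /D (contact_1 w cc) (proj2 Jp_quadratic) mul0rn oppr0. Qed.

Lemma bimonomial_D l k h f : bimonomial l k h f -> D f = ((l%:R - k%:R) * 'i%C) *: f.
Proof.
move=> [a [s [s' [<- <- s10 s01 ->]]]].
have E (r : seq P) (b : C) : (forall x, x \in r -> D x = b *: x) ->
    D (\prod_(x <- r) x) = ((size r)%:R * b) *: \prod_(x <- r) x.
  elim: r => [|x r IH] h1; first by rewrite big_nil D1 mul0r scale0r.
  rewrite big_cons DM IH => [|z zr]; last by apply: h1; rewrite inE zr orbT.
  rewrite h1 ?mem_head // -scalerAl -scalerAr -scalerDl /= mulrS mulrDl mul1r.
  by [].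
have tX : D (t ^+ h) = 0 by apply: contact_quadratic_tX; exact: Jp_quadratic.
rewrite DZ DM tX mul0r add0r DM (E s 'i%C) ?(E s' (- 'i%C)); last first.
- by move=> b /s10[].
- by move=> b /s01[].
rewrite -scalerAl -scalerAr -scalerDl -scalerAr !scalerA mulrC mulrN -mulNr -mulrDl.
by [].
Qed.

Lemma bimonomial_Gr l k h f : bimonomial l k h f -> G ((l + k + h.*2)%:Z - 2) f.
Proof.
move=> [a [s [s' [<- <- s10 s01 ->]]]]; apply: (subspaceZ (sG _)).
have E (r : seq P) : (forall b, b \in r -> G (-1) b) -> G ((size r)%:Z - 2) (\prod_(b <- r) b).
  elim: r => [|b r IH] hr; first by rewrite big_nil; exact: (Gr_1 cc).
  rewrite big_cons.
  have := GrM cc (hr b (mem_head _ _)) (IH (fun z zr => hr z (mem_behead (s := b :: r) zr))).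
  by congr (G _ _); rewrite /=; lia.
have := GrM cc (Gr_tX h) (GrM cc (E s (fun b bs => proj1 (s10 b bs))) (E s' (fun b bs => proj1 (s01 b bs)))).
by congr (G _ _); lia.
Qed.

Lemma bimonomial_mul10 l k h b f : lin10 b -> bimonomial l k h f -> bimonomial l.+1 k h (b * f).
Proof.
move=> lb [a [s [s' [<- <- s10 s01 ->]]]]; exists a, (b :: s), s'; split=> //.
  by move=> x; rewrite inE => /predU1P[->//|/s10].
by rewrite big_cons -scalerAr !mulrA; congr (_ *: (_ * _ * _)); rewrite mulrC.
Qed.
Lemma bimonomial_mul01 l k h b f : lin01 b -> bimonomial l k h f -> bimonomial l k.+1 h (b * f).
Proof.
move=> lb [a [s [s' [<- <- s10 s01 ->]]]]; exists a, s, (b :: s'); split=> //.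
  by move=> x; rewrite inE => /predU1P[->//|/s01].
rewrite big_cons -scalerAr; congr (_ *: _); rewrite mulrCA; congr (_ * _).
by rewrite mulrCA.
Qed.

Lemma mono_bimonomials a h s : exists r : seq (nat * nat * P),
  a *: mono t y h s = \sum_(x <- r) x.2 /\
  forall x, x \in r -> bimonomial x.1.1 x.1.2 h x.2 /\ (x.1.1 + x.1.2 = size s)%N.
Proof.
elim: s => [|i s [r [rE rP]]].
  exists [:: (0%N, 0%N, a *: mono t y h [::])]; rewrite big_seq1; split=> // x.
  rewrite inE => /eqP -> /=; split=> //.
  by exists a, [::], [::]; split=> //; rewrite /mono !big_nil !mulr1.
have [b [b' [lb lb' yE]]] := linear_split (Gr_y cc i).
exists ([seq (x.1.1.+1, x.1.2, b * x.2) | x <- r] ++ [seq (x.1.1, x.1.2.+1, b' * x.2) | x <- r]).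
split.
  rewrite big_cat !big_map /= -!mulr_sumr -mulrDl -yE -rE /mono big_cons.
  by rewrite -scalerAr; congr (_ *: _); rewrite mulrCA.
move=> x; rewrite mem_cat => /orP[] /mapP[z /rP[Bz zs] ->] /=; split.
- exact: bimonomial_mul10.
- by rewrite addSn zs.
- exact: bimonomial_mul01.
- by rewrite addnS zs.
Qed.

Lemma mono_comb_bimonomials r : exists r' : seq (nat * nat * nat * P),
  mono_comb t y r = \sum_(x <- r') x.2 /\
  forall x, x \in r' -> bimonomial x.1.1.1 x.1.1.2 x.1.2 x.2 /\
    exists2 m, m \in r & (x.1.2 = m.2.1 /\ x.1.1.1 + x.1.1.2 = size m.2.2)%N.
Proof.
elim: r => [|[a [h s]] r [r' [rE rP]]]; first by exists [::]; rewrite /mono_comb !big_nil.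
have [r1 [r1E r1P]] := mono_bimonomials a h s.
exists ([seq (x.1, h, x.2) | x <- r1] ++ r'); split.
  by rewrite /mono_comb big_cons big_cat big_map /= -/(mono_comb t y r) rE r1E.
move=> x; rewrite mem_cat => /orP[/mapP[z /r1P[Bz zs] ->] /=|/rP[Bx [m mr mE]]].
  by split=> //; exists (a, (h, s)); rewrite ?mem_head.
by split=> //; exists m => //; rewrite inE mr orbT.
Qed.

Lemma Gr_bimonomials p f : G p f -> exists r : seq (nat * nat * nat * P),
  f = \sum_(x <- r) x.2 /\
  forall x, x \in r -> bimonomial x.1.1.1 x.1.1.2 x.1.2 x.2 /\
    (x.1.1.1 + x.1.1.2 + x.1.2.*2)%:Z = p + 2.
Proof.
move=> /(Gr_span cc span)[r -> rP]; have [r' [-> r'P]] := mono_comb_bimonomials r.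
exists r'; split=> // x /r'P[Bx [m /rP mp [hE xE]]]; split=> //; rewrite -mp hE; lia.
Qed.

Local Notation MS l k h := [set z : cplx c | bimonomial l k h (Th z)].

Lemma bimonomial_eigensp l k h z : MS l k h z ->
  eigensp br gr J ((l + k + h.*2)%:Z - 2) ((l%:R - k%:R) * 'i%C) z.
Proof.
move=> Bz; split; first by apply/ThG; exact: bimonomial_Gr.
by apply: (can_inj ThK); rewrite ThB linearZ; exact: (bimonomial_D Bz).
Qed.

Lemma graded_bimonomials p z : cplxset (gr p) z -> exists r : seq (nat * nat * nat * cplx c),
  z = \sum_(x <- r) x.2 /\
  forall x, x \in r -> MS x.1.1.1 x.1.1.2 x.1.2 x.2 /\
    (x.1.1.1 + x.1.1.2 + x.1.2.*2)%:Z = p + 2.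
Proof.
move=> /ThG/Gr_bimonomials[r [zE rP]]; exists [seq (x.1, Ti x.2) | x <- r]; split.
  by rewrite -[LHS]ThK zE linear_sum big_map.
by move=> _ /mapP[x /rP[Bx xE] ->] /=; rewrite TiK.
Qed.

Lemma bimonomial_map l k h z : MS l k h z -> exists (a : C) (v : 'I_(l + k) -> cplx c),
  (forall i : 'I_(l + k), if (i < l)%N then eigensp br gr J (-1) 'i%C (v i)
       else eigensp br gr J (-1) (- 'i%C) (v i)) /\
  z = a *: monomial_map h v.
Proof.
move=> [a [s [s' [<- <- s10 s01 zE]]]].
exists a, (fun i => Ti (nth 0 (s ++ s') i)); split=> [i|]; last first.
  apply: (can_inj ThK); rewrite zE linearZ TiK -big_cat (big_nth 0) size_cat big_mkord /=.
  by congr (_ *: (_ * _)); apply: eq_bigr => i _; rewrite TiK.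
have T10 b : lin10 b -> eigensp br gr J (-1) 'i%C (Ti b).
  move=> [Gb Db]; split; first by apply/ThG; rewrite TiK.
  by apply: (can_inj ThK); rewrite ThB linearZ /= TiK.
have T01 b : lin01 b -> eigensp br gr J (-1) (- 'i%C) (Ti b).
  move=> [Gb Db]; split; first by apply/ThG; rewrite TiK.
  by apply: (can_inj ThK); rewrite ThB linearZ /= TiK.
rewrite nth_cat; case: ifP => isl.
  by rewrite isl; apply: T10; apply: s10; exact: mem_nth.
rewrite isl; apply: T01; apply: s01; apply: mem_nth.
by rewrite ltn_subLR ?ltn_ord // leqNgt isl.
Qed.

Lemma bimonomial_Scomp l k h p z : (l + k + h.*2)%:Z = p + 2 -> MS l k h z ->
  Scomp br gr p (l + k) z.
Proof.
move=> pE /bimonomial_map[a [v [vJ ->]]]; apply: (subspaceZ (subspace_lspan _)).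
apply: sub_lspan; exists (@monomial_map h (l + k)), v; split; last split=> //.
  exact: monomial_map_equivariant.
by move=> i; have := vJ i; case: ifP => _ [].
Qed.

Lemma bimonomial_Sbi l k p z : (l + k)%:Z = p + 2 -> MS l k 0 z -> Sbi br gr J p l k z.
Proof.
move=> pE /bimonomial_map[a [v [vJ ->]]]; apply: (subspaceZ (subspace_lspan _)).
apply: sub_lspan; exists (@monomial_map 0 (l + k)), v; split=> //.
by apply: monomial_map_equivariant; rewrite addn0.
Qed.

Lemma complex_prolongation p (FF : cplx c -> cplx c) : 0 <= p ->
    linear_on V FF -> (forall a, V a -> cplxset (gr (p - 1)) (FF a)) ->
    (forall a b, V a -> V b -> cbr br (FF a) b = cbr br (FF b) a) ->
    (forall a e, V a -> cplxset (gr (-2)) e -> cbr br (FF a) e = 0) ->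
  exists f, cplxset (gr p) f /\ forall a, V a -> cbr br f a = FF a.
Proof.
move=> p0 lF gF symF eF.
have Vx i : V (Ti (dual_y y W i)) by apply/ThG; rewrite TiK; exact: (Gr_dual cc).
have Ve : cplxset (gr (-2)) (Ti 1) by apply/ThG; rewrite TiK; exact: (Gr_1 cc).
have [|||f [Gf fx _]] := @contact_prolongation _ _ _ _ _ _ _ _ cc ws _ wW p
  (fun i => Th (FF (Ti (dual_y y W i)))) 0 p0 _ (subspace0 (sG _)).
- by move=> i; apply/ThG; exact: gF.
- move=> i j; rewrite scaler0 -[dual_y y W j in X in X - _]TiK -ThB symF // ThB TiK.
  by rewrite subrr.
- by move=> i; rewrite (lie0l lc) -[1]TiK -ThB eF // linear0.
exists (Ti f); split; first by apply/ThG; rewrite TiK.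
have sV := subspace_cplxset (hsub (-1)).
have lh := lie_cbr hl.
pose good : set (cplx c) := [set a | V a /\ cbr br (Ti f) a = FF a].
have sgood : subspace good.
  split; first by split; [exact: subspace0 sV | rewrite (lie0r lh) (linear_on0 sV lF)].
  move=> k a b [Va aE] [Vb bE]; split; first exact: (subspaceZD sV).
  by rewrite (lieDr lh) (lieZr lh) aE bE lF.
have goodx i : good (Ti (dual_y y W i)).
  by split=> //; apply: (can_inj ThK); rewrite ThB !TiK fx.
have goody i : good (Ti (y i)).
  rewrite (y_dual y wW) linear_sum; apply: (subspace_sum sgood) => j _.
  by rewrite linearZ; exact: (subspaceZ sgood).
move=> a Va; have /(Gr_m1 cc span)[k kE] := (ThG _ _).1 Va.
suff : good a by case.
rewrite -[a]ThK kE linear_sum; apply: (subspace_sum sgood) => i _.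
by rewrite linearZ; exact: (subspaceZ sgood).
Qed.

(** The facts about the complex polynomial model that the rest of the proof uses,
    without reference to polynomials: M l k h consists of the multiples of monomials
    t^h v_1...v_l w_1...w_k with v_i of type (10) and w_i of type (01), T is t d/dt and
    Wt is the weight. *)
Record contact_structure (T Wt : {linear cplx c -> cplx c})
    (M : nat -> nat -> nat -> set (cplx c)) : Prop := ContactStructure {
  cs_eigensp : forall l k h z, M l k h z ->
    eigensp br gr J ((l + k + h.*2)%:Z - 2) ((l%:R - k%:R) * 'i%C) z;
  cs_span : forall p z, cplxset (gr p) z -> exists r : seq (nat * nat * nat * cplx c),
    z = \sum_(x <- r) x.2 /\
    forall x, x \in r -> M x.1.1.1 x.1.1.2 x.1.2 x.2 /\
      (x.1.1.1 + x.1.1.2 + x.1.2.*2)%:Z = p + 2;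
  cs_Scomp : forall l k h p z, (l + k + h.*2)%:Z = p + 2 -> M l k h z ->
    Scomp br gr p (l + k) z;
  cs_Sbi : forall l k p z, (l + k)%:Z = p + 2 -> M l k 0%N z -> Sbi br gr J p l k z;
  cs_Scomp_gr : forall p (m h : nat) z, p + 2 = (m + h.*2)%:Z -> Scomp br gr p m z ->
    cplxset (gr p) z /\ T z = h%:R *: z;
  cs_weight : forall p z, cplxset (gr p) z -> Wt z = (p + 2)%:~R *: z;
  cs_prolongation : forall p (FF : cplx c -> cplx c), 0 <= p ->
    linear_on V FF -> (forall a, V a -> cplxset (gr (p - 1)) (FF a)) ->
    (forall a b, V a -> V b -> cbr br (FF a) b = cbr br (FF b) a) ->
    (forall a e, V a -> cplxset (gr (-2)) e -> cbr br (FF a) e = 0) ->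
    exists f, cplxset (gr p) f /\ forall a, V a -> cbr br f a = FF a }.

Lemma contact_structure_exists : exists T Wt M, contact_structure T Wt M.
Proof.
pose T z := Ti (tdt (Th z)).
have lT : linear T by move=> a z z'; rewrite /T linearP [tdt _]linearP linearP.
pose Wt z := Ti (weight dt dx t y (Th z)).
have lWt : linear Wt by move=> a z z'; rewrite /Wt linearP [weight _ _ _ _ _]linearP linearP.
pose TL : {linear cplx c -> cplx c} :=
  HB.pack T (GRing.isLinear.Build C (cplx c) (cplx c) _ T lT).
pose WtL : {linear cplx c -> cplx c} :=
  HB.pack Wt (GRing.isLinear.Build C (cplx c) (cplx c) _ Wt lWt).
exists TL, WtL, (fun l k h => MS l k h).
split.
- exact: bimonomial_eigensp.
- exact: graded_bimonomials.
- exact: bimonomial_Scomp.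
- exact: bimonomial_Sbi.
- move=> p m h z pE /(Scomp_tdt pE)[gz Tz]; split=> //=.
  by rewrite /T Tz linearZ /= ThK.
- by move=> p z /ThG Gz; rewrite /= /Wt Gz linearZ /= ThK.
- exact: complex_prolongation.
Qed.
End EquivariantMaps.

Lemma contact_algebra_structure (R : realType) (n : nat) (c : lmodType R)
    (br : c -> c -> c) (gr : int -> set c) (J : c) :
    (0 < n)%N -> contact_algebra n br gr -> kpart br gr 0 J ->
    (forall v, gr (-1) v -> br J (br J v) = - v) ->
  exists T Wt M, contact_structure br gr J T Wt M.
Proof.
move=> hn hc hJ hJJ.
have hgl : graded_lie br gr by case: hc.
have [w [W [Th [ws wW [Ti ThK TiK] ThB ThG]]]] := contact_complex_model hn hc.
have lTi : linear Ti by move=> a f g; apply: (can_inj ThK); rewrite linearP !TiK.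
pose TiL : {linear mpoly (2 * n).+1 R[i] -> cplx c} :=
  HB.pack Ti (GRing.isLinear.Build R[i] (mpoly (2 * n).+1 R[i]) (cplx c) _ Ti lTi).
have i0 : 'I_(2 * n) by exists 0%N; rewrite muln_gt0.
have integral (f g : mpoly (2 * n).+1 R[i]) : f * g = 0 -> f = 0 \/ g = 0.
  by move/eqP; rewrite mulf_eq0 => /orP[] /eqP; [left | right].
exact: (contact_structure_exists hgl (mpoly_contact_coordinates _ _) ws wW (@mpoly_span _ _)
  integral i0 (Ti := TiL) ThK TiK ThB ThG hJ hJJ).
Qed.

(** * The bidegree *)

Section Bigrading.
Variables (R : realType) (n : nat) (c : lmodType R) (br : c -> c -> c) (gr : int -> set c) (J : c).
Hypothesis hn : (0 < n)%N.
Hypothesis hc : contact_algebra n br gr.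
Hypothesis hJ : kpart br gr 0 J.
Hypothesis hJJ : forall v, gr (-1) v -> br J (br J v) = - v.
Local Notation C := R[i].
Variables (T Wt : {linear cplx c -> cplx c}) (M : nat -> nat -> nat -> set (cplx c)).
Hypothesis cs : contact_structure br gr J T Wt M.

Let hgl : graded_lie br gr. Proof. by case: hc. Qed.
Let hl : lie_bracket br. Proof. by case: hgl. Qed.
Let hsub p : subspace (gr p). Proof. by case: hgl. Qed.
Let lh : lie_bracket (cbr br). Proof. exact: lie_cbr. Qed.
Let csub p : subspace (cplxset (gr p)). Proof. exact: subspace_cplxset. Qed.
Local Notation E := (eigensp br gr J).
Local Notation adJ := (cbr br (rl J)).

(** Bidegree (r, s) means degree r + s - 2 and ad(J)-eigenvalue i(r - s). *)
Definition bidegree (r s : nat) : set (cplx c) := E ((r + s)%:Z - 2) ((r%:R - s%:R) * 'i%C).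
Local Notation B := bidegree.

Lemma subspace_eigensp p a : subspace (E p a).
Proof.
split; first by split; [exact: subspace0 (csub _) | rewrite (lie0r lh) scaler0].
move=> k z z' [gz zE] [gz' z'E]; split; first exact: (subspaceZD (csub _)).
by rewrite (lieDr lh) (lieZr lh) zE z'E scalerDr !scalerA mulrC.
Qed.

Lemma subspace_bidegree r s : subspace (B r s).
Proof. exact: subspace_eigensp. Qed.

Lemma M_bidegree l k h z : M l k h z -> B (l + h) (k + h) z.
Proof.
move=> /(cs_eigensp cs); rewrite /bidegree; have -> : (l + h + (k + h))%N = (l + k + h.*2)%N by lia.
have -> // : (l + h)%:R - (k + h)%:R = l%:R - k%:R :> C.
by rewrite !natrD opprD addrACA subrr addr0.
Qed.

Lemma M_T l k h z : M l k h z -> T z = h%:R *: z.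
Proof.
move=> Mz; have pE : (l + k + h.*2)%:Z = ((l + k + h.*2)%:Z - 2) + 2 by lia.
by have [] := cs_Scomp_gr cs (esym pE) (cs_Scomp cs pE Mz).
Qed.

Lemma bidegree_eq (r s r' s' : nat) : (r + s = r' + s')%N ->
  (r%:R - s%:R) * 'i%C = (r'%:R - s'%:R) * 'i%C :> C -> r = r' /\ s = s'.
Proof.
move=> e /(mulIf (neq0Ci _))/eqP.
rewrite subr_eq addrAC eq_sym subr_eq -!natrD eqr_nat => /eqP; lia.
Qed.

Lemma bidegree_direct :
  is_direct_sum predT (fun x : nat * nat => B x.1 x.2) [set: cplx c].
Proof.
split.
  apply: (@eigen_independent2 _ _ Wt (lie_ad lh (rl J)) _ _ _
    (fun x => (x.1 + x.2)%:R) (fun x => (x.1%:R - x.2%:R) * 'i%C)).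
    move=> [r s] [r' s'] _ _ /= /eqP; rewrite eqr_nat => /eqP rs /(bidegree_eq rs)[-> ->].
    by [].
  move=> [r s] z _ [gz zE]; split=> //; rewrite (cs_weight cs gz) /=.
  by rewrite subrK.
apply/seteqP; split=> // z _.
have sB : subspace (bigsum predT (fun x : nat * nat => B x.1 x.2)).
  by apply: subspace_bigsum => x _; exact: subspace_bidegree.
have gB p z' : cplxset (gr p) z' -> bigsum predT (fun x : nat * nat => B x.1 x.2) z'.
  move=> /(cs_span cs)[r [-> rP]]; apply: (subspace_sum_seq sB) => x /rP[Mx _].
  by apply: (bigsum_mem (i := (x.1.1.1 + x.1.2, x.1.1.2 + x.1.2)%N)) => //; exact: M_bidegree.
have rB u : bigsum predT (fun x : nat * nat => B x.1 x.2) (rl u).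
  have [_ _ [_ /seteqP[/(_ u Logic.I) [s [f [sP ->]]] _]] _] := hgl.
  rewrite rl_sum; apply: (subspace_sum_seq sB) => p /sP[_ gp].
  by apply: (gB p); split=> //; exact: subspace0.
by rewrite (cplxE z); apply: (subspaceD sB) => //; exact: (subspaceZ sB).
Qed.

Section Components.
Variable pr : nat * nat -> cplx c -> cplx c.
Hypothesis prB : forall x z, B x.1 x.2 (pr x z).
Hypothesis prL : forall x, linear (pr x).
Hypothesis pr_id : forall x z, B x.1 x.2 z -> pr x z = z.
Hypothesis pr_0 : forall x y z, x != y -> B y.1 y.2 z -> pr x z = 0.
Hypothesis pr_sum : forall z, exists S : seq (nat * nat),
  [/\ uniq S, forall x, x \notin S -> pr x z = 0 & z = \sum_(x <- S) pr x z].

(** The sum of the pieces of bidegrees satisfying Q, described by the vanishing of the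
    other components. *)
Definition band (Q : nat -> nat -> Prop) : set (cplx c) :=
  [set z | forall r s, ~ Q r s -> pr (r, s) z = 0].

Lemma pr0 x : pr x 0 = 0.
Proof.
by have := prL x 1 0 0; rewrite !scale1r addr0 -[X in X = _]addr0 => /addrI.
Qed.
Lemma prD x z z' : pr x (z + z') = pr x z + pr x z'.
Proof. by have := prL x 1 z z'; rewrite !scale1r. Qed.
Lemma prZ x a z : pr x (a *: z) = a *: pr x z.
Proof. by have := prL x a z 0; rewrite pr0 !addr0. Qed.
Lemma prN x z : pr x (- z) = - pr x z.
Proof. by rewrite -scaleN1r prZ scaleN1r. Qed.
Lemma pr_bigsum x (I : Type) (r : seq I) (P : pred I) (f : I -> cplx c) :
  pr x (\sum_(i <- r | P i) f i) = \sum_(i <- r | P i) pr x (f i).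
Proof. exact: (big_morph _ (prD x) (pr0 x)). Qed.

Lemma prE x y z : B y.1 y.2 z -> pr x z = if x == y then z else 0.
Proof. by move=> Bz; case: eqP => [->|/eqP xy]; [exact: pr_id | exact: pr_0 Bz]. Qed.

Lemma subspace_band Q : subspace (band Q).
Proof.
split=> [r s _|a z z' bz bz' r s Qrs]; first exact: pr0.
by rewrite prD prZ bz // bz' // scaler0 addr0.
Qed.

Lemma band_sub (Q Q' : nat -> nat -> Prop) : (forall r s, Q r s -> Q' r s) -> band Q `<=` band Q'.
Proof. by move=> QQ' z bz r s Qrs; apply: bz => /QQ'. Qed.
Lemma band_ext (Q Q' : nat -> nat -> Prop) : (forall r s, Q r s <-> Q' r s) -> band Q = band Q'.
Proof. by move=> QQ'; apply/seteqP; split; apply: band_sub => r s /QQ'. Qed.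

Lemma bidegree_band (Q : nat -> nat -> Prop) r s : Q r s -> B r s `<=` band Q.
Proof.
move=> Qrs z Bz r' s' Qrs'; rewrite (prE _ (y := (r, s))) //; case: eqP => // [[rE sE]].
by case: Qrs'; rewrite rE sE.
Qed.

(** Together with bidegree_band: a band is the least subspace that contains its pieces. *)
Lemma band_min (Q : nat -> nat -> Prop) (S : set (cplx c)) : subspace S ->
  (forall r s, Q r s -> B r s `<=` S) -> band Q `<=` S.
Proof.
move=> sS QS z bz; have [r [_ _ ->]] := pr_sum z.
apply: (subspace_sum sS) => [[a b]] _.
have [Qab|nQ] := pselect (Q a b); first exact: (QS _ _ Qab _ (prB (a, b) z)).
by rewrite bz //; exact: subspace0.
Qed.

Lemma bandI Q Q' : band Q `&` band Q' = band (fun r s => Q r s /\ Q' r s).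
Proof.
apply/seteqP; split=> [z [bz bz'] r s /not_andP[]|z bz]; [exact: bz | exact: bz' |].
by split; apply: band_sub bz => r s [].
Qed.

Lemma band_add Q Q' : setadd (band Q) (band Q') = band (fun r s => Q r s \/ Q' r s).
Proof.
apply/seteqP; split=> [_ [z [z' [bz [bz' ->]]]]|].
  apply: (subspaceD (subspace_band _)).
    by apply: band_sub bz => r s; left.
  by apply: band_sub bz' => r s; right.
apply: band_min; first by apply: subspace_setadd; exact: subspace_band.
move=> r s [] Qrs z Bz.
  exists z, 0; rewrite addr0; split; first exact: bidegree_band Bz.
  by split=> //; exact: subspace0 (subspace_band _).
exists 0, z; rewrite add0r; split; first exact: subspace0 (subspace_band _).
by split=> //; exact: bidegree_band Bz.
Qed.

Lemma band_inj0 Q z : band Q z -> (forall r s, Q r s -> pr (r, s) z = 0) -> z = 0.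
Proof.
move=> bz Qz; have [r [_ _ ->]] := pr_sum z; rewrite big1 // => [[a b]] _.
by have [/Qz|/bz] := pselect (Q a b).
Qed.

Lemma band_eq0 Q z : (forall r s, ~ Q r s) -> band Q z -> z = 0.
Proof. by move=> nQ bz; apply: (band_inj0 bz) => r s /nQ. Qed.

Lemma graded_band p : cplxset (gr p) = band (fun r s => (r + s)%:Z = p + 2).
Proof.
apply/seteqP; split=> [z /(cs_span cs)[r [-> rP]]|].
  apply: (subspace_sum_seq (subspace_band _)) => x /rP[Mx xE].
  apply: bidegree_band (M_bidegree Mx); lia.
apply: band_min; first exact: csub.
by move=> r s rs z [gz _]; have <- : (r + s)%:Z - 2 = p by lia.
Qed.

Lemma pr_adJ r s z : pr (r, s) (adJ z) = ((r%:R - s%:R) * 'i%C) *: pr (r, s) z.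
Proof.
have [S [_ _ ->]] := pr_sum z; rewrite (lie_sumr lh) !pr_bigsum scaler_sumr.
apply: eq_bigr => x _; have [_ ->] := prB x z; rewrite prZ (prE _ (prB x z)).
by case: eqP => [<-//|_]; rewrite !scaler0.
Qed.

Lemma eigensp_band p a :
  E p a = band (fun r s => (r + s)%:Z = p + 2 /\ (r%:R - s%:R) * 'i%C = a).
Proof.
apply/seteqP; split=> [z [gz zE] r s /not_andP[]|].
- by move: gz; rewrite graded_band; apply.
- move=> /eqP na; have := congr1 (pr (r, s)) zE; rewrite pr_adJ prZ => /eqP.
  by rewrite -subr_eq0 -scalerBl scaler_eq0 subr_eq0 (negbTE na) => /eqP.
apply: band_min; first exact: subspace_eigensp.
move=> r s [rs <-] z; rewrite /bidegree.
by have -> : (r + s)%:Z - 2 = p by lia.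
Qed.

Lemma bidegreeE r s : B r s = band (fun r' s' => r' = r /\ s' = s).
Proof.
rewrite /bidegree eigensp_band; apply: band_ext => r' s'; split=> [[e1 e2]|[-> ->]].
  by apply: bidegree_eq => //; lia.
by split=> //; lia.
Qed.

(** The result is a band rather than a single piece because r + r' or s + s' may vanish;
    then no bidegree qualifies and the bracket is zero. *)
Lemma bidegree_bracket r s r' s' z z' : B r s z -> B r' s' z' ->
  band (fun a b => a.+1 = r + r' /\ b.+1 = s + s')%N (cbr br z z').
Proof.
move=> [gz zE] [gz' zE'].
have : E ((r + s)%:Z - 2 + ((r' + s')%:Z - 2)) ((r%:R - s%:R) * 'i%C + (r'%:R - s'%:R) * 'i%C)
    (cbr br z z').
  split; first exact: cplx_graded.
  by rewrite (lie_jacobi lh) zE zE' (lieZl lh) (lieZr lh) -scalerDl.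
rewrite eigensp_band; apply: band_sub => a b [ab].
rewrite -mulrDl addrACA -opprD -!natrD => abE.
have [||] := @bidegree_eq a.+1 b.+1 (r + r') (s + s').
- by rewrite /=; lia.
- rewrite -abE -[a.+1]addn1 -[b.+1]addn1 !natrD opprD addrACA subrr addr0. by [].
by [].
Qed.

Lemma band_bracket (Q Q' Q'' : nat -> nat -> Prop) z z' :
  (forall r s r' s' a b, Q r s -> Q' r' s' -> a.+1 = (r + r')%N -> b.+1 = (s + s')%N -> Q'' a b) ->
  band Q z -> band Q' z' -> band Q'' (cbr br z z').
Proof.
move=> QQ bz bz'.
have sl z0 : subspace [set z | band Q'' (cbr br z z0)].
  split=> [|k x y bx by_]; rewrite /= ?(lie0l lh); first exact: subspace0 (subspace_band _).
  by rewrite (lieDl lh) (lieZl lh); exact: (subspaceZD (subspace_band _)).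
have sr z0 : subspace [set z | band Q'' (cbr br z0 z)].
  split=> [|k x y bx by_]; rewrite /= ?(lie0r lh); first exact: subspace0 (subspace_band _).
  by rewrite (lieDr lh) (lieZr lh); exact: (subspaceZD (subspace_band _)).
apply: (band_min (sl z')) bz => r s Qrs x Bx /=.
apply: (band_min (sr x)) bz' => r' s' Qrs' x' Bx' /=.
by apply: band_sub (bidegree_bracket Bx Bx') => a b [aE bE]; exact: QQ Qrs Qrs' aE bE.
Qed.

(** Conjugation fixes the degree and conjugates the eigenvalue i(r - s) of the real
    operator ad J. *)
Lemma bidegree_conj r s z : B r s z -> B s r (cconj z).
Proof.
move=> [gz zE]; split; first by rewrite addnC; exact: cplxset_conj.
rewrite -[rl J]cconj_rl -cbr_conj // zE cconjZ; congr (_ *: _).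
have cE k : k%:R = (k%:R : R)%:C%C :> C by rewrite rmorph_nat.
by apply/eqP; rewrite !cE -!rmorphB /= eq_complex /= !(mulr0, mul0r, mulr1, subr0, addr0) opprB !eqxx.
Qed.

Lemma pr_conj r s z : pr (r, s) (cconj z) = cconj (pr (s, r) z).
Proof.
have [S [_ _ ->]] := pr_sum z; rewrite cconj_sum !pr_bigsum cconj_sum; apply: eq_bigr => x _.
rewrite (prE _ (prB x z)) (prE _ (y := (x.2, x.1))); last exact: bidegree_conj (prB x z).
case: x => a b /=; rewrite !xpair_eqE andbC.
by case: ifP => _ //; rewrite cconj0.
Qed.

Lemma band_conj Q : conjset (band Q) = band (fun r s => Q s r).
Proof.
apply/seteqP; split=> z; rewrite conjsetE => h r s nQ.
  by rewrite -[z]cconjK pr_conj h // cconj0.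
by rewrite pr_conj h // cconj0.
Qed.

Lemma nondegenerate_m1 v : gr (-1) v -> (forall w, gr (-1) w -> br v w = 0) -> v = 0.
Proof.
have [_ [_ _ [e [b [e0 _ brb _ bn]]]] _ _] := hc => gv vw.
by apply: bn => // w gw; have /eqP := vw w gw; rewrite brb // scaler_eq0 (negbTE e0) orbF => /eqP.
Qed.

Lemma nondegenerate_cplx p z : -1 <= p -> cplxset (gr p) z ->
  (forall v, cplxset (gr (-1)) v -> cbr br z v = 0) -> z = 0.
Proof.
move=> p1 [g1 g2] zv.
have [_ _ trans _] := hc.
have t0 x : gr p x -> (forall v, gr (-1) v -> br x v = 0) -> x = 0.
  have [p0|p0] := leP 0 p; first exact: trans.
  have -> : p = -1 by lia.
  exact: nondegenerate_m1.
have zv' v : gr (-1) v -> br z.1 v = 0 /\ br z.2 v = 0.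
  move=> gv; have : cbr br z (rl v) = 0 by apply: zv; split=> //; exact: subspace0.
  by rewrite /cbr /= !(lie0r hl) subr0 add0r => [[]].
have z1 : z.1 = 0 by apply: t0 => // v /zv'[].
have z2 : z.2 = 0 by apply: t0 => // v /zv'[].
by rewrite (cplxE z) z1 z2 rl0 scaler0 addr0.
Qed.

(** Since (10)-vectors of degree -1 have bidegree (1, 0), they commute with bidegree
    (r, 0); the remaining (01)-vectors suffice to detect z. *)
Lemma bidegree_transitive r z : (0 < r)%N -> B r 0 z ->
  (forall v, B 0 1 v -> cbr br z v = 0) -> z = 0.
Proof.
move=> r0 Bz zv; have [gz _] := Bz.
apply: (nondegenerate_cplx _ gz); first by lia.
move=> v; rewrite graded_band.
have sv : subspace [set v | cbr br z v = 0].
  by split=> [|a x y /= xE yE]; rewrite /= ?(lie0r lh) // (lieDr lh) (lieZr lh) xE yE scaler0 addr0.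
apply: (band_min sv) => a b ab x Bx /=.
have [/eqP|b0] := eqVneq b 0%N => [b0|].
  have z0 := bidegree_bracket Bz Bx; apply: band_eq0 z0 => a' b'.
  by rewrite (eqP b0) addn0 => [[]].
have [bE aE] : b = 1%N /\ a = 0%N by lia.
by apply: zv; rewrite -bE -aE.
Qed.

(** The bidegrees of q_{k-1}. *)
Definition ufil (k r s : nat) : Prop := (0 < r /\ (0 < s \/ k < r))%N.

(** Bracketing with conj q, the band s > 0, never lowers s and lowers r at most by 1. A
    component with s > 0 therefore ends in conj q, and one of bidegree (r, 0) with
    r > k + 1 ends in q_{k-1} + conj q. A component of bidegree (k + 1, 0) is mapped by
    bidegree (0, 1) to bidegree (k, 0), which occurs neither in q_{k-1} nor in conj q;
    so it must commute with the (01)-vectors of degree -1, and vanishes. *)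
Lemma qfil_band k : qfil br (band (fun r s => 0 < r)%N) k = band (ufil k).
Proof.
have ubar : conjset (band (fun r s => 0 < r)%N) = band (fun r s => 0 < s)%N by rewrite band_conj.
elim: k => [|k IH] /=.
  apply: band_ext => r s; rewrite /ufil; split=> [r0|[]//]; by split=> //; right.
rewrite IH ubar band_add; apply/seteqP; split=> [z [zk zb] r s nQ|z zk].
  have [Qk|nQk] := pselect (ufil k r s); last exact: zk.
  have [sE rE] : s = 0%N /\ r = k.+1.
    by move: nQ Qk; rewrite /ufil => nQ Qk; move/not_andP: nQ => nQ; lia.
  rewrite sE rE in Qk *; apply: (bidegree_transitive (r := k.+1)) => //; first exact: prB (k.+1, 0%N) z.
  move=> v Bv; have Bv' : band (fun r s => 0 < s)%N v by apply: bidegree_band Bv.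
  have := zb v Bv' k 0%N; rewrite /ufil.
  suff -> : pr (k, 0%N) (cbr br z v) = cbr br (pr (k.+1, 0%N) z) v by apply; lia.
  have [S [_ _ ->]] := pr_sum z; rewrite (lie_suml lh) !pr_bigsum (lie_suml lh).
  apply: eq_bigr => x _; rewrite (prE _ (prB x z)).
  have := bidegree_bracket (prB x z) Bv; rewrite addn0 => bx.
  case: eqP => [xE|xE].
    rewrite -xE in bx *; apply: pr_id; rewrite bidegreeE; apply: band_sub bx => a b /=.
    by lia.
  rewrite (lie0l lh) bx // => [[/= e1 e2]]; apply: xE.
  by rewrite [x]surjective_pairing -e1 (_ : x.2 = 0%N) //; lia.
split; first by apply: band_sub zk => r s; rewrite /ufil; lia.
move=> v bv; apply: band_bracket zk bv => r s r' s' a b; rewrite /ufil; lia.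
Qed.

(** * The symmetric power components by bidegree *)

(** Both T and ad J are diagonal on monomials, so only monomials with the right l - k
    are needed. *)
Lemma bidegree_span r s z : B r s z -> exists q : seq (nat * nat * nat * cplx c),
  z = \sum_(x <- q) x.2 /\
  forall x, x \in q -> [/\ M x.1.1.1 x.1.1.2 x.1.2 x.2, (x.1.1.1 + x.1.2 = r)%N & (x.1.1.2 + x.1.2 = s)%N].
Proof.
move=> [gz zE]; have [q [zq qP]] := cs_span cs gz.
pose a (x : nat * nat * nat * cplx c) : C := (x.1.1.1%:R - x.1.1.2%:R) * 'i%C.
exists [seq x <- q | a x == (r%:R - s%:R) * 'i%C]; split.
  rewrite big_filter; apply: (@eigen_sum_filter _ _ (lie_ad lh (rl J)) _ _ _ a _ z) => // x /qP[Mx _].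
  by case: (cs_eigensp cs Mx).
move=> x; rewrite mem_filter => /andP[/eqP ax /qP[Mx xE]]; split=> //.
  have [||] := @bidegree_eq (x.1.1.1 + x.1.2) (x.1.1.2 + x.1.2) r s; [lia| |by []].
  by rewrite -ax /a !natrD opprD addrACA subrr addr0.
have [||] := @bidegree_eq (x.1.1.1 + x.1.2) (x.1.1.2 + x.1.2) r s; [lia| |by []].
by rewrite -ax /a !natrD opprD addrACA subrr addr0.
Qed.

(** As J lies in sp, equivariance computes ad J on the value of sigma as the sum of the
    l + k eigenvalues of its arguments. *)
Lemma Sbi_bidegree p l k : (l + k)%:Z = p + 2 -> Sbi br gr J p l k `<=` B l k.
Proof.
move=> lk; apply: lspan_min; first exact: subspace_bidegree.
move=> _ [sg [v [hs [hv ->]]]].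
have Vv i : cplxset (gr (-1)) (v i) by have := hv i; case: ifP => _ [].
have [gs _ _ eqv] := hs v Vv.
split; first by have -> : (l + k)%:Z - 2 = p by lia.
rewrite eqv // (eq_bigr (fun i : 'I_(l + k) => (if (i < l)%N then 'i%C else - 'i%C) *: sg v)).
  rewrite -scaler_suml big_split_ord /=; congr (_ *: _).
  rewrite (eq_bigr (fun=> 'i%C)) => [|i _]; last by rewrite ltn_ord.
  rewrite [X in _ + X](eq_bigr (fun=> - 'i%C)) => [|i _]; last by rewrite ltnNge leq_addr.
  by rewrite !sumr_const !card_ord -[_ *+ l]mulr_natl -[_ *+ k]mulr_natl mulrN mulrBl.
move=> i _; have vE : adJ (v i) = (if (i < l)%N then 'i%C else - 'i%C) *: v i.
  by have := hv i; case: ifP => _ [].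
by rewrite vE (equivariant_slotZ hgl hs) // upd_id.
Qed.

(** A monomial of bidegree (r, 0) or (0, s) cannot contain t. *)
Lemma Sbi_extremal p r s : (r + s)%:Z = p + 2 -> (r = 0 \/ s = 0)%N -> Sbi br gr J p r s = B r s.
Proof.
move=> rp rs0; apply/seteqP; split; first exact: Sbi_bidegree.
move=> z /bidegree_span[q [-> qP]]; apply: (subspace_sum_seq (subspace_lspan _)) => x /qP[].
case: x => [[[l k] h] x] /= Mx lE kE; have [h0 lr ks] : [/\ h = 0, l = r & k = s]%N by split; lia.
by move: Mx; rewrite h0 lr ks; exact: (cs_Sbi cs).
Qed.

(** The component S^m of degree p is the eigenspace of t d/dt for the eigenvalue h, and
    a monomial containing t^h has r, s at least h. *)
Lemma Scomp_band p m h : p + 2 = (m + h.*2)%:Z ->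
  Scomp br gr p m `<=` band (fun r s => (r + s)%:Z = p + 2 /\ (h <= r)%N /\ (h <= s)%N).
Proof.
move=> pE z Sz; have [gz Tz] := cs_Scomp_gr cs pE Sz; have [q [zq qP]] := cs_span cs gz.
pose a (x : nat * nat * nat * cplx c) : C := x.1.2%:R.
have -> := @eigen_sum_filter _ _ T _ _ _ a _ _ _ Tz zq; last by move=> x /qP[/M_T].
rewrite -big_filter; apply: (subspace_sum_seq (subspace_band _)) => x.
rewrite mem_filter /a eqr_nat => /andP[/eqP hx /qP[]].
by case: x hx => [[[l k] h'] x] /= -> Mx xE; apply: bidegree_band (M_bidegree Mx); lia.
Qed.

Lemma Sbi_Scomp p l k : Sbi br gr J p l k `<=` Scomp br gr p (l + k).
Proof.
move=> _ [d [a [v [vP ->]]]]; exists d, a, v; split=> // i.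
have [sg [w [hs [hw wE]]]] := vP i; exists sg, w; split=> //; split=> // j.
by have := hw j; case: ifP => _ [].
Qed.

Lemma usummand_T p lmax i x : -1 <= p -> lmax <= p + 2 -> uindex p lmax i ->
  usummand br gr J p i x ->
  T x = (match i with inl _ => 0%N | inr j => j.+1 end)%:R *: x.
Proof.
move=> p1 lp; case: i => [l|j] /=.
  move=> /andP[l1 ll] /Sbi_Scomp Sx.
  by have [|_ ->] := cs_Scomp_gr cs (h := 0) _ Sx; first lia.
move=> jp Sx; have [|_ ->//] := cs_Scomp_gr cs (h := j.+1) _ Sx; lia.
Qed.

(** The summands are told apart by the degree in t, which is 0 on S^{l,k} and j + 1 on
    S^{p-2j}, and those of degree 0 by ad J. *)
Lemma usummand_independent p lmax : -1 <= p -> lmax <= p + 2 ->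
  independent (uindex p lmax) (usummand br gr J p).
Proof.
move=> p1 lp s f us sP s0 i si.
pose a (i : nat + nat) : C := (match i with inl _ => 0%N | inr j => j.+1 end)%:R.
have Tf j : j \in s -> T (f j) = a j *: f j by move=> /sP[Pj]; exact: usummand_T Pj.
have T0 : T 0 = a i *: 0 by rewrite linear0 scaler0.
have := eigen_sum_filter Tf T0 (esym s0); rewrite -big_filter => /esym s0'.
pose P' j := uindex p lmax j && (a j == a i).
have sP' j : j \in [seq j <- s | a j == a i] -> P' j /\ usummand br gr J p j (f j).
  by rewrite mem_filter => /andP[aj /sP[Pj Fj]]; rewrite /P' Pj.
have si' : i \in [seq j <- s | a j == a i] by rewrite mem_filter eqxx.
have us' : uniq [seq j <- s | a j == a i] by exact: filter_uniq.
move: [seq j <- s | a j == a i] us' sP' s0' si' => s' us' sP' s0'.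
have ai j : P' j -> match i, j with inl _, inl _ => true | inr k, inr k' => k' == k | _, _ => false end.
  by move=> /andP[_]; rewrite /a eqr_nat; case: (i) j => [l|k] [l'|k'].
pose a' (j : nat + nat) : C := match j with
  inl l => (l%:R - (absz (p + 2 - l%:Z)%R)%:R) * 'i%C | inr k => k.+1%:R end.
pose D : {linear cplx c -> cplx c} := match i with inl _ => lie_ad lh (rl J) | inr _ => T end.
apply: (@eigen_independent _ _ D _ P' (usummand br gr J p) a' _ _ s' f us' sP' s0' i)
  => // [j k Pj Pk|j x Pj Sx].
  have := ai _ Pj; have := ai _ Pk; case: (i) j k Pj Pk => [l|l] [j|j] [k|k] //=.
    move=> /andP[/= uj _] /andP[/= uk _] _ _.
    have e : (j + absz (p + 2 - j%:Z)%R = k + absz (p + 2 - k%:Z)%R)%N by lia.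
    by move=> /(bidegree_eq e)[->].
  by move=> _ _ /eqP -> /eqP ->.
have := ai _ Pj; rewrite /D; case: (i) j Pj Sx => [l|l] [j|j] //= /andP[uj _] Sx _;
  last exact: usummand_T uj Sx.
have lk : (j + absz (p + 2 - j%:Z)%R)%:Z = p + 2 by move: uj => /=; lia.
by have [_ ->] := Sbi_bidegree lk Sx.
Qed.

(** Monomials of bidegree (r, s) without t belong to S^{r,s}, which is a summand if
    r > 0; monomials with t have r > 0 and s > 0 and lie in some S^{p-2j}. *)
Lemma ubigsum (p lmax : int) : -1 <= p -> lmax = p + 1 \/ lmax = p + 2 ->
  bigsum (uindex p lmax) (usummand br gr J p) =
  band (fun r s => (r + s)%:Z = p + 2 /\ (0 < r)%N /\ r%:Z <= lmax).
Proof.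
move=> p1 lp; have sS i : subspace (usummand br gr J p i) by case: i => ?; exact: subspace_lspan.
apply/seteqP; split.
  apply: bigsum_min => [|[l|j] /=]; first exact: subspace_band.
    move=> /andP[l1 ll] z Sz; have lk : (l + absz (p + 2 - l%:Z)%R)%:Z = p + 2 by lia.
    by apply: bidegree_band (Sbi_bidegree lk Sz); lia.
  move=> jp z Sz; have pE : p + 2 = (absz (p - 2 * j%:Z)%R + j.+1.*2)%:Z by lia.
  by apply: band_sub (Scomp_band pE Sz) => r s; lia.
apply: band_min; first by apply: subspace_bigsum => i _; exact: sS.
move=> r s [rs [r0 rl]] z /bidegree_span[q [-> qP]].
apply: (subspace_sum_seq (subspace_bigsum (fun i _ => sS i))) => x /qP[].
case: x => [[[l k] h] x] /= Mx lE kE.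
have [h0|h0] := posnP h.
  apply: (bigsum_mem (i := inl l)) => /=; first by apply/andP; split; lia.
  have -> : absz (p + 2 - l%:Z)%R = k by lia.
  by apply: (cs_Sbi cs); [lia | rewrite -h0].
apply: (bigsum_mem (i := inr h.-1)) => /=; first lia.
have -> : absz (p - 2 * h.-1%:Z)%R = (l + k)%N by lia.
by apply: (cs_Scomp cs) Mx; lia.
Qed.

Lemma band_direct (I : eqType) (P : pred I) (Q : I -> nat -> nat -> Prop) :
    (forall i j r s, P i -> P j -> Q i r s -> Q j r s -> i = j) ->
  is_direct_sum P (fun i => band (Q i)) (band (fun r s => exists i, P i /\ Q i r s)).
Proof.
move=> disj; split.
  move=> q f uq fP f0 i iq; have [Pi bi] := fP _ iq; apply: (band_inj0 bi) => r s Qi.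
  have := pr0 (r, s); rewrite -f0 pr_bigsum (bigD1_seq i) //= big_seq_cond big1 ?addr0 //.
  by move=> j /andP[/fP[Pj bj] ji]; apply: bj => Qj; move/eqP: ji; apply; exact: disj Qj Qi.
apply/seteqP; split.
  apply: band_min; first by apply: subspace_bigsum => i _; exact: subspace_band.
  by move=> r s [i [Pi Qi]] z Bz; apply: (bigsum_mem (i := i)) => //; exact: bidegree_band Bz.
apply: bigsum_min; first exact: subspace_band.
by move=> i Pi; apply: band_sub => r s Qi; exists i.
Qed.

Lemma ucomp_band p : -1 <= p -> ucomp br gr J p = band (fun r s => (r + s)%:Z = p + 2 /\ (0 < r)%N).
Proof.
move=> p1; rewrite /ucomp ubigsum //; last by right.
by apply: band_ext => r s; lia.
Qed.

Lemma ualg_direct : is_direct_sum (fun p : int => -1 <= p) (ucomp br gr J) (band (fun r s => 0 < r)%N).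
Proof.
pose Q (p : int) r s := (r + s)%:Z = p + 2 /\ (0 < r)%N.
have -> : band (fun r s => 0 < r)%N = band (fun r s => exists p : int, -1 <= p /\ Q p r s).
  apply: band_ext => r s; split=> [r0|[p []//]]; last by rewrite /Q => _ [].
  by exists ((r + s)%:Z - 2); rewrite /Q; lia.
apply: (direct_sum_eq (F := fun p => band (Q p))) => [p p1|]; first by rewrite ucomp_band.
by apply: band_direct => p q r s _ _ []; rewrite /Q; lia.
Qed.

Lemma ualg_band : ualg br gr J = band (fun r s => 0 < r)%N.
Proof. by have [_ ->] := ualg_direct. Qed.

Lemma ucomp_cap_band p : -1 <= p -> ucomp br gr J p `&` conjset (ucomp br gr J p) =
  band (fun r s => (r + s)%:Z = p + 2 /\ (0 < r)%N /\ (0 < s)%N).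
Proof. by move=> p1; rewrite ucomp_band // band_conj bandI; apply: band_ext => r s; lia. Qed.

Lemma usummand_direct p : -1 <= p ->
  is_direct_sum (uindex p (p + 2)) (usummand br gr J p) (ucomp br gr J p).
Proof. by move=> p1; split=> //; exact: usummand_independent. Qed.

Lemma usummand_cap_direct p : -1 <= p ->
  is_direct_sum (uindex p (p + 1)) (usummand br gr J p)
    (ucomp br gr J p `&` conjset (ucomp br gr J p)).
Proof.
move=> p1; split; first by apply: usummand_independent => //; lia.
rewrite ucomp_cap_band // ubigsum //; last by left.
by apply: band_ext => r s; lia.
Qed.

Lemma eigensp_direct (p : int) (P : pred C) (Q : nat -> nat -> Prop) :
    (forall r s, (r + s)%:Z = p + 2 -> P ((r%:R - s%:R) * 'i%C) <-> Q r s) ->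
  is_direct_sum P (E p) (band (fun r s => (r + s)%:Z = p + 2 /\ Q r s)).
Proof.
move=> PQ; pose F a r s := (r + s)%:Z = p + 2 /\ (r%:R - s%:R) * 'i%C = a :> C.
have -> : band (fun r s => (r + s)%:Z = p + 2 /\ Q r s) = band (fun r s => exists a, P a /\ F a r s).
  apply: band_ext => r s; split=> [[rs Qrs]|[a [Pa [rs aE]]]].
    by exists ((r%:R - s%:R) * 'i%C); split; [exact/PQ | ].
  by split=> //; apply/(PQ _ _ rs); rewrite aE.
apply: (direct_sum_eq (F := fun a => band (F a))) => [a _|]; first by rewrite eigensp_band.
by apply: band_direct => a b r s _ _ [_ <-] [_ <-].
Qed.

Lemma extr_eigenvalue_eq (p : int) r s : (r + s)%:Z = p + 2 ->
  ((r%:R - s%:R) * 'i%C == extr_eigenvalue R p) = (s == 0%N) /\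
  ((r%:R - s%:R) * 'i%C == - extr_eigenvalue R p) = (r == 0%N).
Proof.
move=> rs; have -> : extr_eigenvalue R p = (((r + s)%N)%:R - 0%:R) * 'i%C.
  by rewrite /extr_eigenvalue -rs subr0.
have -> : - ((((r + s)%N)%:R - 0%:R) * 'i%C) = (0%:R - ((r + s)%N)%:R) * 'i%C :> C.
  by rewrite -mulNr opprB.
split; apply/eqP/eqP => [/bidegree_eq|->].
- by rewrite addn0 => /(_ erefl)[].
- by rewrite addn0.
- by rewrite add0n => /(_ erefl)[].
- by rewrite add0n.
Qed.

Lemma eigensp_ucomp_direct (p : int) : -1 <= p ->
  is_direct_sum (fun a => a != - extr_eigenvalue R p) (E p) (ucomp br gr J p).
Proof.
move=> p1; rewrite ucomp_band //; apply: eigensp_direct => r s /extr_eigenvalue_eq[_ ->]; lia.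
Qed.

Lemma eigensp_cap_direct (p : int) : -1 <= p ->
  is_direct_sum (fun a => (a != extr_eigenvalue R p) && (a != - extr_eigenvalue R p)) (E p)
    (ucomp br gr J p `&` conjset (ucomp br gr J p)).
Proof.
move=> p1; rewrite ucomp_cap_band //; apply: eigensp_direct => r s /extr_eigenvalue_eq[-> ->]; lia.
Qed.

Lemma eigensp_extr (p : int) r : r%:Z = p + 2 ->
  E p (extr_eigenvalue R p) = B r 0 /\ E p (- extr_eigenvalue R p) = B 0 r.
Proof.
move=> rp; rewrite !eigensp_band !bidegreeE; split; apply: band_ext => a b; split.
- by move=> [ab /eqP]; have [-> _] := extr_eigenvalue_eq ab; lia.
- move=> [-> ->]; split; first lia.
  by apply/eqP; have [|->] := @extr_eigenvalue_eq p r 0; first lia.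
- by move=> [ab /eqP]; have [_ ->] := extr_eigenvalue_eq ab; lia.
- move=> [-> ->]; split; first lia.
  by apply/eqP; have [|_ ->] := @extr_eigenvalue_eq p 0 r; first lia.
Qed.
(** * The CR algebra and its isotropy algebra *)

Section CRAlgebra.
Local Notation u := (ualg br gr J).

(** A real vector of u lies in the intersection of u with its conjugate. *)
Lemma isotropy_band : isotropy u = repart (band (fun r s => 0 < r /\ 0 < s)%N).
Proof.
apply/seteqP; split=> x; rewrite /isotropy /repart /= ualg_band => bx; last first.
  by apply: band_sub bx => r s [].
suff : (band (fun r s => 0 < r)%N `&` band (fun r s => 0 < s)%N) (rl x) by rewrite bandI.
by split=> //; rewrite -(band_conj (fun r s => 0 < r)%N); apply/conjsetE; rewrite cconj_rl.
Qed.

Lemma band_real_component (Q : nat -> nat -> Prop) p x :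
  repart (band (fun r s => (r + s)%:Z = p + 2 /\ Q r s)) x -> gr p x.
Proof.
rewrite /repart /= => bx; apply/(cplxset_rl _ (subspace0 (hsub p))).
by rewrite graded_band; apply: band_sub bx => r s [].
Qed.

(** The components of a real vector with respect to the real grading are again real, and
    those of negative degree vanish because no bidegree with r, s > 0 has negative
    degree. *)
Lemma isotropy_direct : is_direct_sum (fun p : int => 0 <= p)
  (fun p => repart (ucomp br gr J p `&` conjset (ucomp br gr J p))) (isotropy u).
Proof.
pose F (p : int) := repart (band (fun r s => (r + s)%:Z = p + 2 /\ (0 < r)%N /\ (0 < s)%N)).
have [_ _ dgr _] := hgl.
apply: (direct_sum_eq (F := F)) => [p p0|]; first by rewrite ucomp_cap_band //; lia.
split.
  have [ind _] := dgr; apply: independent_sub ind => p _; split=> // x; exact: band_real_component.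
rewrite isotropy_band; apply/seteqP; split; last first.
  apply: bigsum_min; first by apply: subspace_repart; exact: subspace_band.
  by move=> p _ x; rewrite /F /repart; apply: band_sub => r s [].
move=> x bx; have [s [f [us gf f0 xE]]] := decomposition_exists hsub dgr x.
have Ff p : F p (f p).
  move=> r r' nQ.
  have fE q : pr (r, r') (rl (f q)) =
      if q + 2 == (r + r')%:Z then pr (r, r') (rl (f q)) else 0.
    case: eqP => // rq; have : cplxset (gr q) (rl (f q)) by split=> //; exact: subspace0.
    by rewrite graded_band => -> // e; apply: rq.
  rewrite fE; case: eqP => // pE.
  have := bx r r'; rewrite xE rl_sum pr_bigsum.
  have [ps|/f0 -> _] := boolP (p \in s); last by rewrite rl0 pr0.
  rewrite (bigD1_seq p) //= big1 ?addr0; first by apply=> Q; apply: nQ; rewrite pE.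
  by move=> q qp; rewrite fE; case: eqP => // qE; case/eqP: qp; lia.
have fn p : ~~ (0 <= p) -> f p = 0.
  move=> p0; apply: rl_inj; apply: (band_eq0 _ (Ff p)) => r r'; lia.
exists [seq p <- s | 0 <= p], f; split; first by move=> p; rewrite mem_filter => /andP[].
by rewrite xE big_filter (bigID (fun p => 0 <= p)) /= [X in _ + X]big1 ?addr0.
Qed.

Lemma isotropy_bracket (p q : int) x y : 0 <= p -> 0 <= q ->
  repart (ucomp br gr J p `&` conjset (ucomp br gr J p)) x ->
  repart (ucomp br gr J q `&` conjset (ucomp br gr J q)) y ->
  repart (ucomp br gr J (p + q) `&` conjset (ucomp br gr J (p + q))) (br x y).
Proof.
move=> p0 q0; rewrite !ucomp_cap_band; try lia.
rewrite /repart /= -(cbr_rl hl); apply: band_bracket => r s r' s' a b; lia.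
Qed.

Lemma isotropy_graded (p : int) : 0 <= p ->
  repart (ucomp br gr J p `&` conjset (ucomp br gr J p)) `<=` gr p.
Proof. by move=> p0 x; rewrite ucomp_cap_band; [exact: band_real_component | lia]. Qed.

Lemma ualg_subalgebra : lie_subalgebra (cbr br) u.
Proof.
rewrite ualg_band; split; first exact: subspace_band.
by move=> x y; apply: band_bracket => r s r' s' a b; lia.
Qed.

Lemma qfil_ualg k : qfil br u k = band (ufil k).
Proof. by rewrite ualg_band qfil_band. Qed.

Lemma ualg_bar : conjset u = band (fun r s => 0 < s)%N.
Proof. by rewrite ualg_band band_conj. Qed.

Lemma ualg_hol_nondegenerate : hol_nondegenerate br u.
Proof.
rewrite /hol_nondegenerate ualg_bar ualg_band bandI; apply/seteqP; split=> z.
  move=> zk r s nQ; have := zk (r.+1) Logic.I; rewrite -ualg_band qfil_ualg; apply.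
  by rewrite /ufil; lia.
move=> bz k _; rewrite -ualg_band qfil_ualg; apply: band_sub bz => r s; rewrite /ufil; lia.
Qed.
End CRAlgebra.

(** * The core *)

Section Core.
Local Notation u := (ualg br gr J).
Local Notation cM := (coreM br gr J).

(** The complexified component of the core of degree r - 2. *)
Definition extremal r : set (cplx c) := band (fun a b => a = r /\ b = 0 \/ a = 0 /\ b = r)%N.

Lemma conj_extremal r : conjset (extremal r) = extremal r.
Proof. by rewrite /extremal band_conj; apply: band_ext => a b; lia. Qed.

Lemma extremalE r : extremal r = setadd (B r 0) (B 0 r).
Proof. by rewrite !bidegreeE band_add. Qed.

(** In degree -1 the extremal pieces exhaust the component of the contact algebra, so
    the two cases of the definition agree there. *)
Lemma coreM_gr (p : int) (r : nat) : (0 < r)%N -> r%:Z = p + 2 -> @cd_gr R cM p = repart (extremal r).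
Proof.
move=> r0 rp /=; case: ifP => [p0|_]; last first.
  have -> : absz (p + 2)%R = r by lia.
  by rewrite !Sbi_extremal -?extremalE //; (lia || by [left | right]).
have -> : repart (extremal r) = repart (cplxset (gr p)).
  by congr (repart _); rewrite graded_band; apply: band_ext => a b; lia.
by apply/seteqP; split=> x; rewrite /repart /= cplxset_rl //; exact: subspace0.
Qed.

Lemma coreM_sub_gr (p : int) : @cd_gr R cM p `<=` gr p.
Proof.
have [p0|p0] := ltP p 0; first by rewrite /= p0.
move=> x; rewrite (@coreM_gr p (absz (p + 2)%R)); try lia.
rewrite /repart /= => bx; apply/(cplxset_rl _ (subspace0 (hsub p))).
by rewrite graded_band; apply: band_sub bx => r s; lia.
Qed.

Lemma coreM_J (p : int) z : cplxmap (@cd_J R cM p) z = ((p + 2)%:~R^-1 : C) *: adJ z.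
Proof.
have -> : ((p + 2)%:~R^-1 : C) = (((p + 2)%:~R^-1 : R)%:C)%C by rewrite fmorphV rmorph_int.
rewrite /cplxmap /cbr cplxZE /= !scale0r !(lie0l hl) !subr0 !addr0. by [].
Qed.

Lemma coreM_cplx (p : int) (r : nat) : (0 < r)%N -> r%:Z = p + 2 -> cplxset (@cd_gr R cM p) = extremal r.
Proof.
move=> r0 rp; rewrite (coreM_gr r0 rp) cplxset_repart //; first exact: subspace_band.
exact: conj_extremal.
Qed.

Lemma coreM_eigen (p : int) (r : nat) (a : C) : (0 < r)%N -> r%:Z = p + 2 ->
    E p ((p + 2)%:~R * a) `<=` extremal r ->
  [set z | cplxset (@cd_gr R cM p) z /\ cplxmap (@cd_J R cM p) z = a *: z] =
  E p ((p + 2)%:~R * a).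
Proof.
move=> r0 rp Ea; have p2 : (p + 2)%:~R != 0 :> C by rewrite -rp intr_eq0; lia.
apply/seteqP; split=> z; rewrite /= coreM_J => -[gz zE].
  split; first by split; apply: coreM_sub_gr; case: gz.
  by rewrite -scalerA -zE scalerA mulfV // scale1r.
rewrite (coreM_cplx r0 rp); split; first exact: Ea.
by rewrite zE scalerA mulKf.
Qed.

Lemma coreM_10 (p : int) (r : nat) : (0 < r)%N -> r%:Z = p + 2 -> @cd10 R cM p = B r 0.
Proof.
move=> r0 rp; have [<- _] := eigensp_extr rp; apply: (coreM_eigen r0 rp).
have [-> _] := eigensp_extr rp.
by rewrite bidegreeE; apply: band_sub => a b; left.
Qed.

Lemma coreM_01 (p : int) (r : nat) : (0 < r)%N -> r%:Z = p + 2 -> @cd01 R cM p = B 0 r.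
Proof.
move=> r0 rp; have [_ <-] := eigensp_extr rp; rewrite /extr_eigenvalue -mulrN.
apply: (coreM_eigen r0 rp); rewrite mulrN; have [_ ->] := eigensp_extr rp.
by rewrite bidegreeE; apply: band_sub => a b; right.
Qed.

Lemma coreM_01_m1 : @cd01 R cM (-1) = B 0 1.
Proof. exact: coreM_01. Qed.

Lemma qq_band (p : int) (r : nat) : (0 < r)%N -> r%:Z = p + 2 -> qq br u p = band (ufil r.-1).
Proof. by move=> r0 rp; rewrite /qq qfil_ualg; congr (band (ufil _)); lia. Qed.

Lemma qqbar_band (p : int) (r : nat) : (0 < r)%N -> r%:Z = p + 2 ->
  qqbar br u p = band (fun a b => ufil r.-1 a b \/ ufil r.-1 b a).
Proof. by move=> r0 rp; rewrite /qqbar (qq_band r0 rp) band_conj band_add. Qed.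

Lemma band_split (QA QF QG : nat -> nat -> Prop) :
  (forall r s, QF r s -> QA r s \/ QG r s) -> band QF `<=` setadd (band QA) (band QG).
Proof. by move=> QQ; rewrite band_add; exact: band_sub. Qed.

Lemma band_disj (QA QG : nat -> nat -> Prop) :
  (forall r s, QA r s -> QG r s -> False) -> band QA `&` band QG `<=` [set 0].
Proof. by move=> QQ z; rewrite bandI; apply: band_eq0 => r s []; exact: QQ. Qed.

(** The bidegrees of q_p not in q_{p+1} reduce to (p + 2, 0), so the extremal piece is a
    complement; similarly for the conjugate and for q_p + conj q_p. *)
Lemma core_components (p : int) : -1 <= p ->
  [/\ set_bij (@cd_gr R cM p) (corere br u p) (fun x => coset (qqbar br u (p + 1)) (rl x)),
      set_bij (@cd10 R cM p) (core10 br u p) (coset (qq br u (p + 1))) &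
      set_bij (@cd01 R cM p) (core01 br u p) (coset (conjset (qq br u (p + 1))))].
Proof.
move=> p1; have [r r0 rp] : exists2 r, (0 < r)%N & r%:Z = p + 2 by exists (absz (p + 2)%R); lia.
have rp' : r.+1%:Z = (p + 1) + 2 by lia.
rewrite (coreM_gr r0 rp) (coreM_10 r0 rp) (coreM_01 r0 rp) !bidegreeE /corere /core10 /core01.
rewrite (qqbar_band r0 rp) (qq_band r0 rp) (qqbar_band (ltn0Sn r) rp') (qq_band (ltn0Sn r) rp') !band_conj.
split; [apply: quo_real_bij | apply: quo_bij | apply: quo_bij];
  (exact: subspace_band || exact: conj_extremal || rewrite ?band_conj);
  (apply: band_ext || apply: band_sub || apply: band_split || apply: band_disj) => a b;
  rewrite /ufil; lia.
Qed.

Lemma nontrivial_m1 : exists2 v, gr (-1) v & v != 0.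
Proof.
have [_ [_ [b [gb bU]] _] _ _] := hc; apply: contrapT => nv.
have v0 v : gr (-1) v -> v = 0 by move=> gv; apply: contrapT => /eqP v0; apply: nv; exists v.
have [a [_ aU]] := bU 0 (subspace0 (hsub _)).
have sum0 (a' : 'rV[R]_(2 * n)) : 0 = \sum_(i < 2 * n) a' ord0 i *: b i.
  by rewrite big1 // => i _; rewrite (v0 _ (gb i)) scaler0.
have := aU _ (sum0 (const_mx 0)); rewrite (aU _ (sum0 (const_mx 1))).
have i0 : 'I_(2 * n) by exists 0%N; rewrite muln_gt0.
by move=> /matrixP/(_ ord0 i0); rewrite !mxE => /eqP; rewrite oner_eq0.
Qed.

Lemma bracket_m2 z : gr (-2) z -> exists v w, [/\ gr (-1) v, gr (-1) w & z = br v w].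
Proof.
have [_ [_ _ [e [b [e0 ge brb _ bn]]]] _ _] := hc.
rewrite ge => -[a ->]; have [v gv v0] := nontrivial_m1.
have [w gw bvw] : exists2 w, gr (-1) w & b v w != 0.
  apply: contrapT => nw; case/eqP: v0; apply: bn => // w gw.
  by apply: contrapT => /eqP bw; apply: nw; exists w.
exists v, ((a / b v w) *: w); split=> //; first exact: (subspaceZ (hsub _)).
by rewrite (lieZr hl) brb // scalerA divfK.
Qed.

Lemma graded_m3 (p : int) : p < -2 -> gr p = [set 0].
Proof. by have [_ [h _ _] _ _] := hc; exact: h. Qed.

(** The real elements of degree at least -1; this is the term g_{-1} of the filtration. *)
Definition real_ge_m1 : set c := repart (band (fun r s => 0 < r + s)%N).

Lemma subspace_real_ge_m1 : subspace real_ge_m1.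
Proof. by apply: subspace_repart; exact: subspace_band. Qed.

Lemma gr_real_ge_m1 (p : int) x : -1 <= p -> gr p x -> real_ge_m1 x.
Proof.
move=> p1 gx; have : cplxset (gr p) (rl x) by split=> //; exact: subspace0.
by rewrite graded_band; apply: band_sub => r s; lia.
Qed.

Lemma gfil0 : gfil br u 0 = real_ge_m1.
Proof. by rewrite /= ualg_bar ualg_band band_add; congr (repart _); apply: band_ext => r s; lia. Qed.

Lemma graded_split x : setadd (gr (-2)) real_ge_m1 x.
Proof.
have sS : subspace (setadd (gr (-2)) real_ge_m1).
  by apply: subspace_setadd => //; exact: subspace_real_ge_m1.
have [_ _ dgr _] := hgl; have [s [f [_ gf _ ->]]] := decomposition_exists hsub dgr x.
apply: (subspace_sum_seq sS) => p _; have [p1|p1] := leP (-1) p.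
  by exists 0, (f p); rewrite add0r; split; [exact: subspace0 | split=> //; exact: gr_real_ge_m1 (gf p)].
have [p2|p2] := ltP p (-2); first by have := gf p; rewrite graded_m3 // => ->; exact: subspace0.
exists (f p), 0; rewrite addr0; split; last by split=> //; exact: subspace0 subspace_real_ge_m1.
by have <- : p = -2 by lia.
Qed.

(** Degree -2 consists of brackets of elements of degree -1, so the filtration is
    exhausted after one step. *)
Lemma gfilS k : gfil br u k.+1 = [set: c].
Proof.
elim: k => [|k IH].
  apply/seteqP; split=> // x _.
  have -> : gfil br u 1 = setadd real_ge_m1
      (lspan [set z | exists x y, real_ge_m1 x /\ real_ge_m1 y /\ z = br x y]).
    by rewrite -gfil0.
  have [_ [g [/bracket_m2[v [w [gv gw ->]]] [bg ->]]]] := graded_split x.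
  exists g, (br v w); rewrite addrC; split=> //; split=> //; apply: sub_lspan; exists v, w.
  by do !split; [exact: gr_real_ge_m1 gv | exact: gr_real_ge_m1 gw].
apply/seteqP; split=> // x _; rewrite -/(gfil br u k.+1) /=.
exists x, 0; rewrite addr0; split; first by have := @Logic.I; rewrite -[True]/([set: c] x) -IH.
by split=> //; exact: subspace0 (subspace_lspan _).
Qed.

Lemma core_neg (p : int) : p <= -2 ->
  set_bij (@cd_gr R cM p) (coreneg br u p) (coset (gg br u (p + 1))).
Proof.
move=> p2 /=; have -> : (p < 0) = true by lia.
have [p3|p3] := ltP p (-2).
  rewrite graded_m3 // /coreneg /gg.
  have -> : absz (p + 1)%R = (absz (p + 2)%R).+1 by lia.
  have -> : absz (p + 1 + 1)%R = (absz (p + 3)%R).+1 by lia.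
  rewrite !gfilS; apply: quo_bij => //; first exact: subspace_set0.
  by move=> x _; exists 0, x; rewrite add0r.
have -> : p = -2 by lia.
rewrite /coreneg /gg -[absz _]/1%N -[absz (-2 + 1 + 1)%R]/0%N gfilS gfil0.
apply: quo_bij => //; first exact: subspace_real_ge_m1.
  by move=> x _; exact: graded_split.
move=> x [gx bx]; apply: rl_inj; have : cplxset (gr (-2)) (rl x) by split=> //; exact: subspace0.
rewrite graded_band => b2.
suff : (band (fun r s => (r + s)%:Z = -2 + 2) `&` band (fun r s => (0 < r + s)%N)) (rl x).
  by rewrite bandI; apply: band_eq0 => r s; lia.
by split.
Qed.

Lemma core_bracketE v w : gr (-1) v -> gr (-1) w ->
  core_bracket br u (coset (qqbar br u 0) (rl v)) (coset (qqbar br u 0) (rl w)) =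
  coset (gg br u (-1)) (br v w).
Proof.
move=> gv gw; rewrite /core_bracket (@qqbar_band 0 2) //.
have -> : gg br u (-1) = real_ge_m1 by exact: gfil0.
pose Q1 r s := (0 < r + s)%N; pose Q2 r s := (1 < r + s)%N.
have Q12 : forall r s, Q2 r s -> Q1 r s by rewrite /Q1 /Q2; lia.
have -> : band (fun a b => ufil (2.-1) a b \/ ufil (2.-1) b a) = band Q2.
  by apply: band_ext => r s; rewrite /ufil /Q2; lia.
have b1 x : gr (-1) x -> band Q1 (rl x) by exact: gr_real_ge_m1.
have bb x y : band Q1 x -> band Q2 y -> band Q1 (cbr br x y).
  by apply: band_bracket => r s r' s' a b; rewrite /Q1 /Q2; lia.
have bb' x y : band Q2 x -> band Q1 y -> band Q1 (cbr br x y).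
  by apply: band_bracket => r s r' s' a b; rewrite /Q1 /Q2; lia.
apply/seteqP; split=> z; last first.
  move=> gz; exists v, w; split; first by rewrite /coset /= subrr; exact: subspace0 (subspace_band _).
  by split=> //; rewrite /coset /= subrr; exact: subspace0 (subspace_band _).
move=> [x [y [bx [by_ gz]]]]; rewrite /coset /=.
have -> : z - br v w = (z - br x y) + (br (x - v) y + br v (y - w)).
  by rewrite (lieBl hl) (lieBr hl) (addrA (br x y - _)) subrK addrA subrK.
apply: (subspaceD subspace_real_ge_m1) => //; rewrite /coset /= -!rlB in bx by_.
have by1 : band Q1 (rl y).
  rewrite -[y](subrK w) rlD; apply: (subspaceD (subspace_band _)); last exact: b1.
  exact: band_sub by_.
apply: (subspaceD subspace_real_ge_m1); rewrite /real_ge_m1 /repart /= -(cbr_rl hl).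
  exact: bb'.
by apply: bb => //; exact: b1.
Qed.

(** Changing v by q_{p+1} and w by conj q_0 changes the bracket by bidegrees in
    q_p + conj q, and q_{p-1} meets q_p + conj q in q_p only. *)
Lemma core_LE (p : nat) v w : @cd10 R cM p v -> @cd01 R cM (-1) w ->
  core_L br u p (coset (qq br u (p%:Z + 1)) v) (coset (conjset (qq br u 0)) w) =
  coset (qq br u p) (cbr br v w).
Proof.
rewrite (@coreM_10 p p.+2) ?coreM_01_m1; try lia.
move=> Bv Bw; rewrite /core_L ualg_bar.
rewrite (@qq_band (p%:Z - 1) p.+1) ?(@qq_band (p%:Z + 1) p.+3) ?(@qq_band p%:Z p.+2)
  ?(@qq_band 0 2) //=; try lia.
rewrite band_conj band_add.
have Bvw := bidegree_bracket Bv Bw.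
apply/seteqP; split=> Z; rewrite /coset /=.
  move=> [bZ [X [Y [bX [bY bZXY]]]]].
  have e : Z - cbr br v w = (Z - cbr br X Y) + (cbr br (X - v) Y + cbr br v (Y - w)).
    by rewrite (lieBl lh) (lieBr lh) (addrA (cbr br X Y - _)) subrK addrA subrK.
  have bY' : band (fun r s => 0 < s)%N Y.
    rewrite -[Y](subrK w); apply: (subspaceD (subspace_band _)).
      by apply: band_sub bY => r s [].
    by apply: bidegree_band Bw.
  (* Q is q_p + conj q. *)
  pose Q a b := ufil p.+1 a b \/ (0 < b)%N.
  have b1 : band Q (Z - cbr br v w).
    rewrite e; apply: (subspaceD (subspace_band _)) => //; apply: (subspaceD (subspace_band _)).
      by apply: band_bracket bX bY' => r s r' s' a b; rewrite /Q /ufil; lia.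
    rewrite bidegreeE in Bv; apply: band_bracket Bv bY => r s r' s' a b; rewrite /Q /ufil; lia.
  have b2 : band (ufil p) (Z - cbr br v w).
    apply: (subspaceB (subspace_band _)) => //; apply: band_sub Bvw => a b; rewrite /ufil; lia.
  suff : (band Q `&` band (ufil p)) (Z - cbr br v w).
    by rewrite bandI; apply: band_sub => a b; rewrite /Q /ufil; lia.
  by split.
move=> bZ; split.
  rewrite -[Z](subrK (cbr br v w)); apply: (subspaceD (subspace_band _)).
    by apply: band_sub bZ => a b; rewrite /ufil; lia.
  by apply: band_sub Bvw => a b; rewrite /ufil; lia.
exists v, w; rewrite !subrr; split; first exact: subspace0 (subspace_band _).
split; first exact: subspace0 (subspace_band _).
by apply: band_sub bZ => a b; left.
Qed.

Lemma extremal_J2 r z : extremal r z -> adJ (adJ z) = - (r%:R ^+ 2) *: z.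
Proof.
have sS : subspace [set z | adJ (adJ z) = - (r%:R ^+ 2) *: z].
  split=> [|a x y /= xE yE]; rewrite /= ?(lie0r lh) ?scaler0 //.
  by rewrite !(lieDr lh) !(lieZr lh) xE yE scalerDr !scalerA mulrC.
apply: (band_min sS) => a b ab x [_ xE] /=; rewrite xE (lieZr lh) xE scalerA; congr (_ *: _).
rewrite mulrACA ii mulrN1 -expr2; congr (- _).
by case: ab => -[-> ->]; rewrite ?subr0 // sub0r sqrrN.
Qed.

Lemma adJ_extremal r z : extremal r z -> extremal r (adJ z).
Proof. by move=> ez a b ab; rewrite pr_adJ ez // scaler0. Qed.

Lemma coreM_neg_part : neg_part (@cd_gr R cM) = neg_part gr.
Proof.
apply/seteqP; split=> z [s [f [sP ->]]]; exists s, f; split=> // p /sP[p0 /=];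
  by rewrite p0.
Qed.

Lemma neg_part_sub S : subspace S -> gr (-1) `<=` S ->
  (forall x y, S x -> S y -> S (br x y)) -> neg_part gr `<=` S.
Proof.
move=> sS S1 Sbr; apply: bigsum_min => // p p0 x gx.
have [p3|p3] := ltP p (-2); first by move: gx; rewrite graded_m3 // => ->; exact: subspace0.
have [p1|p1] := eqVneq p (-1); first by apply: S1; rewrite -p1.
have p2 : p = -2 by lia.
by move: gx; rewrite p2 => /bracket_m2[v [w [gv gw ->]]]; apply: Sbr; exact: S1.
Qed.

Lemma subspace_neg_part : subspace (neg_part gr).
Proof. exact: subspace_bigsum. Qed.

Lemma neg_part_bracket x y : neg_part gr x -> neg_part gr y -> neg_part gr (br x y).
Proof.
have [_ _ _ gbr] := hgl => nx.
have sr z : subspace [set y | neg_part gr (br z y)].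
  split=> [|a u1 u2 h1 h2]; rewrite /= ?(lie0r hl); first exact: subspace0 subspace_neg_part.
  by rewrite (lieDr hl) (lieZr hl); exact: (subspaceZD subspace_neg_part).
have sl z : subspace [set y | neg_part gr (br y z)].
  split=> [|a u1 u2 h1 h2]; rewrite /= ?(lie0l hl); first exact: subspace0 subspace_neg_part.
  by rewrite (lieDl hl) (lieZl hl); exact: (subspaceZD subspace_neg_part).
apply: (bigsum_min (sr x)) y => q q0 y gy /=.
apply: (bigsum_min (sl y)) x nx => p p0 x gx /=.
by apply: (bigsum_mem (i := p + q)); [lia | exact: gbr].
Qed.

(** Because J annihilates c^{-2}, it is skew for the bracket of c^{-1}, and J^2 = -1
    turns this into invariance. *)
Lemma J_isotropic v w : gr (-1) v -> gr (-1) w -> br (br J v) (br J w) = br v w.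
Proof.
have [_ _ _ gbr] := hgl; have [gJ J2] := hJ; move=> gv gw.
have gJv x : gr (-1) x -> gr (-1) (br J x) by move=> gx; rewrite -[-1]add0r; exact: gbr.
have : br J (br v (br J w)) = 0 by apply: J2; exact: (gbr (-1) (-1)) gv (gJv _ gw).
rewrite (lie_jacobi hl) hJJ // (lieNr hl) => /eqP.
by rewrite subr_eq0 => /eqP.
Qed.

Lemma core_form_foldl k (v : cplx cM) ws : size ws = k.+1 -> core_form k v ws = foldl (cbr br) v ws.
Proof.
elim: k v ws => [|k IH] v [|w ws] //= [sz]; last exact: IH.
by case: ws sz.
Qed.

Lemma core_axioms_M : core_axioms cM.
Proof.
have [_ _ dgr gbr] := hgl.
have D p : -1 <= p -> exists2 r, (0 < r)%N & r%:Z = p + 2 by exists (absz (p + 2)%R); lia.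
rewrite /core_axioms coreM_neg_part; split.
- split=> [p|]; last first.
    by have [ind _] := dgr; apply: independent_sub ind => p _; split=> //; exact: coreM_sub_gr.
  have [p1|p1] := ltP p 0; first by rewrite /= p1; exact: hsub.
  have [|r r0 rp] := D p; first lia.
  by rewrite (coreM_gr r0 rp); apply: subspace_repart; exact: subspace_band.
- move=> p /D[r r0 rp].
  have rR : (p + 2)%:~R = r%:R :> R by rewrite -rp.
  rewrite (coreM_gr r0 rp) /= rR; split=> [x bx|a x y _ _|x bx].
  + apply: (subspaceZ (subspace_repart (subspace_band _))).
    by rewrite /repart /= -(cbr_rl hl); exact: adJ_extremal.
  + by rewrite (lieDr hl) (lieZr hl) scalerDr !scalerA mulrC.
  + apply: rl_inj; rewrite (lieZr hl) scalerA rlZ rlN -!(cbr_rl hl) (extremal_J2 bx) scalerA -[RHS]scaleN1r.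
    congr (_ *: _); rewrite mulrN -invfM -expr2 fmorphV rmorphXn rmorph_nat /= mulVf //.
    by rewrite expf_neq0 // pnatr_eq0 -lt0n.
- split.
  + split.
    * exact: neg_part_bracket.
    * move=> x _; split=> a y z _ _ /=; first by rewrite (lieDr hl) (lieZr hl).
      by rewrite (lieDl hl) (lieZl hl).
    * by move=> x _; exact: liexx.
    * by move=> x y z _ _ _; have [_ _ _ jac] := hl; exact: jac.
  + move=> p q x y p0 q0 /coreM_sub_gr gx /coreM_sub_gr gy /=.
    by have -> : p + q < 0 by [lia]; exact: gbr.
  + move=> v w gv gw /=; have -> : (-1 + 2)%:~R^-1 = 1 :> R by rewrite invr1.
    by rewrite !scale1r J_isotropic.
  + move=> S sS SN S1 Sbr; apply/seteqP; split=> //; exact: neg_part_sub.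
  + exact: nondegenerate_m1.
- move=> p; rewrite coreM_01_m1 (@coreM_10 p p.+2) //; last lia.
  split.
  + move=> v w Bv Bw; rewrite (@coreM_10 _ p.+1) //; last lia.
    have := bidegree_bracket Bv Bw; rewrite bidegreeE; apply: band_sub => a b; lia.
  + by move=> v _ a x y _ _; rewrite /= (lieDr lh) (lieZr lh).
  + by move=> v _ a x y _ _; rewrite /= (lieDl lh) (lieZl lh).
  + by move=> v Bv; exact: (bidegree_transitive (ltn0Sn p.+1) Bv).
  + move=> v ws ws' _ sz wsP pm; rewrite !core_form_foldl //; last by rewrite -(perm_size pm).
    apply: (foldl_bracket_perm lh) pm => w w' /wsP Bw /wsP Bw'.
    have := bidegree_bracket Bw Bw'; apply: band_eq0 => a b; lia.
Qed.

Lemma core_description (p : int) : 0 <= p ->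
  [/\ @cd_gr R cM p = repart (setadd (@cd10 R cM p) (@cd01 R cM p)),
      @cd01 R cM p = conjset (@cd10 R cM p),
      @cd10 R cM p = Sbi br gr J p (absz (p + 2)%R) 0%N /\
      @cd01 R cM p = Sbi br gr J p 0%N (absz (p + 2)%R) &
      @cd10 R cM p = E p (extr_eigenvalue R p) /\ @cd01 R cM p = E p (- extr_eigenvalue R p)].
Proof.
move=> p0; have [r rE [r0 rp]] : exists2 r, r = absz (p + 2)%R & (0 < r)%N /\ r%:Z = p + 2.
  by exists (absz (p + 2)%R) => //; lia.
rewrite -rE (coreM_10 r0 rp) (coreM_01 r0 rp) (coreM_gr r0 rp).
have [-> ->] := eigensp_extr rp; split=> //.
- by rewrite extremalE.
- by rewrite !bidegreeE band_conj; apply: band_ext => a b; lia.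
- by rewrite !Sbi_extremal //; (lia || by [left | right]).
Qed.
End Core.

(** * Universality of the core *)

Section Immersion.
Local Notation cM := (coreM br gr J).
Variables (m : core_data R) (psi : m -> c).
Local Notation gm := (@cd_gr R m).
Local Notation brm := (@cd_br R m).
Hypothesis hm : core_axioms m.
Hypothesis dm : is_direct_sum predT gm [set: m].
Hypothesis hpsi : neg_iso brm gm br gr psi.
Hypothesis hpsiJ : forall v, gm (-1) v -> psi (@cd_J R m (-1) v) = br J (psi v).

Let sgm p : subspace (gm p). Proof. by have [[]] := hm. Qed.
Let scgm p : subspace (cplxset (gm p)). Proof. exact: subspace_cplxset. Qed.
Let axJ (p : int) : -1 <= p -> [/\ forall x, gm p x -> gm p (cd_J p x),
  linear_on (gm p) (@cd_J R m p) & forall x, gm p x -> cd_J p (cd_J p x) = - x].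
Proof. by have [_ h _ _] := hm; exact: h. Qed.
Local Notation psih := (cplxmap psi).

Lemma neg_part_gm (p : int) : p < 0 -> gm p `<=` neg_part gm.
Proof. by move=> p0 x gx; exact: (bigsum_mem (i := p)). Qed.

Lemma psi_linear_on (p : int) : p < 0 -> linear_on (gm p) psi.
Proof.
have [lpsi _ _] := hpsi => p0 a x y gx gy.
by apply: lpsi; exact: (neg_part_gm p0).
Qed.

Lemma subspace_cd (p : int) (a : C) : -1 <= p ->
  subspace [set z | cplxset (gm p) z /\ cplxmap (@cd_J R m p) z = a *: z].
Proof.
move=> p1; have [_ lJ _] := axJ p1; have lJc := cplxmap_linear_on (sgm p) lJ.
split; first by split; [exact: subspace0 | rewrite (linear_on0 (scgm p) lJc) scaler0].
move=> b x y [gx xE] [gy yE]; split; first exact: (subspaceZD (scgm p)).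
by rewrite lJc // xE yE scalerDr !scalerA mulrC.
Qed.

Lemma subspace_cd10 (p : int) : -1 <= p -> subspace (@cd10 R m p).
Proof. exact: subspace_cd. Qed.
Lemma subspace_cd01 (p : int) : -1 <= p -> subspace (@cd01 R m p).
Proof. exact: subspace_cd. Qed.

Lemma psih_linear_on (p : int) : p < 0 -> linear_on (cplxset (gm p)) psih.
Proof. by move=> p0; apply: cplxmap_linear_on => //; exact: psi_linear_on. Qed.

Lemma psih_J z : cplxset (gm (-1)) z -> psih (cplxmap (@cd_J R m (-1)) z) = adJ (psih z).
Proof.
by move=> [g1 g2]; rewrite /cplxmap /cbr /= !hpsiJ // !(lie0l hl) subr0 addr0.
Qed.

Lemma psih_bij : set_bij (cplxset (gm (-1))) (cplxset (gr (-1))) psih.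
Proof.
have [_ /(_ (-1) isT)[fpsi ipsi spsi] _] := hpsi; split.
- by move=> z [g1 g2]; split; exact: fpsi.
- move=> [x1 x2] [y1 y2]; rewrite !inE => -[/= gx1 gx2] [/= gy1 gy2] [e1 e2].
  by congr (_, _); apply: ipsi; rewrite ?inE.
- by move=> [x1 x2] [/= /spsi[y1 g1 <-] /spsi[y2 g2 <-]]; exists (y1, y2).
Qed.

(** Applied to a = i and a = -i: psi identifies the (10)- and (01)-vectors of m^{-1}
    with those of c^{-1}. *)
Lemma psih_eigen (a : C) : set_bij [set z | cplxset (gm (-1)) z /\ cplxmap (@cd_J R m (-1)) z = a *: z]
  (E (-1) a) psih.
Proof.
have [f1 i1 s1] := psih_bij; have lpsi := psih_linear_on (p := -1) isT; split.
- by move=> z [gz zE]; split; [exact: f1 | rewrite -psih_J // zE (linear_onZ (scgm _) lpsi)].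
- by move=> x y; rewrite !inE => -[gx _] [gy _]; apply: i1; rewrite inE.
- move=> y [gy yE]; have [z gz zy] := s1 y gy; exists z => //; split=> //.
  have [gJ _ _] := axJ (p := -1) isT.
  apply: i1; rewrite ?inE; first by case: gz => ? ?; split; exact: gJ.
    exact: subspaceZ.
  by rewrite psih_J // zy yE (linear_onZ (scgm _) lpsi) // zy.
Qed.

Lemma psih_10 : set_bij (@cd10 R m (-1)) (B 1 0) psih.
Proof. by have [<- _] := @eigensp_extr (-1) 1 erefl; rewrite /extr_eigenvalue mul1r; exact: psih_eigen. Qed.
Lemma psih_01 : set_bij (@cd01 R m (-1)) (B 0 1) psih.
Proof. by have [_ <-] := @eigensp_extr (-1) 1 erefl; rewrite /extr_eigenvalue mul1r; exact: psih_eigen. Qed.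

Lemma psih_bracket x y : cplxset (gm (-1)) x -> cplxset (gm (-1)) y ->
  psih (cbr brm x y) = cbr br (psih x) (psih y).
Proof.
move=> [x1 x2] [y1 y2]; have [_ _ bpsi] := hpsi; have [_ _ [_ gbr _ _ _] _] := hm.
have n1 := neg_part_gm (p := -1) isT.
have g2 u v : gm (-1) u -> gm (-1) v -> gm (-2) (brm u v) by exact: (gbr (-1) (-1)).
have lpsi := psi_linear_on (p := -2) isT.
rewrite /cplxmap /cbr /= (linear_onB (sgm _) lpsi) ?(linear_onD lpsi); try exact: g2.
by rewrite !bpsi //; exact: n1.
Qed.

Let axL (p : nat) :
  [/\ forall v w : cplx m, cd10 p v -> cd01 (-1) w -> cd10 (p%:Z - 1) (cd_L p v w),
      forall v : cplx m, cd10 p v -> linear_on (@cd01 R m (-1)) (cd_L p v),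
      forall w : cplx m, cd01 (-1) w -> linear_on (@cd10 R m p) (cd_L p ^~ w),
      forall v : cplx m, cd10 p v -> (forall w : cplx m, cd01 (-1) w -> cd_L p v w = 0) -> v = 0 &
      forall (v : cplx m) (ws ws' : seq (cplx m)), cd10 p v ->
        size ws = p.+2 -> (forall w : cplx m, w \in ws -> cd01 (-1) w) ->
        perm_eq ws ws' -> core_form p.+1 v ws = core_form p.+1 v ws'].
Proof. by have [_ _ _ h] := hm; exact: h. Qed.

Let degS (k : nat) : k.+1%:Z - 1 = k%:Z. Proof. by lia. Qed.

Lemma psih_inj10 x : @cd10 R m (-1) x -> psih x = 0 -> x = 0.
Proof.
move=> x10; have [_ i10 _] := psih_10; have lpsi := psih_linear_on (p := -1) isT.
rewrite -(linear_on0 (scgm _) lpsi) => /i10; apply; rewrite inE //.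
exact: subspace0 (subspace_cd10 _).
Qed.

(** By injectivity of the maps L and nondegeneracy, a (10)-vector of an abstract core is
    determined by its multilinear form. *)
Lemma core_form_inj k x y : @cd10 R m (k%:Z - 1) x -> @cd10 R m (k%:Z - 1) y ->
  (forall ws : seq (cplx m), size ws = k.+1 -> (forall w : cplx m, w \in ws -> cd01 (-1) w) ->
     core_form k x ws = core_form k y ws) -> x = y.
Proof.
elim: k x y => [|k IH] x y.
  move=> x10 y10 xy; have lpsi := psih_linear_on (p := -1) isT.
  have [[gx _] [gy _]] := (x10, y10); have [fp _ _] := psih_10; have [_ _ sp] := psih_01.
  apply: subr0_eq; apply: psih_inj10; first exact: (subspaceB (subspace_cd10 _)).
  rewrite (linear_onB (scgm _) lpsi) //; apply: (bidegree_transitive (r := 1)) => //.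
    by apply: (subspaceB (subspace_bidegree _ _)); exact: fp.
  move=> w /sp[w' w01 <-]; have [gw _] := w01.
  rewrite (lieBl lh) -!psih_bracket //.
  have := xy [:: w'] erefl; rewrite /= => -> //; first by rewrite subrr.
  by move=> w''; rewrite inE => /eqP ->.
rewrite degS => x10 y10 xy; have [L10 lL lLl Linj _] := axL k.
apply: subr0_eq; apply: Linj; first exact: (subspaceB (subspace_cd10 _)).
move=> w w01; have s10 := subspace_cd10 (p := k%:Z) isT.
rewrite (linear_onB s10 (lLl _ w01)) //; apply/eqP; rewrite subr_eq0; apply/eqP.
apply: IH; try exact: L10.
move=> ws sz wsP; have := xy (w :: ws); rewrite /= sz; apply=> // w'.
by rewrite inE => /predU1P[->//|/wsP].
Qed.

(** The image in M of a (10)-vector of degree k - 1: the element of bidegree (k + 1, 0)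
    with prescribed brackets with (01)-vectors. *)
Fixpoint lift10 (k : nat) (v : cplx m) : cplx c :=
  if k is k'.+1 then
    xget 0 [set Z | B k.+1 0 Z /\ forall w : cplx m, cd01 (-1) w ->
                      cbr br Z (psih w) = lift10 k' (cd_L k' v w)]
  else psih v.

(** The properties of lift10 at step k that make step k + 1 possible. *)
Definition lift_ok (k : nat) : Prop :=
  [/\ forall v : cplx m, cd10 (k%:Z - 1) v -> B k.+1 0 (lift10 k v),
      linear_on (@cd10 R m (k%:Z - 1)) (lift10 k) &
      if k is k'.+1 then forall v w : cplx m, cd10 (k%:Z - 1) v -> cd01 (-1) w ->
        cbr br (lift10 k v) (psih w) = lift10 k' (cd_L k' v w) else True].

(** The uniqueness behind the definition of lift10. *)
Lemma transitive_eq r Z Z' : (0 < r)%N -> B r 0 Z -> B r 0 Z' ->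
  (forall w : cplx m, cd01 (-1) w -> cbr br Z (psih w) = cbr br Z' (psih w)) -> Z = Z'.
Proof.
move=> r0 BZ BZ' ZZ'; have [_ _ s01] := psih_01; apply: subr0_eq.
apply: (bidegree_transitive r0); first exact: (subspaceB (subspace_bidegree _ _)).
by move=> v /s01[w w01 <-]; rewrite (lieBl lh) ZZ' // subrr.
Qed.

(** The prescribed bracket is extended by 0 to (10)-vectors, and prolonged. The
    prolongation condition for two (01)-vectors w, w' is that lift10 of L(L(v)(w))(w')
    is symmetric in w and w', which is an axiom of abstract cores. The component of
    bidegree (k + 2, 0) of the prolongation has the same brackets with c^{-1} as the
    prolongation itself, hence equals it. *)
Lemma lift10_exists k v : lift_ok k -> @cd10 R m k v ->
  exists Z, B k.+2 0 Z /\ forall w : cplx m, cd01 (-1) w -> cbr br Z (psih w) = lift10 k (cd_L k v w).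
Proof.
move=> [lB lL lok] v10; have [L10 lL1 _ _ Lperm] := axL k.
have [f01 i01 s01] := psih_01.
have lpsi := psih_linear_on (p := -1) isT.
have s1 := subspace_cd01 (p := -1) isT.
(* wof is the inverse of psi on (01)-vectors. *)
pose wof x := xget 0 [set w | @cd01 R m (-1) w /\ psih w = x].
have wofP x : B 0 1 x -> @cd01 R m (-1) (wof x) /\ psih (wof x) = x.
  by move=> /s01[w w01 wx]; rewrite /wof; case: xgetP => // /(_ w)[].
have wofK w : @cd01 R m (-1) w -> wof (psih w) = w.
  by move=> w01; have [w1 w2] := wofP _ (f01 _ w01); apply: i01; rewrite ?inE.
pose FF a := lift10 k (cd_L k v (wof (pr (0, 1)%N a))).
have pB a : B 0 1 (pr (0, 1)%N a) by exact: (prB (0, 1)%N).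
have BFF a : B k.+1 0 (FF a) by apply: lB; apply: L10 => //; case: (wofP _ (pB a)).
have FFw w : @cd01 R m (-1) w -> FF (psih w) = lift10 k (cd_L k v w).
  by move=> w01; rewrite /FF pr_id ?wofK //; exact: f01.
have FF0 : lift10 k (cd_L k v 0) = 0.
  rewrite (linear_on0 s1 (lL1 _ v10)); apply: (linear_on0 _ lL).
  by apply: subspace_cd10; lia.
have FFlin : linear FF.
  move=> a x y; rewrite /FF prL.
  have [w1 e1] := wofP _ (pB x); have [w2 e2] := wofP _ (pB y).
  have -> : wof (a *: pr (0, 1)%N x + pr (0, 1)%N y) = a *: wof (pr (0, 1)%N x) + wof (pr (0, 1)%N y).
    have w12 := subspaceZD s1 a w1 w2.
    by rewrite -[RHS]wofK // lpsi ?e1 ?e2 //; [case: w1 | case: w2].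
  by rewrite (lL1 _ v10) // lL //; exact: L10.
have FF10 a : B 1 0 a -> FF a = 0.
  move=> Ba; rewrite /FF (pr_0 _ (y := (1, 0)%N)) //.
  suff -> : wof 0 = 0 by [].
  by rewrite -[X in wof X](linear_on0 (scgm _) lpsi) wofK //; exact: subspace0 s1.
have FFz : FF 0 = 0 by apply: FF10; exact: subspace0 (subspace_bidegree _ _).
have b10 r a z : B r.+1 0 z -> B 1 0 a -> cbr br z a = 0.
  move=> Bz Ba; have := bidegree_bracket Bz Ba; apply: band_eq0 => r' s'; lia.
(* For k = 0 this is the symmetry of the form of v; for larger k both sides are lifts of
   elements of degree k - 2, which agree because their forms do. *)
have key w w' : @cd01 R m (-1) w -> @cd01 R m (-1) w' ->
    cbr br (lift10 k (cd_L k v w)) (psih w') = cbr br (lift10 k (cd_L k v w')) (psih w).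
  move=> w1 w1'.
  have hp ws : size ws = k -> (forall x : cplx m, x \in ws -> cd01 (-1) x) ->
      core_form k.+1 v (w :: w' :: ws) = core_form k.+1 v (w' :: w :: ws).
    move=> sz wsP; apply: Lperm => //=; rewrite ?sz //; last by apply/seq.permP => P /=; rewrite addnCA.
    by move=> x; rewrite !inE => /predU1P[->//|/predU1P[->//|/wsP]].
  case: k v10 lB lL lok L10 lL1 {Lperm FF BFF FFw FF0 FFlin FF10 FFz} hp => [|k] v10 lB lL lok L10 lL1 hp.
    have g x : @cd01 R m (-1) x -> cplxset (gm (-1)) x by case.
    have g' x : @cd01 R m (-1) x -> cplxset (gm (-1)) (cd_L 0 v x) by move=> /(L10 _ _ v10)[].
    have e : cbr brm (cd_L 0 v w) w' = cbr brm (cd_L 0 v w') w by exact: (hp [::]).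
    rewrite /= -psih_bracket; [|exact: g'|exact: g].
    by rewrite e psih_bracket; [|exact: g'|exact: g].
  rewrite !lok //; try exact: L10.
  congr (lift10 k _); have [K10 _ _ _ _] := axL k.
  have L10' x : @cd01 R m (-1) x -> @cd10 R m k (cd_L k.+1 v x).
    by move=> x1; have := L10 _ _ v10 x1; rewrite degS.
  apply: (@core_form_inj k); try by apply: K10 => //; exact: L10'.
  by move=> ws sz wsP; exact: hp.
have span1 (P : cplx c -> Prop) : (forall a x y, P x -> P y -> P (a *: x + y)) -> P 0 ->
    (forall a, B 1 0 a -> P a) -> (forall w : cplx m, cd01 (-1) w -> P (psih w)) ->
    forall a, cplxset (gr (-1)) a -> P a.
  move=> PD P0 P1 P2 a; rewrite graded_band; apply: (band_min (S := P)) => // r s rs x Bx.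
  have [rE|sE] : (r = 1 /\ s = 0 \/ r = 0 /\ s = 1)%N by lia.
    by apply: P1; case: rE Bx => -> ->.
  by case: sE Bx => -> -> /s01[w w01 <-]; exact: P2.
have [|||||f [gf fF]] := cs_prolongation cs (p := k) (FF := FF).
- by [].
- by move=> a x y _ _; exact: FFlin.
- move=> a _; have [+ _] := BFF a; by have -> : (k.+1 + 0)%:Z - 2 = k%:Z - 1 by lia.
- move=> a b ga gb; move: a ga b gb.
  apply: (span1) => [a x y hx hy b gb||a Ba b gb|w w01].
  + by rewrite FFlin (lieDl lh) (lieDr lh) (lieZl lh) (lieZr lh) hx // hy.
  + by move=> b _; rewrite FFz (lie0l lh) (lie0r lh).
  + by rewrite (FF10 _ Ba) (lie0l lh) (b10 k _ _ (BFF _) Ba).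
  apply: (span1) => [a x y hx hy||a Ba|w' w01'].
  + by rewrite FFlin (lieDl lh) (lieDr lh) (lieZl lh) (lieZr lh) hx // hy.
  + by rewrite FFz (lie0l lh) (lie0r lh).
  + by rewrite (FF10 _ Ba) (lie0l lh) (b10 k _ _ (BFF _) Ba).
  by rewrite !FFw // key.
- move=> a e _; rewrite graded_band => be; have Ba := BFF a.
  rewrite bidegreeE in Ba; have : band (fun _ _ => False) (cbr br (FF a) e).
    by apply: band_bracket Ba be => r s r' s' a' b'; lia.
  by apply: band_eq0 => r s [].
exists f; split; last first.
  by move=> w w01; rewrite fF ?FFw //; have [g _ _] := psih_bij; apply: g; case: w01.
(* The brackets of f with (01)-vectors have bidegree (k + 1, 0) and those with
   (10)-vectors vanish, so the components of f with s > 0 commute with c^{-1}. *)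
pose f' := f - pr (k.+2, 0)%N f.
have Bp : B k.+2 0 (pr (k.+2, 0)%N f) by exact: (prB (k.+2, 0)%N).
have gp : cplxset (gr k) (pr (k.+2, 0)%N f).
  by have [+ _] := Bp; have -> : (k.+2 + 0)%:Z - 2 = k%:Z by lia.
suff -> : f = pr (k.+2, 0)%N f by [].
apply: subr0_eq; rewrite -/f'; apply: (@nondegenerate_cplx k); first lia.
  exact: (subspaceB (csub _)).
have bf' : band (fun r s => (r + s)%N = k.+2 /\ (0 < s)%N) f'.
  move=> r s nQ; rewrite /f' prD prN.
  have [[rE sE]|rs] := pselect ((r + s)%N = k.+2 /\ s = 0%N).
    have -> : r = k.+2 by lia.
    by rewrite sE (pr_id (x := (k.+2, 0)%N) Bp) subrr.
  move: gf; rewrite graded_band => -> /=; last lia.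
  rewrite (prE _ (y := (k.+2, 0)%N) Bp); case: eqP => [[rE sE]|_]; last by rewrite subrr.
  by case: rs; rewrite rE sE addn0.
apply: (span1) => [a x y /= hx hy||a Ba|w w01] /=.
- by rewrite (lieDr lh) (lieZr lh) hx hy scaler0 addr0.
- exact: lie0r lh _.
- have ga : cplxset (gr (-1)) a by case: Ba.
  by rewrite (lieBl lh) fF // FF10 // (b10 k.+1) // subrr.
have [gw _] := f01 _ w01.
have b1 : band (fun r s => (0 < s)%N) (cbr br f' (psih w)).
  have := f01 _ w01; rewrite bidegreeE => bw.
  by apply: band_bracket bf' bw => r s r' s' a b; lia.
have b2 : band (fun r s => s = 0)%N (cbr br f' (psih w)).
  rewrite (lieBl lh) fF //; apply: (subspaceB (subspace_band _)); first exact: bidegree_band (BFF _).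
  by apply: band_sub (bidegree_bracket Bp (f01 _ w01)) => r s; lia.
suff : (band (fun r s => (0 < s)%N) `&` band (fun r s => s = 0)%N) (cbr br f' (psih w)).
  by rewrite bandI; apply: band_eq0 => r s; lia.
by split.
Qed.

Lemma lift10_spec k v : lift_ok k -> @cd10 R m k v ->
  B k.+2 0 (lift10 k.+1 v) /\ forall w : cplx m, cd01 (-1) w ->
    cbr br (lift10 k.+1 v) (psih w) = lift10 k (cd_L k v w).
Proof.
by move=> /lift10_exists h /h[Z ZP] /=; case: xgetP => // /(_ Z).
Qed.

Lemma lift10_ok k : lift_ok k.
Proof.
elim: k => [|k ok].
  split=> //; first by have [f _ _] := psih_10.
  move=> a x y [gx _] [gy _]; exact: (psih_linear_on (p := -1)).
have spec := lift10_spec ok; have [lB lL _] := ok; have [L10 lL1 lLl _ _] := axL k.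
rewrite /lift_ok degS; split.
- by move=> v /spec[].
- move=> a x y x10 y10; have xy10 := subspaceZD (subspace_cd10 (p := k%:Z) isT) a x10 y10.
  have [[[B1 e1] [B2 e2]] [B3 e3]] := (spec _ x10, spec _ y10, spec _ xy10).
  apply: (transitive_eq (r := k.+2)) => //; first exact: (subspaceZD (subspace_bidegree _ _)).
  move=> w w01; rewrite e3 // (lieDl lh) (lieZl lh) e1 // e2 // (lLl _ w01) // lL //; exact: L10.
- by move=> v w v10 w01; have [_ ->] := spec _ v10.
Qed.

Lemma lift10_inj k v : @cd10 R m (k%:Z - 1) v -> lift10 k v = 0 -> v = 0.
Proof.
elim: k v => [|k IH] v; first exact: psih_inj10.
have [_ _ lok] := lift10_ok k.+1; move=> v10 v0; have vk := v10; rewrite degS in vk.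
have [L10 _ _ Linj _] := axL k; apply: Linj => // w w01; apply: IH; first exact: L10.
by rewrite -lok // v0 (lie0l lh).
Qed.

(** A real vector x of a core corresponds to x - iJx in its (10)-part, of which x is the
    real part. *)
Lemma cd10_pair (p : int) x : -1 <= p -> gm p x -> @cd10 R m p (x, - @cd_J R m p x).
Proof.
move=> p1 gx; have [gJ lJ JJ] := axJ p1; split; first by split=> //=; apply: (subspaceN (sgm p)); exact: gJ.
rewrite cplx_iZ /cplxmap /= opprK (linear_onN (sgm p) lJ); last exact: gJ.
by rewrite JJ // opprK.
Qed.

Lemma cd10_fst (p : int) (z : cplx m) : cd10 p z -> z.2 = - cd_J p z.1.
Proof. by case=> _; rewrite cplx_iZ => -[-> _]; rewrite opprK. Qed.

Definition phi_deg (p : int) (x : m) : c :=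
  if p < 0 then psi x else (lift10 (absz p).+1 (x, - @cd_J R m p x)).1.

Lemma phi_deg_lift (k : nat) z : @cd10 R m (k%:Z - 1) z -> cplxmap (phi_deg (k%:Z - 1)) z = lift10 k z.
Proof.
case: k => [|k] //; rewrite degS => z10; have k0 : (k%:Z < 0) = false by [].
rewrite /cplxmap /phi_deg k0 absz_nat.
have [_ lL _] := lift10_ok k.+1; rewrite degS in lL.
have s10 := subspace_cd10 (p := k%:Z) isT.
have e1 : (z.1, - cd_J k%:Z z.1) = z by rewrite -(cd10_fst z10); case: (z).
have e2 : (z.2, - cd_J k%:Z z.2) = - 'i%C *: z.
  by rewrite cplx_niZ; case: z10 => _; rewrite cplx_iZ => -[_ ->].
rewrite e1 e2 (linear_onZ s10 lL) // cplx_niZ.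
by case: (lift10 _ _).
Qed.

Lemma phi_deg_linear_on (p : int) : linear_on (gm p) (phi_deg p).
Proof.
rewrite /phi_deg; case: ltP => [p0|p0]; first exact: psi_linear_on.
case: p p0 => // k _; rewrite absz_nat => a x y gx gy.
have [_ lL _] := lift10_ok k.+1; rewrite degS in lL.
have [_ lJ _] := axJ (p := k%:Z) isT.
have x10 := cd10_pair (p := k%:Z) isT gx; have y10 := cd10_pair (p := k%:Z) isT gy.
have -> : (a *: x + y, - cd_J k%:Z (a *: x + y)) =
   (a%:C)%C *: ((x, - cd_J k%:Z x) : cplx m) + ((y, - cd_J k%:Z y) : cplx m).
  rewrite cplxDE cplxZE /= !scale0r subr0 addr0 lJ // opprD scalerN. by [].
by rewrite lL // cplxDE cplxZE /= scale0r subr0.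
Qed.

(** On real vectors of nonnegative degree the immersion is the real part of lift10 of
    x - iJx; being determined by transitivity, it is the only morphism extending psi. *)
Lemma immersion_exists : exists phi : {linear m -> cM},
  [/\ core_immersion phi,
      forall x, neg_part gm x -> phi x = psi x &
      forall phi' : {linear m -> cM}, core_morphism phi' ->
        (forall x, neg_part gm x -> phi' x = psi x) -> phi' =1 phi].
Proof.
have [phi phiE] := direct_sum_linear_extension (W := cM) sgm dm phi_deg_linear_on.
have [lpsi bpsi brpsi] := hpsi.
have phi_psi x : neg_part gm x -> phi x = psi x.
  have n0 : psi 0 = 0 by apply: (linear_on0 _ lpsi); apply: subspace_bigsum.
  move=> nx; have : subspace [set x | neg_part gm x /\ phi x = psi x].
    split; first by split; [exact: subspace0 (subspace_bigsum _) | rewrite linear0 n0].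
    move=> a u v [nu eu] [nv ev]; split; first exact: (subspaceZD (subspace_bigsum _)).
    by rewrite linearP eu ev lpsi.
  move=> sS; have : [set x | neg_part gm x /\ phi x = psi x] x; last by case.
  apply: (bigsum_min sS) nx => p p0 y gy; split; first exact: (neg_part_gm p0).
  by rewrite (phiE _ _ gy) /phi_deg p0.
have phi_lift k z : @cd10 R m (k%:Z - 1) z -> cplxmap phi z = lift10 k z.
  move=> z10; rewrite -phi_deg_lift //; have [[g1 g2] _] := z10.
  by rewrite /cplxmap (phiE _ _ g1) (phiE _ _ g2).
have phi10 k z : @cd10 R m (k%:Z - 1) z -> @cd10 R cM (k%:Z - 1) (cplxmap phi z).
  move=> z10; rewrite (phi_lift _ _ z10) (@coreM_10 _ k.+1) //; last lia.
  by have [lB _ _] := lift10_ok k; exact: lB.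
have phi_psih w : cplxset (gm (-1)) w -> cplxmap phi w = psih w.
  by move=> [g1 g2]; rewrite /cplxmap !phi_psi //; exact: (neg_part_gm (p := -1)).
have mor : core_morphism phi.
  split.
  - move=> p x gx; have [p0|p0] := ltP p 0.
      rewrite /= p0 phi_psi; last exact: (neg_part_gm p0).
      by have [f _ _] := bpsi p p0; exact: f.
    case: p p0 gx => // k _ gx.
    have := cd10_pair (p := k%:Z) isT gx; rewrite -degS => /phi10.
    by rewrite degS => -[[]].
  - move=> p x p1 gx; have [k kE] : exists k : nat, p = k%:Z - 1 by exists (absz (p + 1)%R); lia.
    rewrite kE in p1 gx *; have /phi10[_] := cd10_pair p1 gx.
    by rewrite cplx_iZ => -[e _]; have := esym e; rewrite linearN opprK.
  - move=> x y nx ny; rewrite /= !phi_psi //; first exact: brpsi.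
    by have [_ _ [[h _ _ _] _ _ _ _] _] := hm; exact: h.
  - move=> p v w v10 w01; have [L10 _ _ _ _] := axL p.
    have [_ _ lok] := lift10_ok p.+1.
    have v10' : @cd10 R m (p.+1%:Z - 1) v by rewrite degS.
    rewrite (phi_psih w); last by case: w01.
    rewrite (phi_lift p.+1 v) // (phi_lift p); last exact: L10.
    exact: lok.
exists phi; split=> //.
- split=> //; have [gphi _ _ _] := mor.
  suff inj0 x : phi x = 0 -> x = 0 by move=> x y xy; apply: subr0_eq; apply: inj0; rewrite linearB xy subrr.
  move=> x0; have [s [f [us gf f0 xE]]] := decomposition_exists sgm dm x.
  have [_ _ [ind _] _] := hgl.
  have f1 p : p \in s -> phi (f p) = 0.
    move=> ps; apply: (ind s (fun p => phi (f p))) => //; last by rewrite -linear_sum -xE.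
    by move=> q _; split=> //; apply: coreM_sub_gr; exact: gphi.
  rewrite xE big_seq big1 // => p ps; have := f1 p ps; have gx := gf p.
  have [p0|p0] := ltP p 0.
    rewrite phi_psi; last exact: (neg_part_gm p0).
    have [_ i _] := bpsi p p0.
    rewrite -(linear_on0 (sgm _) (psi_linear_on p0)) => /i; apply; rewrite inE //.
    exact: subspace0.
  case: p p0 ps gx => // k _ ps gx fx.
  have [gphi' Jphi _ _] := mor.
  have z10 : @cd10 R m (k.+1%:Z - 1) (f k, - cd_J k (f k)) by rewrite degS; exact: cd10_pair.
  have /(lift10_inj z10)[] // : lift10 k.+1 (f k, - cd_J k (f k)) = 0.
  have e2 : phi (cd_J k%:Z (f k)) = 0 by rewrite (Jphi k%:Z _ isT gx) fx /= (lie0r hl) scaler0.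
  by rewrite -phi_lift // /cplxmap /= linearN e2 fx oppr0.
- move=> phi' [gphi' Jphi' _ Lphi'] neg'.
  have phi'_psih w : cplxset (gm (-1)) w -> cplxmap phi' w = psih w.
    by move=> [g1 g2]; rewrite /cplxmap !neg' //; exact: (neg_part_gm (p := -1)).
  have phi'_lift k z : @cd10 R m (k%:Z - 1) z -> cplxmap phi' z = lift10 k z.
    elim: k z => [|k IH] z z10; first by rewrite phi'_psih //; case: z10.
    have [lB _ lok] := lift10_ok k.+1; apply: (transitive_eq (r := k.+2)) => //; last first.
    - rewrite degS in z10; move=> w w01; rewrite lok ?degS //; have [L10 _ _ _ _] := axL k.
      rewrite -IH; last exact: L10.
      by rewrite -(phi'_psih w); [exact: Lphi' | case: w01].
    - exact: lB.
    rewrite degS in z10; rewrite -(@coreM_10 k%:Z k.+2) //; last lia.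
    have [[g1 g2] zJ] := z10; split; first by split; exact: gphi'.
    have := congr1 (cplxmap phi') zJ; rewrite !cplx_iZ /cplxmap /= !(Jphi' k%:Z) // => -> /=.
    by rewrite linearN.
  move=> x; have [s [f [us gf f0 ->]]] := decomposition_exists sgm dm x.
  rewrite !linear_sum; apply: eq_bigr => p _; have gx := gf p.
  have [p0|p0] := ltP p 0; first by rewrite neg' ?phi_psi //; exact: (neg_part_gm p0).
  case: p p0 gx => // k _ gx.
  have z10 : @cd10 R m (k.+1%:Z - 1) (f k, - cd_J k (f k)) by rewrite degS; exact: cd10_pair.
  by have := phi_lift _ _ z10; rewrite -(phi'_lift _ _ z10) /cplxmap => -[].
Qed.
End Immersion.
End Components.
End Bigrading.

Theorem proposition3p4 (R : realType) (n : nat) (c : lmodType R)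
    (br : c -> c -> c) (gr : int -> set c) (J : c)
    (hn : (0 < n)%N)
    (hc : contact_algebra n br gr)
    (hJ : kpart br gr 0 J)
    (hJJ : forall v, gr (-1) v -> br J (br J v) = - v) :
  let u := ualg br gr J in
  let up := ucomp br gr J in
  let upbar := fun p => conjset (ucomp br gr J p) in
  let co := isotropy u in
  let cop := fun p => repart (up p `&` upbar p) in
  let M := coreM br gr J in
  let S := Sbi br gr J in
  let E := eigensp br gr J in
  let mu := extr_eigenvalue R in
  (* the two descriptions of u^p *)
  (forall p : int, -1 <= p ->
     is_direct_sum (uindex p (p + 2)) (usummand br gr J p) (up p) /\
     is_direct_sum (fun lambda => lambda != - mu p) (E p) (up p)) /\
  is_direct_sum (fun p : int => -1 <= p) up u /\
  (* (c, u) is a holomorphically nondegenerate CR algebra *)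
  lie_subalgebra (cbr br) u /\
  CR_algebra br u /\
  hol_nondegenerate br u /\
  (* (i) *)
  [/\ is_direct_sum (fun p : int => 0 <= p) cop co,
      (forall (p q : int) x y, 0 <= p -> 0 <= q -> cop p x -> cop q y ->
         cop (p + q) (br x y)) &
      (forall p : int, 0 <= p ->
         [/\ cop p `<=` gr p,
             is_direct_sum (uindex p (p + 1)) (usummand br gr J p)
               (up p `&` upbar p) &
             is_direct_sum
               (fun lambda => (lambda != mu p) && (lambda != - mu p)) (E p)
               (up p `&` upbar p)])] /\
  (* (ii) *)
  [/\ (* the components of the core are those of M ... *)
      (forall p : int, p <= -2 ->
         set_bij (@cd_gr R M p) (coreneg br u p) (coset (gg br u (p + 1)))),
      (forall p : int, -1 <= p ->
         [/\ set_bij (@cd_gr R M p) (corere br u p)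
               (fun x => coset (qqbar br u (p + 1)) (rl x)),
             set_bij (@cd10 R M p) (core10 br u p)
               (coset (qq br u (p + 1))) &
             set_bij (@cd01 R M p) (core01 br u p)
               (coset (conjset (qq br u (p + 1))))]),
      (* ... with the structure maps induced by the bracket, ... *)
      (forall v w, gr (-1) v -> gr (-1) w ->
         core_bracket br u (coset (qqbar br u 0) (rl v))
                           (coset (qqbar br u 0) (rl w)) =
         coset (gg br u (-1)) (br v w)) /\
      (forall (p : nat) v w, @cd10 R M p v -> @cd01 R M (-1) w ->
         core_L br u p (coset (qq br u (p%:Z + 1)) v)
                       (coset (conjset (qq br u 0)) w) =
         coset (qq br u p) (cbr br v w)),
      core_axioms M &
      (* ... where M^p is as follows. *)
      (forall p : int, p < 0 -> @cd_gr R M p = gr p) /\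
      (forall p : int, 0 <= p ->
         [/\ @cd_gr R M p = repart (setadd (@cd10 R M p) (@cd01 R M p)),
             @cd01 R M p = conjset (@cd10 R M p),
             @cd10 R M p = S p (absz (p + 2)%R) 0%N /\
             @cd01 R M p = S p 0%N (absz (p + 2)%R) &
             @cd10 R M p = E p (mu p) /\ @cd01 R M p = E p (- mu p)])] /\
  (* (iii) *)
  (forall (m : core_data R) (psi : m -> c),
     abstract_core m -> hypersurface_type m ->
     neg_iso (@cd_br R m) (@cd_gr R m) br gr psi ->
     (forall v, @cd_gr R m (-1) v -> psi (@cd_J R m (-1) v) = br J (psi v)) ->
     exists phi : {linear m -> M},
       [/\ core_immersion phi,
           forall x, neg_part (@cd_gr R m) x -> phi x = psi x &
           forall phi' : {linear m -> M}, core_morphism phi' ->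
             (forall x, neg_part (@cd_gr R m) x -> phi' x = psi x) ->
             phi' =1 phi]).
Proof.
have [T [Wt [M cs]]] := contact_algebra_structure hn hc hJ hJJ.
have [pr [prB prL pr_id pr_0 pr_sum]] :=
  projections_exist (fun x => subspace_bidegree J hc x.1 x.2) (bidegree_direct hn hc cs).
move=> u up upbar co cop MM S E mu.
have u_sub : lie_subalgebra (cbr br) u := ualg_subalgebra hn hc hJ cs prB prL pr_id pr_0 pr_sum.
split; [|split; [|split; [|split; [|split; [|split; [|split]]]]]].
- move=> p p1; split; first exact: (usummand_direct hn hc hJ cs p1).
  exact: (eigensp_ucomp_direct hn hc hJ cs prB prL pr_id pr_0 pr_sum p1).
- rewrite /u (ualg_band hn hc hJ cs prB prL pr_id pr_0 pr_sum).
  exact: (ualg_direct hn hc hJ cs prB prL pr_id pr_0 pr_sum).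
- exact: u_sub.
- by split=> //; case: hc => [[]].
- exact: (ualg_hol_nondegenerate hn hc hJ cs prB prL pr_id pr_0 pr_sum).
- split.
  + exact: (isotropy_direct hn hc hJ cs prB prL pr_id pr_0 pr_sum).
  + move=> p q x y; exact: (isotropy_bracket hn hc hJ cs prB prL pr_id pr_0 pr_sum).
  + move=> p p0; have p1 : -1 <= p by lia.
    split; first exact: (isotropy_graded hn hc hJ cs prB prL pr_id pr_0 pr_sum p0).
      exact: (usummand_cap_direct hn hc hJ cs prB prL pr_id pr_0 pr_sum p1).
    exact: (eigensp_cap_direct hn hc hJ cs prB prL pr_id pr_0 pr_sum p1).
- split.
  + exact: (core_neg hn hc hJ cs prB prL pr_id pr_0 pr_sum).
  + exact: (core_components hn hc hJ cs prB prL pr_id pr_0 pr_sum).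
  + split; first exact: (core_bracketE hn hc hJ cs prB prL pr_id pr_0 pr_sum).
    exact: (core_LE hn hc hJ cs prB prL pr_id pr_0 pr_sum).
  + exact: (core_axioms_M hn hc hJ hJJ cs prB prL pr_id pr_0 pr_sum).
  + split; first by move=> p p0; rewrite /= p0.
    exact: (core_description hn hc hJ cs prB prL pr_id pr_0 pr_sum).
- move=> m psi [hm dm _] _ hpsi hpsiJ.
  exact: (immersion_exists hn hc hJ cs prB prL pr_id pr_0 pr_sum hm dm hpsi hpsiJ).
Qed.
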